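(* Let $W, W_1, W_2$ be weights, and let $\mathcal{M}(W), \mathcal{M}(W_1), \mathcal{M}(W_2)$ be the corresponding spaces of modular forms on $\Gamma\backslash G$. Let $\mu_{1,2}\colon W \to W_1\otimes W_2$ be a homomorphism of $(\mathfrak{g},K)$-modules. If $F_1\in\mathcal{M}(W_1)$ and $F_2\in\mathcal{M}(W_2)$, then $$m_{1,2}(F_1,F_2) := m\circ (F_1\otimes F_2)\circ \mu_{1,2}$$ belongs to $\mathcal{M}(W)$. In this way, sending $\mu_{1,2}$ to the map $F_1\otimes F_2\mapsto m_{1,2}(F_1,F_2)$, one gets a linear map $$Co\colon \mathrm{Hom}_{(\mathfrak{g},K)}(W, W_1\otimes W_2)\to \mathrm{Hom}_{\mathbb{C}}(\mathcal{M}(W_1)\otimes\mathcal{M}(W_2),\mathcal{M}(W)).$$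
   Context: Setting: $\mathbf{G}$ is a connected semisimple algebraic group over $\mathbb{Q}$; $G=\mathbf{G}(\mathbb{R})$ is a connected semisimple real Lie group with finite center; $\mathfrak{g}=\mathrm{Lie}(\mathbf{G})\otimes_{\mathbb{Q}}\mathbb{C}$; $\mathcal{U}$ is its universal enveloping algebra, with center $\mathcal{Z}$; $K$ is a maximal compact subgroup of $G$; $\Gamma$ is an arithmetic subgroup of $\mathbf{G}(\mathbb{Q})$. Tensor products are over $\mathbb{C}$. A $(\mathfrak{g},K)$-module is a complex vector space with actions of $\mathfrak{g}$ and $K$, locally finite and semisimple as a $K$-module, with $k(Xw)=(\mathrm{Ad}(k)X)(kw)$, and such that on each finite-dimensional $K$-stable subspace the $K$-action is differentiable with differential equal to the restriction of the $\mathfrak{g}$-action to $\mathfrak{k}$. Tensor products of $(\mathfrak{g},K)$-modules carry the diagonal action ($X$ acts by $X\otimes 1+1\otimes X$, $k$ by $k\otimes k$). A Harish-Chandra module is a $(\mathfrak{g},K)$-module, finitely generated over $\mathcal{U}$, in which every irreducible representation of $K$ has finite multiplicity. A weight is an irreducible Harish-Chandra module with a unitary structure, i.e. a positive definite Hermitian inner product that is $K$-invariant and satisfies $\langle Xv,w\rangle+\langle v,Xw\rangle=0$ for all $X$ in the real Lie algebra of $G$. Fix a finite-dimensional complex representation $\sigma\colon G\to GL(E)$ with finite kernel and closed image, and a $\sigma(K)$-invariant Hilbert space structure on $E$; put $\|g\|=\sqrt{|\mathrm{tr}(\sigma(g)^*\sigma(g))|}$. An automorphic form is $f\in C^\infty(\Gamma\backslash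 G)$ such that (1) $f$ has moderate growth: there are a positive integer $n$ and a constant $C$ with $|f(g)|\le C\|g\|^n$ for all $g\in G$; (2) $f$ is right $K$-finite; (3) $f$ is right $\mathcal{Z}$-finite. $\mathcal{A}=\mathcal{A}(\Gamma\backslash G)$ is the space of automorphic forms, a $(\mathfrak{g},K)$-module under right translation. For a weight $W$, $\mathcal{M}(W)=\mathrm{Hom}_{(\mathfrak{g},K)}(W,\mathcal{A}(\Gamma\backslash G))$. The map $m\colon\mathcal{A}\otimes\mathcal{A}\to C^\infty(\Gamma\backslash G)$ is the linear map with $m(f_1\otimes f_2)=f_1\cdot f_2$ (pointwise product). *)

(* Defs.v *)
From HB Require Import structures.
From mathcomp Require Import all_boot all_order all_algebra.
From mathcomp Require Import generic_quotient ring_quotient.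
From mathcomp Require Import all_classical all_reals all_analysis.
From mathcomp.finmap Require Import finmap.
From mathcomp.real_closed Require Export complex.
From mathcomp.multinomials Require mpoly monalg.

Set Implicit Arguments.
Unset Strict Implicit.
Unset Printing Implicit Defensive.

(* The notations of multinomials are incompatible with those of analysis; only
   the canonical structures are needed here. *)
Import -(notations) mpoly monalg.
Import Order.TTheory GRing.Theory Num.Theory numFieldNormedType.Exports.
Local Open Scope classical_set_scope.
Local Open Scope ring_scope.
Local Open Scope quotient_scope.

Section LinearAlgebra.
Context {F : fieldType}.

Definition is_subspace (V : lmodType F) (S : set V) : Prop :=
  S 0 /\ forall (a : F) u v, S u -> S v -> S (a *: u + v).

(* The linear span of A is finite-dimensional. *)
Definition fin_dim_span (V : lmodType F) (A : set V) : Prop :=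
  exists s : seq V, forall v, A v ->
    exists c : nat -> F, v = \sum_(i < size s) c i *: s`_i.

Definition lin_indep (V : lmodType F) m (e : 'I_m -> V) : Prop :=
  forall a : 'I_m -> F, \sum_i a i *: e i = 0 -> forall i, a i = 0.

Definition stable (V : Type) (acts : set (V -> V)) (S : set V) : Prop :=
  forall f v, acts f -> S v -> S (f v).

Definition simple_sub (V : lmodType F) (acts : set (V -> V)) (S : set V) :=
  [/\ is_subspace S, stable acts S, exists2 v, S v & v != 0 &
      forall T : set V, is_subspace T -> stable acts T -> T `<=` S ->
        T `<=` [set 0] \/ S `<=` T].

Definition irreducible (V : lmodType F) (acts : set (V -> V)) : Prop :=
  simple_sub acts setT.

Definition semisimple (V : lmodType F) (acts : set (V -> V)) : Prop :=
  forall v : V, exists2 s : seq V, v = \sum_(x <- s) x &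
    forall x, x \in s -> exists2 S : set V, simple_sub acts S & S x.

Definition bilin (V W U : lmodType F) (b : V -> W -> U) : Prop :=
  (forall w, linear (b^~ w)) /\ (forall v, linear (b v)).

End LinearAlgebra.

Section SubspaceType.
Context {F : fieldType} {V : lmodType F} {S : set V}.

Definition subspace_pred (hS : is_subspace S) : {pred V} := fun v => `[< S v >].

Record subm (hS : is_subspace S) : predArgType :=
  Subm { subm_val : V; subm_valP : subm_val \in subspace_pred hS }.

Context (hS : is_subspace S).

Lemma subspace_predP v : reflect (S v) (v \in subspace_pred hS).
Proof. exact: asboolP. Qed.

Fact subspace_pred_submod : submod_closed (subspace_pred hS).
Proof.
case: hS (hS) => h0 hD h; split; first exact/asboolP.
by move=> a u v /asboolP Su /asboolP Sv; apply/asboolP; exact: hD.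
Qed.

HB.instance Definition _ := GRing.isSubmodClosed.Build F V
  (subspace_pred hS) subspace_pred_submod.
HB.instance Definition _ := [isSub of subm hS for @subm_val hS].
HB.instance Definition _ := [Choice of subm hS by <:].
HB.instance Definition _ := [SubChoice_isSubLmodule of subm hS by <:].

End SubspaceType.

Section LinearMaps.
Context {F : fieldType}.

Lemma linear_subspace (V W : lmodType F) :
  is_subspace [set f : V -> W | linear f].
Proof.
split; first by move=> a u v; rewrite /= scaler0 addr0.
move=> a f g lf lg b u v; rewrite /= !fctE.
by rewrite lf lg !scalerDr !scalerA mulrC addrACA.
Qed.

Definition linhom (V W : lmodType F) := subm (linear_subspace V W).

End LinearMaps.

Section Tensor.
Context {F : fieldType}.
Variables V W : lmodType F.

Definition free_tens := monalg.malg (V * W)%type F.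
Local Notation "<< v , w >>" := (monalg.mkmalgU (v, w) (1 : F)).

Definition tens_gen (x : free_tens) : Prop :=
  (exists (a : F) (v v' : V) (w : W),
     x = << a *: v + v', w >> - (a *: << v, w >> + << v', w >>)) \/
  (exists (a : F) (v : V) (w w' : W),
     x = << v, a *: w + w' >> - (a *: << v, w >> + << v, w' >>)).

Definition tens_rel (x : free_tens) : Prop :=
  forall S : set free_tens, is_subspace S -> tens_gen `<=` S -> S x.

Definition tens_pred : {pred free_tens} := fun x => `[< tens_rel x >].

Lemma tens_rel_subspace : is_subspace tens_rel.
Proof.
split; first by move=> S [].
by move=> a u v hu hv S hS hg; case: (hS) => _; apply; [exact: hu|exact: hv].
Qed.

Fact tens_pred_submod : submod_closed tens_pred.
Proof.
case: tens_rel_subspace => h0 hD; split; first exact/asboolP.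
by move=> a u v /asboolP Su /asboolP Sv; apply/asboolP; exact: hD.
Qed.

HB.instance Definition _ := GRing.isSubmodClosed.Build F free_tens
  tens_pred tens_pred_submod.

Definition tens := Quotient.quot tens_pred.

HB.instance Definition _ := GRing.Zmodule.on tens.
HB.instance Definition _ := EqQuotient.on tens.

Definition pi_tens (x : free_tens) : tens := \pi_tens x.
Definition repr_tens (x : tens) : free_tens := repr x.

Lemma repr_tensK : cancel repr_tens pi_tens.
Proof. exact: reprK. Qed.

Lemma pi_tensD : {morph pi_tens : x y / x + y}.
Proof. exact: (raddfD (\pi_(Quotient.quot tens_pred))). Qed.

Lemma pi_tensP (x y : free_tens) :
  reflect (pi_tens x = pi_tens y) (tens_pred (x - y)).
Proof.
rewrite -[tens_pred _]/((x - y) \in tens_pred) Quotient.idealrBE; exact: eqP.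
Qed.

Definition tens_scale (a : F) (x : tens) : tens := pi_tens (a *: repr_tens x).

Lemma pi_tensZ a x : pi_tens (a *: x) = tens_scale a (pi_tens x).
Proof.
apply/pi_tensP; rewrite -scalerBr -[_ (_ *: _)]/(_ \in tens_pred).
by apply: rpredZ; apply/pi_tensP; rewrite repr_tensK.
Qed.

Let tens_scaleA a b x : tens_scale a (tens_scale b x) = tens_scale (a * b) x.
Proof. by rewrite -[x]repr_tensK -!pi_tensZ scalerA. Qed.

Let tens_scale1 : left_id 1 tens_scale.
Proof. by move=> x; rewrite -[x]repr_tensK -pi_tensZ scale1r. Qed.

Let tens_scaleDr : right_distributive tens_scale +%R.
Proof.
move=> a x y; rewrite -[x]repr_tensK -[y]repr_tensK -pi_tensD -!pi_tensZ.
by rewrite scalerDr pi_tensD.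
Qed.

Let tens_scaleDl x : {morph tens_scale^~ x : a b / a + b}.
Proof.
by move=> a b; rewrite -[x]repr_tensK -!pi_tensZ scalerDl pi_tensD.
Qed.

HB.instance Definition _ := GRing.Zmodule_isLmodule.Build F tens
  tens_scaleA tens_scale1 tens_scaleDr tens_scaleDl.

Definition tprod (v : V) (w : W) : tens := pi_tens << v, w >>.

End Tensor.

Arguments tprod {F V W}.
Arguments pi_tens {F V W}.
Arguments repr_tens {F V W}.

Section TensorLift.
Context {F : fieldType}.

(* The linear extension v (x) w |-> b v w; meaningful when b is bilinear. *)
Definition tens_lift (V W U : lmodType F) (b : V -> W -> U) (x : tens V W) : U :=
  \sum_(k <- monalg.msupp (repr_tens x))
    monalg.mcoeff k (repr_tens x) *: b k.1 k.2.

Let free_lift (V W U : lmodType F) (b : V -> W -> U) (x : free_tens V W) : U :=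
  \sum_(k <- monalg.msupp x) monalg.mcoeff k x *: b k.1 k.2.

Let free_liftEw (V W U : lmodType F) (b : V -> W -> U) (x : free_tens V W)
    (d : {fset (V * W)%type}) :
  (monalg.msupp x `<=` d)%fset ->
  free_lift b x = \sum_(k <- d) monalg.mcoeff k x *: b k.1 k.2.
Proof.
move=> le; rewrite /free_lift (big_fset_incl _ le) //= => k _ kx.
by rewrite monalg.mcoeff_outdom // scale0r.
Qed.

Let free_lift_linear (V W U : lmodType F) (b : V -> W -> U) :
  linear (free_lift b).
Proof.
move=> a x y.
pose d := (monalg.msupp x `|` monalg.msupp y)%fset.
have hx : (monalg.msupp x `<=` d)%fset by exact: fsubsetUl.
have hy : (monalg.msupp y `<=` d)%fset by exact: fsubsetUr.
have hxy : (monalg.msupp (a *: x + y) `<=` d)%fset.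
  apply: (fsubset_trans (monalg.msuppD_le _ _)); rewrite fsubUset hy andbT.
  exact: fsubset_trans (monalg.msuppZ_le _ _) hx.
rewrite (free_liftEw b hx) (free_liftEw b hy) (free_liftEw b hxy).
rewrite scaler_sumr -big_split /=; apply: eq_bigr => k _.
by rewrite monalg.mcoeffD monalg.mcoeffZ scalerDl scalerA.
Qed.

Let free_liftU (V W U : lmodType F) (b : V -> W -> U) v w :
  free_lift b (monalg.mkmalgU (v, w) 1) = b v w.
Proof.
rewrite (free_liftEw b (@monalg.msuppU_le _ _ (v, w) 1)) big_seq_fset1.
by rewrite monalg.mcoeffUU scale1r.
Qed.

Let free_liftB (V W U : lmodType F) (b : V -> W -> U) x y :
  free_lift b (x - y) = free_lift b x - free_lift b y.
Proof.
by rewrite [x - y]addrC -[- y]scaleN1r free_lift_linear scaleN1r addrC.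
Qed.

Section Bilinear.
Context (V W U : lmodType F) (b : V -> W -> U) (hb : bilin b).

Let free_lift_rel x : tens_rel x -> free_lift b x = 0.
Proof.
move=> /(_ [set x | free_lift b x = 0]); apply.
  split; first by rewrite /= /free_lift monalg.msupp0 big_seq_fset0.
  by move=> a u v /= hu hv; rewrite free_lift_linear hu hv scaler0 addr0.
case: hb => hl hr x' /= [[a [v [v' [w ->]]]]|[a [v [w [w' ->]]]]].
  by rewrite free_liftB free_lift_linear !free_liftU (hl w a) subrr.
by rewrite free_liftB free_lift_linear !free_liftU (hr v a) subrr.
Qed.

Let tens_lift_pi x : tens_lift b (pi_tens x) = free_lift b x.
Proof.
have : tens_pred (repr_tens (pi_tens x) - x).
  by apply/pi_tensP; rewrite repr_tensK.
by move=> /asboolP /free_lift_rel /eqP; rewrite free_liftB subr_eq0 => /eqP.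
Qed.

Lemma tens_liftE v w : tens_lift b (tprod v w) = b v w.
Proof. by rewrite tens_lift_pi free_liftU. Qed.

Lemma tens_lift_linear : linear (tens_lift b).
Proof.
move=> a x y; rewrite -[x]repr_tensK -[y]repr_tensK.
have -> : a *: pi_tens (repr_tens x) + pi_tens (repr_tens y)
          = pi_tens (a *: repr_tens x + repr_tens y).
  by rewrite pi_tensD pi_tensZ.
by rewrite !tens_lift_pi free_lift_linear.
Qed.

End Bilinear.

Lemma tprod_bilin (V W : lmodType F) : bilin (@tprod F V W).
Proof.
split=> [w|v] a x y; rewrite /tprod.
  transitivity (pi_tens (a *: monalg.mkmalgU (x, w) 1 + monalg.mkmalgU (y, w) 1)).
    apply/pi_tensP/asboolP => S _; apply; left; by exists a, x, y, w.
  by rewrite pi_tensD pi_tensZ.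
transitivity (pi_tens (a *: monalg.mkmalgU (v, x) 1 + monalg.mkmalgU (v, y) 1)).
  apply/pi_tensP/asboolP => S _; apply; right; by exists a, v, x, y.
by rewrite pi_tensD pi_tensZ.
Qed.

(* f (x) g; meaningful when f and g are linear. *)
Definition tens_map (V W V' W' : lmodType F) (f : V -> V') (g : W -> W') :
    tens V W -> tens V' W' :=
  tens_lift (fun v w => tprod (f v) (g w)).

Lemma tens_map_bilin (V W V' W' : lmodType F) (f : V -> V') (g : W -> W') :
  linear f -> linear g -> bilin (fun v w => tprod (f v) (g w)).
Proof.
case: (tprod_bilin V' W') => hl hr lf lg.
by split=> [w|v] a x y; rewrite ?lf ?lg ?hr // (hl (g w)).
Qed.

Lemma tens_map_linear (V W V' W' : lmodType F) (f : V -> V') (g : W -> W') :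
  linear f -> linear g -> linear (tens_map f g).
Proof. by move=> lf lg; exact/tens_lift_linear/tens_map_bilin. Qed.

HB.instance Definition _ (V W V' W' : lmodType F) (f : {linear V -> V'})
    (g : {linear W -> W'}) :=
  GRing.isLinear.Build F (tens V W) (tens V' W') *:%R (tens_map f g)
    (tens_map_linear (linearP f) (linearP g)).

End TensorLift.

Section AlgebraicGroups.
Variable n : nat.

(* n x n matrices are flattened to n * n variables by mxvec. *)
Definition poly_at (A : nzRingType) (phi : rat -> A)
    (P : mpoly.mpoly (n * n) rat) (g : 'M[A]_n) : A :=
  mpoly.mmap phi (fun k => mxvec g 0 k) P.

Definition is_point (S : seq (mpoly.mpoly (n * n) rat)) (A : comNzRingType)
    (phi : {rmorphism rat -> A}) (g : 'M[A]_n) : Prop :=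
  (exists h : 'M[A]_n, g *m h = 1%:M /\ h *m g = 1%:M) /\
  (forall P, P \in S -> poly_at phi P g = 0).

(* A closed subgroup scheme of GL_n over Q: the equations cut out a subgroup of
   GL_n(A) for every commutative Q-algebra A.  (Over GL_n an equation involving
   1/det can be cleared of denominators, so polynomials in the entries suffice.) *)
Record alg_group := AlgGroup {
  ag_eqs : seq (mpoly.mpoly (n * n) rat);
  ag_closed : forall (A : comNzRingType) (phi : {rmorphism rat -> A}),
    [/\ is_point ag_eqs phi 1%:M,
        forall g h, is_point ag_eqs phi g -> is_point ag_eqs phi h ->
          is_point ag_eqs phi (g *m h) &
        forall g h, is_point ag_eqs phi g -> g *m h = 1%:M ->
          is_point ag_eqs phi h]
}.

Definition point_set (GG : alg_group) (F : numFieldType) : set 'M[F]_n :=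
  [set g | is_point (ag_eqs GG) (ratr : {rmorphism rat -> F}) g].
Arguments point_set : clear implicits.

Definition points (GG : alg_group) (F : numFieldType) : Type :=
  set_type (point_set GG F).

HB.instance Definition _ (GG : alg_group) (F : numFieldType) :=
  SubChoice.on (points GG F).

(* The differential at 1 of P, applied to X. *)
Definition diff_at1 (F : numFieldType) (P : mpoly.mpoly (n * n) rat)
    (X : 'M[F]_n) : F^o :=
  \sum_(k < n * n) poly_at ratr (mpoly.mderiv k P) (1%:M : 'M[F]_n) * mxvec X 0 k.

(* Lie(GG) (x)_Q F inside M_n(F): the X such that 1 + eps X is a point of GG over
   the dual numbers F[eps].  It is cut out by linear equations over Q. *)
Definition lie (GG : alg_group) (F : numFieldType) : {vspace 'M[F]_n} :=
  (\bigcap_(P <- ag_eqs GG) lker (linfun (@diff_at1 F P)))%VS.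

End AlgebraicGroups.

Arguments point_set {n}.
Arguments points {n}.
Arguments lie {n}.

Section PointsGroup.
Context {n : nat} {GG : alg_group n} {F : numFieldType}.
Local Notation G := (points GG F).

Lemma pointP (g : G) : point_set GG F (val g).
Proof. exact: set_mem (valP g). Qed.

Definition mk_point (x : 'M[F]_n) (hx : point_set GG F x) : G :=
  exist _ x (mem_set hx).

Lemma point_unit (g : G) : val g \in unitmx.
Proof. by case: (pointP g) => -[h [gh _]] _; case: (mulmx1_unit gh). Qed.

Definition pt_one : G.
Proof. by apply: (@mk_point 1%:M); case: (ag_closed GG (ratr : {rmorphism rat -> F})). Defined.

Definition pt_mul (g h : G) : G.
Proof.
apply: (@mk_point (val g *m val h)).
by case: (ag_closed GG (ratr : {rmorphism rat -> F})) => _ + _; apply; exact: pointP.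
Defined.

Definition pt_inv (g : G) : G.
Proof.
apply: (@mk_point (invmx (val g))).
case: (ag_closed GG (ratr : {rmorphism rat -> F})) => _ _; apply; first exact: pointP.
by rewrite mulmxV ?point_unit.
Defined.

Let pt_mulA : associative pt_mul.
Proof. by move=> x y z; apply: val_inj; rewrite /= mulmxA. Qed.
Let pt_mul1 : left_id pt_one pt_mul.
Proof. by move=> x; apply: val_inj; rewrite /= mul1mx. Qed.
Let pt_mulr1 : right_id pt_one pt_mul.
Proof. by move=> x; apply: val_inj; rewrite /= mulmx1. Qed.
Let pt_mulV : left_inverse pt_one pt_inv pt_mul.
Proof. by move=> x; apply: val_inj; rewrite /= mulVmx ?point_unit. Qed.
Let pt_mulrV : right_inverse pt_one pt_inv pt_mul.
Proof. by move=> x; apply: val_inj; rewrite /= mulmxV ?point_unit. Qed.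

HB.instance Definition _ :=
  isGroup.Build G pt_mulA pt_mul1 pt_mulr1 pt_mulV pt_mulrV.

End PointsGroup.

HB.instance Definition _ (n : nat) (GG : alg_group n) (R : realType) :=
  Topological.copy (points GG R) (set_type (point_set GG R)).

Section Subgroups.
Context {gT : groupType}.
Local Open Scope group_scope.

Definition is_subgroup (H : set gT) : Prop :=
  H 1 /\ forall x y, H x -> H y -> H (x * y^-1).

Definition is_normal (H : set gT) : Prop := forall g x, H x -> H (g * x * g^-1).

Definition derived (H : set gT) : set gT :=
  [set z | forall D : set gT, is_subgroup D ->
     (forall x y, H x -> H y -> D (x^-1 * y^-1 * x * y)) -> D z].

Definition is_solvable (H : set gT) : Prop :=
  exists k, iter k derived H `<=` [set 1].

(* D has finite index in H, when D is a subgroup of H. *)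
Definition finite_index (H D : set gT) : Prop :=
  exists s : seq gT, forall h, H h -> exists2 x, x \in s & D (x^-1 * h).

Definition commensurable (H H' : set gT) : Prop :=
  finite_index H (H `&` H') /\ finite_index H' (H `&` H').

End Subgroups.

Section SemisimpleGroups.
Context {n : nat} (GG : alg_group n).

Section Zariski.
Variable C : numFieldType.

Definition zariski_closed (A : set (points GG C)) : Prop :=
  exists S : set (mpoly.mpoly (n * n) C),
    A = [set g | forall P, S P -> mpoly.meval (fun k => mxvec (val g) 0 k) P = 0].

Definition zariski_connected (A : set (points GG C)) : Prop :=
  forall B1 B2, zariski_closed B1 -> zariski_closed B2 ->
    A `<=` B1 `|` B2 -> A `&` B1 `&` B2 = set0 -> A `<=` B1 \/ A `<=` B2.

(* For C algebraically closed of characteristic 0: GG is connected and its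
   radical is trivial. *)
Definition connected_semisimple_alg : Prop :=
  zariski_connected setT /\
  forall H : set (points GG C), is_subgroup H -> is_normal H ->
    zariski_closed H -> zariski_connected H -> is_solvable H ->
    H `<=` [set 1%g].

End Zariski.

Section Real.
Variable R : realType.

Definition bracket (F : numFieldType) (X Y : 'M[F]_n) : 'M[F]_n :=
  X *m Y - Y *m X.

(* The trace of ad X o ad Y on the real Lie algebra, computed in a basis. *)
Definition killing (X Y : 'M[R]_n) : R :=
  let b := vbasis (lie GG R) in
  \sum_(i < \dim (lie GG R)) coord b i (bracket X (bracket Y b`_i)).

(* Semisimplicity of a real Lie algebra as nondegeneracy of the Killing form. *)
Definition semisimple_lie : Prop :=
  forall X, X \in lie GG R ->
    (forall Y, Y \in lie GG R -> killing X Y = 0) -> X = 0.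

Definition connected_semisimple_real : Prop :=
  [/\ connected [set: points GG R], semisimple_lie &
      finite_set [set z : points GG R | forall g, (z * g = g * z)%g]].

Definition maximal_compact (K : set (points GG R)) : Prop :=
  [/\ is_subgroup K, compact K &
      forall K' : set (points GG R), is_subgroup K' -> compact K' ->
        K `<=` K' -> K' = K].

Definition rational_points : set (points GG R) :=
  [set g : points GG R | exists q : 'M[rat]_n, val g = map_mx ratr q].

Definition integral_points : set (points GG R) :=
  [set g : points GG R | exists z z' : 'M[int]_n,
     val g = map_mx intr z /\ val (g^-1%g : points GG R) = map_mx intr z'].

Definition arithmetic_subgroup (Gamma : set (points GG R)) : Prop :=
  [/\ is_subgroup Gamma, Gamma `<=` rational_points &
      commensurable Gamma integral_points].

End Real.
End SemisimpleGroups.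

Arguments connected_semisimple_alg {n}.
Arguments connected_semisimple_real {n}.
Arguments maximal_compact {n GG R}.
Arguments arithmetic_subgroup {n GG R}.

Section Calculus.
Context {R : realType} {n : nat} {GG : alg_group n}.
Local Notation M := 'M[R]_n.
Local Notation G := (points GG R).

Definition expm (X : M) : M := limn (series (fun k => (k`!%:R)^-1 *: X ^+ k)).

(* exp(X) as an element of GG(R); the default value 1 is never used for X in the
   Lie algebra. *)
Definition exp_pt (X : M) : G := insubd (1%g : G) (expm X).

Fixpoint Ck (k : nat) (U : set M) (F : M -> R) : Prop :=
  if k is k'.+1 then
    (forall x, U x -> differentiable F x) /\
    (forall v, Ck k' U (fun x => 'd F x v))
  else forall x, U x -> {for x, continuous F}.

Definition smooth_on (U : set M) (F : M -> R) : Prop := forall k, Ck k U F.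

Definition differentiable_on (U : set M) (F : M -> R) : Prop :=
  forall x, U x -> differentiable F x.

(* f, defined on a subset S of GG(R), extends locally to functions of class P on
   open subsets of M_n(R). *)
Definition locally_extends (P : set M -> (M -> R) -> Prop) (S : set G)
    (f : G -> R) : Prop :=
  forall g, S g -> exists U F,
    [/\ open U, U (val g), P U F &
        forall h, S h -> U (val h) -> f h = F (val h)].

Definition locally_extendsC (P : set M -> (M -> R) -> Prop) (S : set G)
    (f : G -> R[i]) : Prop :=
  locally_extends P S (fun g => complex.Re (f g)) /\
  locally_extends P S (fun g => complex.Im (f g)).

Definition smooth (f : G -> R[i]) : Prop := locally_extendsC smooth_on setT f.

Definition derivC (f : R -> R[i]) (t : R) : R[i] :=
  Complex (derive1 (fun s => complex.Re (f s)) t)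
          (derive1 (fun s => complex.Im (f s)) t).

End Calculus.

Notation gC R GG := (subvs_of (lie GG R[i])).

Section Enveloping.
Variables (R : realType) (n : nat) (GG : alg_group n).
Local Notation C := R[i].

Local Notation g := (gC R GG).

(* Free associative algebra on the set g; the enveloping algebra U(g) is its
   quotient by the two-sided ideal env_ideal. *)
Definition free_env : pzRingType := monalg.malg (monalg.fmonom g) C.

Definition env_gen (X : g) : free_env :=
  monalg.mkmalgU (monalg.fmu X) (1 : C).

Definition env_rel (u : free_env) : Prop :=
  (exists (a : C) (X Y : g),
     u = env_gen (a *: X + Y) -
         (monalg.mkmalgU (monalg.fmone g) a * env_gen X + env_gen Y)) \/
  (exists X Y Z : g, vsval Z = bracket (vsval X) (vsval Y) /\
     u = env_gen X * env_gen Y - env_gen Y * env_gen X - env_gen Z).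

Definition env_ideal (u : free_env) : Prop :=
  forall I : set free_env, I 0 -> (forall x y, I x -> I y -> I (x + y)) ->
    (forall x y, I x -> I (y * x)) -> (forall x y, I x -> I (x * y)) ->
    env_rel `<=` I -> I u.

Definition env_central (u : free_env) : Prop :=
  forall v, env_ideal (u * v - v * u).

(* The word X_1 ... X_k acts by X_1 (... (X_k v)). *)
Definition env_act (V : lmodType C) (act : g -> V -> V) (u : free_env) (v : V) : V :=
  \sum_(m <- monalg.msupp u)
    monalg.mcoeff m u *: foldr act v (monalg.fmonom_val m).

End Enveloping.

Section GKModules.
Context {R : realType} {n : nat} {GG : alg_group n}.
Local Notation C := R[i].
Local Notation G := (points GG R).
Local Notation g := (gC R GG).

(* A vector space on which g and GG(R) act by linear maps; only the restriction of
   the group action to K is ever used.  The axioms of a (g,K)-module are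
   [is_gk_module]. *)
Record gk_rep := GkRep {
  gk_space :> lmodType C;
  gk_lie : g -> {linear gk_space -> gk_space};
  gk_grp : G -> {linear gk_space -> gk_space}
}.

Definition toC (X : 'M[R]_n) : 'M[C]_n := map_mx (real_complex R) X.

Definition lie_of (K : set G) : set 'M[R]_n :=
  [set X | forall t : R, exists2 k, K k & val k = expm (t *: X)].

Definition grp_acts (K : set G) (W : gk_rep) : set (W -> W) :=
  [set f | exists2 k, K k & f = gk_grp W k :> (W -> W)].

Arguments grp_acts : clear implicits.

Definition lie_acts (W : gk_rep) : set (W -> W) :=
  [set f | exists X, f = gk_lie W X :> (W -> W)].
Arguments lie_acts : clear implicits.

(* For a basis e of a finite-dimensional K-stable subspace, on which k acts by the
   matrix c k: the coefficients of c are differentiable on K and, for X in Lie(K),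
   X acts by the derivative at 0 of c (exp (t X)). *)
Definition differentiable_action (K : set G) (W : gk_rep) : Prop :=
  forall m (e : 'I_m -> W) (c : G -> 'M[C]_m), lin_indep e ->
    (forall k, K k -> forall j, gk_grp W k (e j) = \sum_i c k i j *: e i) ->
    (forall i j, locally_extendsC differentiable_on K (fun k => c k i j)) /\
    (forall X, lie_of K X -> forall X' : g, vsval X' = toC X -> forall j,
       gk_lie W X' (e j) =
       \sum_i derivC (fun t => c (exp_pt (t *: X)) i j) 0 *: e i).

(* g is closed under brackets and under Ad(K); the elements [X, Y] and Ad(k)X of g
   are designated through their matrices. *)
Definition is_gk_module (K : set G) (W : gk_rep) : Prop :=
  [/\ (forall (a : C) (X Y : g) (w : W),
         gk_lie W (a *: X + Y) w = a *: gk_lie W X w + gk_lie W Y w) /\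
      (forall (X Y Z : g) (w : W), vsval Z = bracket (vsval X) (vsval Y) ->
         gk_lie W Z w = gk_lie W X (gk_lie W Y w) - gk_lie W Y (gk_lie W X w)),
      (forall w : W, gk_grp W 1%g w = w) /\
      (forall k k', K k -> K k' -> forall w : W,
         gk_grp W (k * k')%g w = gk_grp W k (gk_grp W k' w)),
      forall k, K k -> forall X X' : g,
        vsval X' = toC (val k) *m vsval X *m toC (val (k^-1%g : G)) ->
        forall w : W, gk_grp W k (gk_lie W X w) = gk_lie W X' (gk_grp W k w),
      (forall w : W, fin_dim_span [set v | exists2 k, K k & v = gk_grp W k w]) /\
      semisimple (grp_acts K W) &
      differentiable_action K W].

Definition fin_gen_env (W : gk_rep) : Prop :=
  exists s : seq W, forall w, exists u : nat -> free_env R GG,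
    w = \sum_(i < size s) env_act (fun X => gk_lie W X) (u i) s`_i.

Definition irreducible_K_rep (K : set G) m (rho : G -> 'M[C]_m) : Prop :=
  [/\ rho 1%g = 1%:M,
      forall k k', K k -> K k' -> rho (k * k')%g = rho k *m rho k',
      {within K, continuous (rho : G -> 'M[C^o]_m)} &
      irreducible [set f : 'cV[C]_m -> 'cV[C]_m |
                   exists2 k, K k & f = mulmx (rho k)]].

Definition K_hom (K : set G) m (rho : G -> 'M[C]_m) (W : gk_rep) :
    set ('cV[C]_m -> W) :=
  [set T | linear T /\
     forall k, K k -> forall v, T (rho k *m v) = gk_grp W k (T v)].
Arguments K_hom K {m} rho W.

Definition harish_chandra (K : set G) (W : gk_rep) : Prop :=
  [/\ is_gk_module K W, fin_gen_env W &
      forall m (rho : G -> 'M[C]_m), irreducible_K_rep K rho ->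
        fin_dim_span (K_hom K rho W)].

Definition unitary_structure (K : set G) (W : gk_rep) (h : W -> W -> C) : Prop :=
  [/\ forall (a : C) u v w, h (a *: u + v) w = a * h u w + h v w,
      forall u w, h w u = conjc (h u w),
      forall u, u != 0 -> 0 < h u u,
      forall k, K k -> forall u w, h (gk_grp W k u) (gk_grp W k w) = h u w &
      forall X, X \in lie GG R -> forall X' : g, vsval X' = toC X ->
        forall v w, h (gk_lie W X' v) w + h v (gk_lie W X' w) = 0].
Arguments unitary_structure : clear implicits.

Definition weight (K : set G) (W : gk_rep) : Prop :=
  [/\ harish_chandra K W, irreducible (grp_acts K W `|` lie_acts W) &
      exists h, unitary_structure K W h].

Definition gk_tensor (W1 W2 : gk_rep) : gk_rep :=
  @GkRep (tens W1 W2)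
    (fun X => tens_map (gk_lie W1 X) (idfun : W2 -> W2)
              \+ tens_map (idfun : W1 -> W1) (gk_lie W2 X))
    (fun k => tens_map (gk_grp W1 k) (gk_grp W2 k)).

(* Intertwining linear maps between vector spaces on which g and GG(R) act by
   arbitrary maps: Hom_(g,K) without requiring that the target be a
   (g,K)-module. *)
Definition intertwines (K : set G) (V V' : lmodType C)
    (lieV : g -> V -> V) (grpV : G -> V -> V)
    (lieV' : g -> V' -> V') (grpV' : G -> V' -> V') (phi : V -> V') : Prop :=
  [/\ linear phi,
      forall X v, phi (lieV X v) = lieV' X (phi v) &
      forall k, K k -> forall v, phi (grpV k v) = grpV' k (phi v)].

Definition gk_homs (K : set G) (W W' : gk_rep) : set (W -> W') :=
  [set phi | intertwines K (fun X => gk_lie W X) (fun k => gk_grp W k)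
               (fun X => gk_lie W' X) (fun k => gk_grp W' k) phi].
Arguments gk_homs : clear implicits.

Lemma gk_homs_subspace (K : set G) (W W' : gk_rep) :
  is_subspace (gk_homs K W W').
Proof.
case: (@linear_subspace _ W W') => l0 lD.
split; first by split=> // [X|k _] v; rewrite linear0.
move=> a p q [lp gp kp] [lq gq kq]; split; first exact: lD.
  by move=> X v; rewrite !fctE gp gq linearP.
by move=> k Kk v; rewrite !fctE kp // kq // linearP.
Qed.

Definition gk_hom (K : set G) (W W' : gk_rep) := subm (@gk_homs_subspace K W W').

End GKModules.

Arguments grp_acts {R n GG} K W.
Arguments lie_acts {R n GG} W.
Arguments K_hom {R n GG} K {m} rho W.
Arguments unitary_structure {R n GG} K W h.
Arguments gk_homs {R n GG} K W W'.

Arguments gk_rep R {n}.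

Section AutomorphicForms.
Context {R : realType} {n : nat} {GG : alg_group n}.
Local Notation C := R[i].
Local Notation G := (points GG R).
Local Notation g := (gC R GG).
Local Notation "A ^H" := (map_mx conjc A^T) (at level 2, format "A ^H").

(* A representation sigma of GG(R) on E = C^d with finite kernel and closed image
   in GL(E), and a sigma(K)-invariant inner product <u, v> = u^H H v on E. *)
Definition norm_data (K : set G) d (sigma : G -> 'M[C]_d) (H : 'M[C]_d) : Prop :=
  [/\ [/\ sigma 1%g = 1%:M,
          forall x y, sigma (x * y)%g = sigma x *m sigma y &
          continuous (sigma : G -> 'M[C^o]_d)],
      finite_set [set x | sigma x = 1%:M],
      (forall A : 'M[C]_d, A \in unitmx ->
         closure [set (sigma x : 'M[C^o]_d) | x in setT] A ->
         exists x, sigma x = A),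
      H^H = H /\ (forall v : 'cV[C]_d, v != 0 -> 0 < (v^H *m H *m v) 0 0) &
      forall k, K k -> (sigma k)^H *m H *m sigma k = H].

Definition adjoint d (H A : 'M[C]_d) : 'M[C]_d := invmx H *m A^H *m H.

Definition gnorm d (sigma : G -> 'M[C]_d) (H : 'M[C]_d) (x : G) : R :=
  Num.sqrt (Normc.normc (\tr (adjoint H (sigma x) *m sigma x))).

(* Derivative of f at x along the left-invariant field of X, for X in Lie(G). *)
Definition rderivR (X : 'M[R]_n) (f : G -> C) : G -> C :=
  fun x => derivC (fun t => f (x * exp_pt (t *: X))%g) 0.

(* Right translation action of g, extended C-linearly from the real Lie algebra. *)
Definition rderiv (X : g) (f : G -> C) : G -> C :=
  rderivR (map_mx (@complex.Re R) (vsval X)) f +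
  Complex 0 1 *: rderivR (map_mx (@complex.Im R) (vsval X)) f.

Definition rtrans (y : G) (f : G -> C) : G -> C := fun x => f (x * y)%g.

Definition moderate_growth d (sigma : G -> 'M[C]_d) H (f : G -> C) : Prop :=
  exists m : nat, (0 < m)%N /\ exists c : R, forall x,
    Normc.normc (f x) <= c * gnorm sigma H x ^+ m.

Definition K_finite (K : set G) (f : G -> C) : Prop :=
  fin_dim_span [set h | exists2 k, K k & h = rtrans k f].

Definition Z_finite (f : G -> C) : Prop :=
  fin_dim_span [set h | exists2 z : free_env R GG,
                  env_central z & h = env_act rderiv z f].

Definition smooth_quotient (Gamma : set G) : set (G -> C) :=
  [set f | smooth f /\ forall c x, Gamma c -> f (c * x)%g = f x].

Definition automorphic (K Gamma : set G) d (sigma : G -> 'M[C]_d) (H : 'M[C]_d) :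
    set (G -> C) :=
  [set f | [/\ smooth_quotient Gamma f, moderate_growth sigma H f,
               K_finite K f & Z_finite f]].

(* Hom_(g,K)(W, A) for the subspace A of automorphic forms inside all functions
   on GG(R): the maps intertwining the actions, with values in A. *)
Definition modular_forms (K Gamma : set G) d (sigma : G -> 'M[C]_d)
    (H : 'M[C]_d) (W : gk_rep R GG) : set (W -> (G -> C)) :=
  [set F | intertwines K (fun X => gk_lie W X) (fun k => gk_grp W k)
             rderiv rtrans F /\
           forall w, automorphic K Gamma sigma H (F w)].

Definition mult_tens : tens (G -> C) (G -> C) -> (G -> C) :=
  tens_lift (fun f1 f2 : G -> C => (fun x => f1 x * f2 x) : G -> C).

(* F1 and F2 take values in automorphic forms, but the tensor product is formed
   inside (G -> C) (x) (G -> C), to which m extends by the same formula. *)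
Definition m12 (W W1 W2 : gk_rep R GG) (mu : W -> gk_tensor W1 W2)
    (F1 : W1 -> (G -> C)) (F2 : W2 -> (G -> C)) : W -> (G -> C) :=
  mult_tens \o tens_map F1 F2 \o mu.

End AutomorphicForms.

Arguments modular_forms {R n GG} K Gamma {d} sigma H W.

(* Main.v *)
Require Import Defs.
From HB Require Import structures.
From mathcomp Require Import all_boot all_order all_algebra.
From mathcomp Require Import all_classical all_reals all_analysis.
From mathcomp.finmap Require Import finmap.
From mathcomp.multinomials Require mpoly monalg.
From mathcomp Require Import perm spectral sesquilinear.
From mathcomp Require Import ring lra.

Set Implicit Arguments.
Unset Strict Implicit.
Unset Printing Implicit Defensive.
Import -(notations) mpoly.
Import Order.TTheory GRing.Theory Num.Theory numFieldNormedType.Exports.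
Local Open Scope classical_set_scope.
Local Open Scope ring_scope.

(* The products F1(w1) F2(w2) inherit smoothness, Gamma-invariance and K-finiteness, and the
   Leibniz rule makes m12 an intertwining map.  Two points need more.

   Moderate growth: sums of functions of moderate growth need ||g|| bounded below.  As
   det sigma = 1, the squared norm, a sum of terms (d_j / d_i) |B_ji|^2 with |det B| = 1, is
   bounded below.

   Z-finiteness: the center Z of the enveloping algebra is Ad(G)-invariant in its action on
   W, as the derivative of Ad(x exp tX) z along t is the action of a commutator with z.
   Hence z in Z commutes with K, and maps the simple K-submodule of W through w into the
   isotypic component of the same type, which is finite-dimensional by admissibility.  So Zw
   is finite-dimensional, and so is its image under any intertwining map.

   Both det sigma = 1 and the Ad(G)-invariance come from a density statement: a subgroup of
   the connected group G that contains the commutators [exp sY, exp sZ], and every point near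
   which it accumulates, is G.  Indeed the Lie algebra equals its derived algebra, so an
   element near 1 is approximated by a product of such commutators with an error half its
   distance to 1. *)

(** * Points over dual numbers *)

(** An [alg_group] is given only by equations that cut out a group over every commutative ring
    receiving the rationals, so its Lie theory is read off from points over suitable rings: one
    infinitesimal for Ad, two for the bracket, and m for the exponential, since exp(tX) at t = eps_1
    + ... + eps_m is the product of the points 1 + eps_i X.

    Near 1 the group is compared with its Lie algebra to second order only: g - 1 is within O(|g -
    1|^2) of it. Combined with commutators, this drives the successive approximation in the density
    statement.

    A product of Z-finite functions need not be Z-finite, so Z-finiteness has to come from the
    source W of the intertwining map. There the invariance of Z is needed at elements k of K, which
    are not given as products of exponentials; this is why the whole connected group G must be
    reached. As W carries no topology, derivatives and limits are taken after applying linear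
    functionals, and the inner product of the weight supplies enough of them to separate vectors. *)

Section MpolyGeneral.

Lemma mpoly_ring_ind (k : nat) (A : nzRingType) (Q : mpoly k A -> Prop) :
  (forall c, Q (mpolyC k c)) -> (forall i, Q (mpolyX A (mnm1 i))) ->
  (forall p q, Q p -> Q q -> Q (p + q)) ->
  (forall p q, Q p -> Q q -> Q (p * q)) -> forall p, Q p.
Proof.
move=> QC QX QD QM p; rewrite [p]mpolyE.
elim/big_ind: _ => [|//|m _]; first by rewrite -(mpolyC0 k A); exact: QC.
rewrite -mul_mpolyC; apply: (QM _ _ (QC _)); rewrite mpolyXE_id.
have Q1 : Q 1 by rewrite -(mpolyC1 k A); exact: QC.
elim/big_ind: _ => [//|//|i _].
by elim: (m i) => [|j IH]; rewrite ?expr0 // exprS; exact: QM.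
Qed.

End MpolyGeneral.

Section DualNumbers.
Variable A : comNzRingType.

(* A[eps]/(eps^2); the pair (a, b) stands for a + eps b. *)
Definition dual : Type := (A * A)%type.
HB.instance Definition _ := GRing.Zmodule.on dual.

Definition dual_mul (x y : dual) : dual := (x.1 * y.1, x.1 * y.2 + x.2 * y.1).

Let dual_mulA : associative dual_mul.
Proof. by move=> [a b] [c e] [f g]; congr pair => /=; ring. Qed.
Let dual_mulC : commutative dual_mul.
Proof. by move=> [a b] [c e]; congr pair => /=; ring. Qed.
Let dual_mul1 : left_id ((1, 0) : dual) dual_mul.
Proof. by move=> [a b]; congr pair => /=; ring. Qed.
Let dual_mulD : left_distributive dual_mul +%R.
Proof. by move=> [a b] [c e] [f g]; congr pair => /=; ring. Qed.
Let dual_10 : ((1, 0) : dual) != 0.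
Proof. by apply/eqP => -[] /eqP; rewrite oner_eq0. Qed.

HB.instance Definition _ := GRing.Zmodule_isComNzRing.Build dual
  dual_mulA dual_mulC dual_mul1 dual_mulD dual_10.

Definition dual_of (a : A) : dual := (a, 0).

Let dual_of_add : zmod_morphism dual_of.
Proof. by move=> a b; rewrite /dual_of; congr pair => /=; rewrite subr0. Qed.
Let dual_of_mul : monoid_morphism dual_of.
Proof. by split=> // a b; congr pair => /=; rewrite mulr0 mul0r addr0. Qed.
HB.instance Definition _ := GRing.isZmodMorphism.Build A dual dual_of dual_of_add.
HB.instance Definition _ := GRing.isMonoidMorphism.Build A dual dual_of dual_of_mul.

End DualNumbers.

Section PolyAt.
Variable n : nat.

Lemma poly_at_rmorph (A B : comNzRingType) (phi : rat -> A)
    (f : {rmorphism A -> B}) (P : mpoly (n * n) rat) (g : 'M[A]_n) :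
  f (poly_at phi P g) = poly_at (f \o phi) P (map_mx f g).
Proof.
rewrite /poly_at /mmap rmorph_sum; apply: eq_bigr => m _ /=.
rewrite rmorphM; congr (_ * _); rewrite /mmap1 rmorph_prod; apply: eq_bigr => i _.
by rewrite rmorphXn /= -map_mxvec mxE.
Qed.

Section Morph.
Variables (A : comNzRingType) (phi : {rmorphism rat -> A}) (g : 'M[A]_n).

Lemma poly_atD P Q : poly_at phi (P + Q) g = poly_at phi P g + poly_at phi Q g.
Proof. exact: mmapD. Qed.
Lemma poly_atM P Q : poly_at phi (P * Q) g = poly_at phi P g * poly_at phi Q g.
Proof. by case: (mmap_is_multiplicative (fun k => mxvec g 0 k) phi) => h _; exact: h. Qed.
Lemma poly_atC c : poly_at phi (mpolyC _ c) g = phi c.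
Proof. exact: mmapC. Qed.
Lemma poly_atX i : poly_at phi (mpolyX _ (mnm1 i)) g = mxvec g 0 i.
Proof. by rewrite /poly_at mmapX mmap1U. Qed.

(** P(g + eps h) = P(g) + eps dP_g(h): multiplication of dual numbers is the Leibniz rule, so both
    sides are multiplicative in P and only constants and variables have to be compared. *)
Lemma poly_at_dual (h : 'M[A]_n) P :
  poly_at (@dual_of A \o phi) P (\matrix_(i, j) ((g i j, h i j) : dual A)) =
  (poly_at phi P g, \sum_k poly_at phi (mderiv k P) g * mxvec h 0 k).
Proof.
set gh := \matrix_(i, j) _.
have ghE k : mxvec gh 0 k = (mxvec g 0 k, mxvec h 0 k).
  by case/mxvec_indexP: k => i j; rewrite !mxvecE mxE.
set psi := (X in poly_at X).
have D p q : poly_at psi (p + q) gh = poly_at psi p gh + poly_at psi q gh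
  by exact: mmapD.
have M p q : poly_at psi (p * q) gh = poly_at psi p gh * poly_at psi q gh.
  by case: (mmap_is_multiplicative (fun k => mxvec gh 0 k) psi) => h' _; exact: h'.
have psiC c : poly_at psi (mpolyC _ c) gh = psi c by exact: mmapC.
have X i : poly_at psi (mpolyX _ (mnm1 i)) gh = mxvec gh 0 i.
  by rewrite /poly_at mmapX mmap1U.
elim/mpoly_ring_ind: P => [c|i|p q IHp IHq|p q IHp IHq].
- rewrite psiC poly_atC big1 // => k _.
  by rewrite mderivC /poly_at mmap0 mul0r.
- rewrite X ghE poly_atX (bigD1 i) //= big1 ?addr0 => [|k ki].
    rewrite mderivX mnm1E eqxx scale1r.
    have -> : mnm_sub (mnm1 i) (mnm1 i) = mnm0.
      by apply/mnmP => j; rewrite mnmBE subnn mnm0E.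
    by rewrite mpolyX0 -mpolyC1 poly_atC rmorph1 mul1r.
  by rewrite mderivX mnm1E eq_sym (negPf ki) scale0r /poly_at mmap0 mul0r.
- rewrite D IHp IHq poly_atD; congr pair; rewrite /= -big_split.
  by apply: eq_bigr => k _; rewrite mderivD poly_atD mulrDl.
- rewrite M IHp IHq poly_atM; congr pair; rewrite /= mulr_sumr mulr_suml -big_split.
  apply: eq_bigr => k _ /=; rewrite mderivM poly_atD !poly_atM; ring.
Qed.

End Morph.
End PolyAt.

Section DualPoints.
Variable n : nat.

(** The morphism from the rationals to a given ring arises below as various composites, which agree
    only pointwise. *)
Lemma is_point_ext (S : seq (mpoly (n * n) rat)) (A : comNzRingType)
    (phi psi : {rmorphism rat -> A}) (g : 'M[A]_n) :
  phi =1 psi -> is_point S phi g -> is_point S psi g.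
Proof.
by move=> /funext e [hg hP]; split=> // P PS; rewrite -e; exact: hP.
Qed.

Lemma is_point_map (S : seq (mpoly (n * n) rat)) (A B : comNzRingType)
    (phi : {rmorphism rat -> A}) (f : {rmorphism A -> B}) (g : 'M[A]_n) :
  is_point S phi g -> is_point S (f \o phi) (map_mx f g).
Proof.
move=> [[h [gh hg]] hP]; split.
  by exists (map_mx f h); rewrite -!map_mxM gh hg map_mx1.
by move=> P PS; rewrite -poly_at_rmorph hP // rmorph0.
Qed.

Definition dual_mx (A : comNzRingType) (g h : 'M[A]_n) : 'M[dual A]_n :=
  \matrix_(i, j) ((g i j, h i j) : dual A).

Lemma dual_mxM (A : comNzRingType) (g h g' h' : 'M[A]_n) :
  dual_mx g h *m dual_mx g' h' = dual_mx (g *m g') (g *m h' + h *m g').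
Proof.
have sum_dual (I : finType) (F : I -> dual A) :
    \sum_i F i = (\sum_i (F i).1, \sum_i (F i).2).
  by elim/big_rec3: _ => // i a b c _ ->.
apply/matrixP => i j; rewrite !mxE sum_dual; congr pair.
  by apply: eq_bigr => k _; rewrite !mxE.
by rewrite -big_split; apply: eq_bigr => k _; rewrite !mxE.
Qed.

Lemma dual_mx1 (A : comNzRingType) : dual_mx (1%:M : 'M[A]_n) 0 = 1%:M.
Proof. by apply/matrixP => i j; rewrite !mxE; case: (i == j). Qed.

Lemma map_dual_of (A : comNzRingType) (g : 'M[A]_n) :
  map_mx (@dual_of A) g = dual_mx g 0.
Proof. by apply/matrixP => i j; rewrite !mxE. Qed.

Variable GG : alg_group n.

Lemma diff_at1_linear (F : numFieldType) P : linear (@diff_at1 n F P).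
Proof.
move=> a X Y; rewrite /diff_at1 scaler_sumr -big_split; apply: eq_bigr => k _ /=.
by rewrite linearP /= mxE [X in _ * (X + _)]mxE mulrDr /GRing.scale /= mulrCA.
Qed.
HB.instance Definition _ (F : numFieldType) P :=
  GRing.isLinear.Build F 'M[F]_n F^o *:%R (@diff_at1 n F P) (@diff_at1_linear F P).

Lemma lieP (F : numFieldType) (X : 'M[F]_n) :
  reflect (forall P, P \in ag_eqs GG -> diff_at1 P X = 0) (X \in lie GG F).
Proof.
rewrite /lie; elim: (ag_eqs GG) => [|P s IH].
  by rewrite big_nil memvf; constructor.
rewrite big_cons memv_cap memv_ker lfunE /=.
apply: (iffP andP) => [[/eqP PX /IH h] Q|h]; first by rewrite inE => /orP[/eqP->|/h].
split; first by rewrite h ?mem_head.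
by apply/IH => Q Qs; apply: h; rewrite inE Qs orbT.
Qed.

Variable F : numFieldType.
Local Notation ratF := (ratr : {rmorphism rat -> F}).

(** The constant term vanishes because 1 is a point. The factor [a] is for [lie_bracket], where it
    is a second infinitesimal. *)
Lemma poly_at_dual1 (A : comNzRingType) (f : {rmorphism F -> A}) (a : A)
    (X : 'M[F]_n) P :
  P \in ag_eqs GG ->
  poly_at (@dual_of A \o (f \o ratF)) P (dual_mx 1%:M (a *: map_mx f X))
  = (0, a * f (diff_at1 P X)).
Proof.
move=> PS; rewrite /dual_mx (poly_at_dual (f \o ratF)); congr pair.
  rewrite -[1%:M](map_mx1 f) -poly_at_rmorph.
  by case: (ag_closed GG ratF) => -[_ /(_ _ PS) ->]; rewrite rmorph0.
rewrite rmorph_sum mulr_sumr; apply: eq_bigr => k _.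
rewrite rmorphM poly_at_rmorph map_mx1 linearZ mxE mulrCA; congr (_ * (_ * _)).
by rewrite /= -map_mxvec mxE.
Qed.

Lemma lie_is_point (A : comNzRingType) (f : {rmorphism F -> A}) (X : 'M[F]_n) :
  X \in lie GG F ->
  is_point (ag_eqs GG) (@dual_of A \o (f \o ratF)) (dual_mx 1%:M (map_mx f X)).
Proof.
move=> /lieP hX; split; last first.
  move=> P PS; have := poly_at_dual1 f 1 X PS; rewrite scale1r => ->.
  by rewrite hX // rmorph0 mulr0.
exists (dual_mx 1%:M (- map_mx f X)).
by split; rewrite dual_mxM !mul1mx mulmx1 ?addrN ?addNr dual_mx1.
Qed.

Lemma is_point_lie (X : 'M[F]_n) :
  (forall P, P \in ag_eqs GG ->
     poly_at (@dual_of F \o ratF) P (dual_mx 1%:M X) = 0) -> X \in lie GG F.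
Proof.
move=> h; apply/lieP => P PS; have := h P PS.
by have := @poly_at_dual1 F idfun 1 X P PS; rewrite scale1r map_mx_id // mul1r => -> [].
Qed.

(** Conjugating the point 1 + eps X by g over the dual numbers yields 1 + eps g X g^-1. *)
Lemma lie_Ad (g : points GG F) (X : 'M[F]_n) :
  X \in lie GG F -> val g *m X *m invmx (val g) \in lie GG F.
Proof.
move=> hX; apply: is_point_lie; pose f := (@dual_of F \o ratF).
case: (ag_closed GG f) => _ M _.
suff [_ h] : is_point (ag_eqs GG) f (dual_mx 1%:M (val g *m X *m invmx (val g))).
  exact: h.
have pt (x : points GG F) : is_point (ag_eqs GG) f (dual_mx (val x) 0).
  by rewrite -map_dual_of; apply: is_point_map; exact: pointP.
have hX' : is_point (ag_eqs GG) f (dual_mx 1%:M X).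
  have := @lie_is_point F idfun X hX; rewrite map_mx_id //; exact: is_point_ext.
have := M _ _ (M _ _ (pt g) hX') (pt (g^-1)%g).
rewrite !dual_mxM !mulmx0 !mul0mx mulmx1 addr0 add0r /=.
by rewrite mulmxV ?point_unit.
Qed.

(** With two independent infinitesimals, the commutator of 1 + eps X and 1 + eps' Y is 1 + eps eps'
    [X, Y]. As it is a point of the group, the differentials of the equations vanish at [X, Y]. *)
Lemma lie_bracket (X Y : 'M[F]_n) :
  X \in lie GG F -> Y \in lie GG F -> bracket X Y \in lie GG F.
Proof.
move=> hX hY.
pose D := dual F; pose f := (@dual_of D \o (@dual_of F \o ratF)).
case: (ag_closed GG f) => _ M _.
have pY (Z : 'M[F]_n) : Z \in lie GG F ->
    is_point (ag_eqs GG) f (dual_mx 1%:M (map_mx (@dual_of F) Z)).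
  by move=> hZ; exact: lie_is_point.
have pX (Z : 'M[F]_n) : Z \in lie GG F ->
    is_point (ag_eqs GG) f (map_mx (@dual_of D) (dual_mx 1%:M Z)).
  move=> hZ; apply: is_point_map.
  have := @lie_is_point F idfun Z hZ; rewrite map_mx_id //; exact: is_point_ext.
have mN (Z : 'M[F]_n) : Z \in lie GG F -> - Z \in lie GG F by rewrite memvN.
have [_ hP] := M _ _ (M _ _ (pX X hX) (pY Y hY)) (M _ _ (pX _ (mN X hX)) (pY _ (mN Y hY))).
have E : map_mx (@dual_of D) (dual_mx 1%:M X) *m dual_mx 1%:M (map_mx (@dual_of F) Y) *m
    (map_mx (@dual_of D) (dual_mx 1%:M (- X)) *m
      dual_mx 1%:M (map_mx (@dual_of F) (- Y)))
    = dual_mx 1%:M (((0, 1) : D) *: map_mx (@dual_of F) (bracket X Y)).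
  rewrite !map_dual_of !dual_mxM !(mulmx1, mul1mx, mul0mx, mulmx0, addr0, add0r).
  rewrite !dual_mxM !(mulmx1, mul1mx, mul0mx, mulmx0, addr0, add0r) addNr dual_mx1.
  congr dual_mx; transitivity (dual_mx 0 (bracket X Y)); last first.
    apply/matrixP => i j; rewrite !mxE; congr pair; first by rewrite /= mul0r.
    by rewrite /= mul0r mul1r add0r.
  have -> : bracket X Y = - X *m - Y + X *m - Y + (Y *m - X + X *m Y).
    by rewrite /bracket !mulNmx !mulmxN opprK addrN add0r addrC.
  rewrite -[X in dual_mx X (_ + (_ + _))](addNr Y).
  move: (_ + X *m - Y) (_ + X *m Y) => U V.
  by apply/matrixP => i j; rewrite !mxE; congr pair.
apply/lieP => P PS; have := hP P PS; rewrite E.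
have := @poly_at_dual1 D (@dual_of F) ((0, 1) : D) (bracket X Y) P PS.
move=> -> /(congr1 snd) /(congr1 snd) /=.
by rewrite !mul0r mul1r add0r.
Qed.

End DualPoints.

(** * Several infinitesimals and the truncated exponential *)

Section IteratedDual.
Variable F : numFieldType.

Fixpoint idual (m : nat) : comNzRingType :=
  if m is m'.+1 then dual (idual m') else F.

(* The morphism p |-> p(eps_1 + ... + eps_m); its kernel is ('X^m.+1). *)
Fixpoint theta (m : nat) : {poly F} -> idual m :=
  if m is m'.+1 then fun p => ((theta m' p, theta m' p^`()) : dual (idual m'))
  else fun p => p`_0.

Fact theta_zmod m : zmod_morphism (theta m).
Proof.
elim: m => [|m IH] p q /=; first by rewrite coefB.
by rewrite derivB !IH.
Qed.
HB.instance Definition _ m :=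
  GRing.isZmodMorphism.Build {poly F} (idual m) (theta m) (theta_zmod m).

Fact theta_monoid m : monoid_morphism (theta m).
Proof.
elim: m => [|m [IH1 IH]]; first by split=> [|p q] /=; rewrite ?coefC // coef0M.
split=> [|p q]; first by rewrite /= IH1 derivC raddf0.
by rewrite /= derivM raddfD /= !IH; congr pair; rewrite /= addrC.
Qed.
HB.instance Definition _ m :=
  GRing.isMonoidMorphism.Build {poly F} (idual m) (theta m) (theta_monoid m).

Lemma thetaS m p : theta m.+1 p = (theta m p, theta m p^`()). Proof. by []. Qed.

Lemma thetaXn m k : (m < k)%N -> theta m 'X^k = 0.
Proof.
elim: m k => [|m IH] [//|k] mk; first by rewrite /= coefXn.
rewrite thetaS IH; last exact: leq_trans mk.
by rewrite derivXn /= raddfMn /= IH // mul0rn.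
Qed.

(** Characteristic 0 is essential: (eps_1 + ... + eps_m)^k is k! times an elementary symmetric
    function. In the induction it enters through the factor k + 1 in the coefficients of the
    derivative. *)
Lemma theta_eq0 m p : theta m p = 0 -> forall k, (k <= m)%N -> p`_k = 0.
Proof.
elim: m p => [|m IH] p; first by move=> /= h [].
move=> [/IH h /IH h'] [|k] km; first exact: h.
have := h' k km; rewrite coef_deriv => /eqP.
by rewrite -mulr_natr mulf_eq0 pnatr_eq0 orbF => /eqP.
Qed.

End IteratedDual.

Section TruncatedExp.
Variables (F : numFieldType) (n : nat).

(** The polynomial variable is time: this is exp(tX) truncated after degree m in t. *)
Definition texp (X : 'M[F]_n) (m : nat) : 'M[{poly F}]_n :=
  \sum_(k < m.+1) ((k`!%:R^-1)%:P * 'X^k) *: map_mx polyC (X ^+ k).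

Variable GG : alg_group n.
Local Notation ratF := (ratr : {rmorphism rat -> F}).

(** This is exp((t + eps)X) = exp(tX)(1 + eps X). For the truncation, the derivative in t differs
    from multiplication by X by a multiple of t^N, which [theta m] kills as soon as m < N. *)
Lemma theta_texpS (X : 'M[F]_n) m N : (m < N)%N ->
  map_mx (@theta F m.+1) (texp X N) =
  dual_mx (map_mx (@theta F m) (texp X N)) 0 *m
  dual_mx 1%:M (map_mx (@theta F m \o polyC) X).
Proof.
case: N => // N; rewrite ltnS => mN.
rewrite dual_mxM mulmx1 mul0mx addr0.
have -> : map_mx (@theta F m \o polyC) X = map_mx (@theta F m) (map_mx polyC X).
  by apply/matrixP => i j; rewrite !mxE.
rewrite -map_mxM; apply/matrixP => i j; rewrite !mxE thetaS; congr (_, _).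
suff : theta m (((texp X N.+1 i j)^`()) - (texp X N.+1 *m map_mx polyC X) i j) = 0.
  by rewrite raddfB /= !mxE => /eqP; rewrite subr_eq0 => /eqP.
pose c := N.+1`!%:R^-1 * (X ^+ N.+1 *m X) i j.
have -> : (texp X N.+1 i j)^`() - (texp X N.+1 *m map_mx polyC X) i j =
    (- c)%:P * 'X^(N.+1).
  have eT M : texp X M i j = \sum_(k < M.+1) (k`!%:R^-1 * (X ^+ k) i j)%:P * 'X^k.
    rewrite /texp summxE; apply: eq_bigr => k _.
    by rewrite !mxE mulrAC -polyCM.
  rewrite eT raddf_sum big_ord_recl /= expr0 mulr1 derivC add0r.
  have -> : (texp X N.+1 *m map_mx polyC X) i j =
      \sum_(k < N.+2) (k`!%:R^-1 * (X ^+ k *m X) i j)%:P * 'X^k.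
    rewrite /texp mulmx_suml summxE; apply: eq_bigr => k _.
    by rewrite -scalemxAl -map_mxM !mxE mulrAC -polyCM.
  rewrite [X in _ - X]big_ord_recr /= opprD addrA -sumrB big1 ?add0r; last first.
    move=> k _; rewrite derivM derivC mul0r add0r derivXn /=.
    rewrite /bump leq0n !add1n add0n exprSr mulrnAr -mulrnAl -polyCMn.
    have hk : (k.+1`!%:R^-1 : F) *+ k.+1 = k`!%:R^-1.
      by rewrite -[LHS]mulr_natr factS natrM invfM mulrAC mulVf ?mul1r ?pnatr_eq0.
    by rewrite -mulrnAl hk subrr.
  by rewrite /c polyCN mulNr.
by rewrite rmorphM /= thetaXn // mulr0.
Qed.

(** By induction on m this is a product of the m points 1 + eps_i X. *)
Lemma texp_point (X : 'M[F]_n) m N : X \in lie GG F -> (m <= N)%N ->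
  is_point (ag_eqs GG) (@theta F m \o (polyC \o ratF)) (map_mx (@theta F m) (texp X N)).
Proof.
move=> hX; elim: m N => [|m IH] N mN.
  have -> : map_mx (@theta F 0) (texp X N) = 1%:M.
    apply/matrixP => i j; rewrite mxE /texp summxE /= coef_sum big_ord_recl.
    rewrite !mxE expr0 big1 ?addr0 => [|k _].
      by rewrite mulr1 -polyCM coefC eqxx fact0 invr1 mul1r.
    by rewrite !mxE mulrAC -polyCM coefCM coefXn mulr0.
  by case: (ag_closed GG (@theta F 0 \o (polyC \o ratF))).
rewrite theta_texpS // -map_dual_of.
have e : (@dual_of (idual F m) \o (@theta F m \o (polyC \o ratF))) =1
         (@theta F m.+1 \o (polyC \o ratF)).
  by move=> q /=; rewrite /dual_of derivC raddf0.
case: (ag_closed GG (@theta F m.+1 \o (polyC \o ratF))) => _ M _; apply: M.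
  apply: (@is_point_ext n _ (idual F m.+1)
    (@dual_of (idual F m) \o (@theta F m \o (polyC \o ratF))) _ _ e).
  by apply: is_point_map; apply: IH; exact: ltnW.
have := lie_is_point (@theta F m \o polyC) hX; exact: is_point_ext.
Qed.

Lemma coef_poly_at_texp (X : 'M[F]_n) N P k : X \in lie GG F -> P \in ag_eqs GG ->
  (k <= N)%N -> (poly_at (polyC \o ratF) P (texp X N))`_k = 0.
Proof.
move=> hX PS; apply: theta_eq0; rewrite poly_at_rmorph.
by case: (texp_point hX (leqnn N)) => _; apply.
Qed.

End TruncatedExp.

(** * The matrix exponential *)

Section EntrySumNorm.
Variable R : realType.

(* A submultiplicative norm; the norm of the library on matrices is the maximum
   of the entries. *)
Definition mxn m n (A : 'M[R]_(m, n)) : R := \sum_i \sum_j `|A i j|.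

Lemma mxn_ge0 m n (A : 'M[R]_(m, n)) : 0 <= mxn A.
Proof. by apply: sumr_ge0 => i _; apply: sumr_ge0. Qed.

Lemma mxn_entry m n (A : 'M[R]_(m, n)) i j : `|A i j| <= mxn A.
Proof.
rewrite /mxn (bigD1 i) //= (bigD1 j) //= -addrA lerDl addr_ge0 //.
  by apply: sumr_ge0.
by apply: sumr_ge0 => k _; apply: sumr_ge0.
Qed.

Lemma mxnD m n (A B : 'M[R]_(m, n)) : mxn (A + B) <= mxn A + mxn B.
Proof.
rewrite /mxn -big_split; apply: ler_sum => i _; rewrite -big_split.
by apply: ler_sum => j _; rewrite mxE ler_normD.
Qed.

Lemma mxnZ m n a (A : 'M[R]_(m, n)) : mxn (a *: A) = `|a| * mxn A.
Proof.
rewrite /mxn mulr_sumr; apply: eq_bigr => i _; rewrite mulr_sumr.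
by apply: eq_bigr => j _; rewrite mxE normrM.
Qed.

Lemma mxnN m n (A : 'M[R]_(m, n)) : mxn (- A) = mxn A.
Proof. by rewrite -scaleN1r mxnZ normrN1 mul1r. Qed.

Lemma mxn0 m n : mxn (0 : 'M[R]_(m, n)) = 0.
Proof. by rewrite -(scale0r (0 : 'M[R]_(m, n))) mxnZ normr0 mul0r. Qed.

Lemma mxnB m n (A B : 'M[R]_(m, n)) : mxn (A - B) <= mxn A + mxn B.
Proof. by rewrite -(mxnN B) mxnD. Qed.

Lemma mxn_sum m n (I : Type) (r : seq I) (P : pred I) (F : I -> 'M[R]_(m, n)) :
  mxn (\sum_(i <- r | P i) F i) <= \sum_(i <- r | P i) mxn (F i).
Proof.
elim/big_rec2: _ => [|i x y _ h]; first by rewrite mxn0.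
by apply: le_trans (mxnD _ _) _; rewrite lerD2l.
Qed.

Lemma mxnM m n p (A : 'M[R]_(m, n)) (B : 'M[R]_(n, p)) :
  mxn (A *m B) <= mxn A * mxn B.
Proof.
rewrite /mxn mulr_suml; apply: ler_sum => i _.
rewrite mulr_suml.
apply: (@le_trans _ _ (\sum_j \sum_k `|A i k| * `|B k j|)).
  apply: ler_sum => j _; rewrite mxE; apply: le_trans (ler_norm_sum _ _ _) _.
  by apply: ler_sum => k _; rewrite normrM.
rewrite exchange_big; apply: ler_sum => k _; rewrite -mulr_sumr ler_wpM2l //.
by rewrite [leRHS](bigD1 k) //= lerDl; apply: sumr_ge0 => l _; apply: sumr_ge0.
Qed.

Lemma mxn_eq0 m n (A : 'M[R]_(m, n)) : (mxn A == 0) = (A == 0).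
Proof.
apply/idP/eqP => [/eqP h|->]; last by rewrite mxn0.
apply/matrixP => i j; rewrite mxE; apply/eqP; rewrite -normr_le0 -h.
exact: mxn_entry.
Qed.

Lemma mxn1 n : mxn (1%:M : 'M[R]_n) = n%:R.
Proof.
rewrite /mxn (eq_bigr (fun=> 1)) ?sumr_const ?card_ord // => i _.
rewrite (bigD1 i) //= mxE eqxx normr1 big1 ?addr0 // => j ij.
by rewrite mxE eq_sym (negPf ij) normr0.
Qed.

(** The factor n is the norm of the identity and accounts for k = 0. *)
Lemma mxnXn n (A : 'M[R]_n) k : mxn (A ^+ k) <= n%:R * mxn A ^+ k.
Proof.
elim: k => [|k IH]; first by rewrite !expr0 mulr1 mxn1.
rewrite exprSr; apply: le_trans (mxnM _ _) _.
by rewrite exprSr mulrA ler_wpM2r // mxn_ge0.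
Qed.

End EntrySumNorm.

Section MatrixExp.
Variables (R : realType) (n : nat).
Local Notation M := 'M[R]_n.

Definition psum (X : M) : nat -> M := series (fun k => (k`!%:R)^-1 *: X ^+ k).
Definition epsum (a : R) : nat -> R := series (exp_coeff a).
Definition etail (a : R) (N : nat) : R := expR a - epsum a N.

Lemma epsum_cvg a : epsum a @ \oo --> expR a.
Proof. exact: (is_cvg_series_exp_coeff a). Qed.

Lemma etail_cvg a : etail a @ \oo --> 0.
Proof.
by rewrite -(subrr (expR a)); apply: cvgB; [exact: cvg_cst|exact: epsum_cvg].
Qed.

Lemma epsum_ndecr a : 0 <= a -> nondecreasing_seq (epsum a).
Proof.
move=> a0; apply/nondecreasing_seqP => k.
by rewrite /epsum /series /= big_nat_recr //= lerDl exp_coeff_ge0.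
Qed.

Lemma epsum_le a N : 0 <= a -> epsum a N <= expR a.
Proof.
move=> a0; apply: nondecreasing_cvgn_le; first exact: epsum_ndecr.
exact: is_cvg_series_exp_coeff.
Qed.

(** Every term of the tail has degree k >= N in t, and t^k <= t^N on [0, 1]. This turns tails of the
    series into Taylor remainders. *)
Lemma etail_scale (t a : R) N : 0 <= t <= 1 -> 0 <= a ->
  etail (t * a) N <= t ^+ N * expR a.
Proof.
move=> /andP[t0 t1] a0; rewrite /etail lerBlDr.
apply: (cvgr_to_le (@epsum_cvg (t * a))).
exists N => //= K NK; rewrite -lerBlDr.
rewrite /epsum sub_series NK.
apply: (@le_trans _ _ (t ^+ N * \sum_(N <= k < K) exp_coeff a k)).
  rewrite mulr_sumr big_nat [leRHS]big_nat; apply: ler_sum => k /andP[Nk _].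
  rewrite /exp_coeff /= exprMn mulrA ler_wpM2r ?invr_ge0 ?ler0n //.
  by rewrite ler_wpM2r ?exprn_ge0 // ler_wiXn2l.
rewrite ler_wpM2l ?exprn_ge0 //; apply: le_trans (epsum_le K a0).
rewrite /epsum /series /= [leRHS](@big_cat_nat _ _ _ N) //= lerDr.
by apply: sumr_ge0 => k _; exact: exp_coeff_ge0.
Qed.

Lemma psumB (X : M) N K : (N <= K)%N ->
  mxn (psum X K - psum X N) <= n%:R * (epsum (mxn X) K - epsum (mxn X) N).
Proof.
move=> NK; rewrite /psum /epsum !sub_series NK mulr_sumr.
apply: le_trans (mxn_sum _ _ _) _; apply: ler_sum => k _.
rewrite mxnZ ger0_norm ?invr_ge0 ?ler0n // /exp_coeff /=.
by rewrite mulrA mulrC ler_wpM2r ?invr_ge0 ?ler0n // mxnXn.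
Qed.

Lemma cvg_mx (u : nat -> M) (A : M) :
  (forall i j, (fun k => u k i j) @ \oo --> A i j) -> u @ \oo --> A.
Proof.
move=> h; apply/cvgrPdist_le => /= e e0.
have H : \forall k \near \oo, forall ij : 'I_n * 'I_n, `|A ij.1 ij.2 - u k ij.1 ij.2| <= e.
  by apply: filter_forall => ij; move/cvgrPdist_le : (h ij.1 ij.2); exact.
apply: filterS H => k H.
rewrite /Num.Def.normr/= mx_normrE (bigmax_le _ (ltW e0))//= => ij _.
by rewrite !mxE.
Qed.

Lemma cvg_entry (u : nat -> M) (A : M) i j : u @ \oo --> A -> (fun k => u k i j) @ \oo --> A i j.
Proof.
move=> h; apply: (@cvg_comp nat M R u (fun B : M => B i j) \oo (nbhs A)) => //.
exact: coord_continuous.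
Qed.

Lemma psum_cvg (X : M) : psum X @ \oo --> expm X.
Proof.
suff [A hA] : exists A, psum X @ \oo --> (A : M) by exact: (cvgP A hA).
have cv i j : cvgn (fun k => psum X k i j).
  have -> : (fun k => psum X k i j) = series (fun k => (k`!%:R)^-1 * (X ^+ k) i j).
    apply/funext => k; rewrite /psum /series /= summxE.
    by apply: eq_bigr => l _; rewrite mxE.
  apply: normed_cvg; apply: (@series_le_cvg _ _ (fun k => n%:R * exp_coeff (mxn X) k)).
  - by move=> k; exact: normr_ge0.
  - by move=> k; rewrite mulr_ge0 ?ler0n // exp_coeff_ge0 ?mxn_ge0.
  - move=> k /=; rewrite normrM ger0_norm ?invr_ge0 ?ler0n //.
    rewrite /exp_coeff /= mulrA mulrC ler_wpM2r ?invr_ge0 ?ler0n //.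
    exact: le_trans (mxn_entry _ _ _) (mxnXn _ _).
  - exact: is_cvg_seriesZ (is_cvg_series_exp_coeff _).
exists (\matrix_(i, j) limn (fun k => psum X k i j)); apply: cvg_mx => i j.
by rewrite mxE; exact: cv.
Qed.

Lemma mxn_le_cvg (u : nat -> M) (A : M) c :
  u @ \oo --> A -> (\forall k \near \oo, mxn (u k) <= c) -> mxn A <= c.
Proof.
move=> hu; apply: cvgr_to_le; rewrite /mxn.
apply: (cvg_big add_continuous) => i _; apply: (cvg_big add_continuous) => j _.
by apply: cvg_norm; exact: cvg_entry.
Qed.

Lemma expm_psum (X : M) N : mxn (expm X - psum X N) <= n%:R * etail (mxn X) N.
Proof.
apply: (@mxn_le_cvg (fun K => psum X K - psum X N)).
  by apply: cvgB; [exact: psum_cvg|exact: cvg_cst].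
exists N => //= K NK; apply: le_trans (psumB X NK) _.
by rewrite ler_wpM2l ?ler0n // lerD2r epsum_le ?mxn_ge0.
Qed.

End MatrixExp.

(** * One-parameter subgroups *)

Section CauchyProduct.

(** The part i + j >= N of an N by N square: the excess of the product of two partial sums over the
    partial sum of the Cauchy product. *)
Definition corner (V : zmodType) (f : nat -> nat -> V) (N : nat) : V :=
  \sum_(0 <= i < N) \sum_(N - i <= j < N) f i j.

Lemma square_corner (V : zmodType) (f : nat -> nat -> V) N :
  \sum_(0 <= i < N) \sum_(0 <= j < N) f i j =
  \sum_(0 <= k < N) \sum_(0 <= i < k.+1) f i (k - i)%N + corner f N.
Proof.
have tri : \sum_(0 <= i < N) \sum_(0 <= j < N - i) f i j =
    \sum_(0 <= k < N) \sum_(0 <= i < k.+1) f i (k - i)%N.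
  elim: N => [|N IH]; first by rewrite !big_geq.
  rewrite [RHS]big_nat_recr //= -IH [X in _ = _ + X]big_nat_recr //= addrA -big_split /=.
  rewrite big_nat_recr //= subSnn big_nat1 subnn; congr (_ + _).
  rewrite big_nat [RHS]big_nat; apply: eq_bigr => i /= iN.
  by rewrite subSn 1?ltnW // big_nat_recr.
rewrite -tri /corner -big_split; apply: eq_bigr => i _ /=.
by rewrite [LHS](@big_cat_nat _ _ _ (N - i)) // leq_subr.
Qed.

End CauchyProduct.

Section ExpProduct.
Variables (R : realType) (n : nat).
Local Notation M := 'M[R]_n.

Lemma exp_coeff_binomial (s t : R) k :
  \sum_(0 <= i < k.+1) exp_coeff s i * exp_coeff t (k - i)%N = exp_coeff (s + t) k.
Proof.
rewrite /exp_coeff /= addrC exprDn mulr_suml big_mkord; apply: eq_bigr => i _.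
have ik : (i <= k)%N by rewrite -ltnS.
have e : (binomial k i)%:R * (i`!%:R * (k - i)%N`!%:R) = k`!%:R :> R.
  by rewrite -!natrM bin_fact.
rewrite -e -mulr_natr; field.
by rewrite !pnatr_eq0 -!lt0n !fact_gt0 bin_gt0 ik.
Qed.

Lemma exprZmx (t : R) (X : M) k : (t *: X) ^+ k = t ^+ k *: X ^+ k.
Proof.
elim: k => [|k IH]; first by rewrite !expr0 scale1r.
by rewrite !exprS IH -!mulmxE -scalemxAl -scalemxAr scalerA.
Qed.

Lemma psumE (t : R) (X : M) N :
  psum (t *: X) N = \sum_(0 <= k < N) exp_coeff t k *: X ^+ k.
Proof.
rewrite /psum /series /=; apply: eq_bigr => k _.
by rewrite exprZmx scalerA /exp_coeff /= mulrC.
Qed.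

Let pprod (s t : R) (X : M) N :
  psum (s *: X) N *m psum (t *: X) N - psum ((s + t) *: X) N =
  corner (fun i j => (exp_coeff s i * exp_coeff t j) *: X ^+ (i + j)) N.
Proof.
rewrite !psumE mulmx_suml.
under eq_bigr => i _.
  rewrite mulmx_sumr.
  under eq_bigr => j _ do rewrite -scalemxAl -scalemxAr scalerA -[_ *m _]/(X ^+ i * X ^+ j) -exprD.
  over.
rewrite square_corner.
under [X in X + _ - _]eq_bigr => k _.
  rewrite big_nat.
  under eq_bigr => i /= ik do rewrite subnKC //.
  rewrite -big_nat -scaler_suml exp_coeff_binomial.
  over.
by rewrite addrAC subrr add0r.
Qed.

Let pprod_le (s t : R) (X : M) N :
  mxn (psum (s *: X) N *m psum (t *: X) N - psum ((s + t) *: X) N) <=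
  n%:R * (epsum (`|s| * mxn X) N * epsum (`|t| * mxn X) N - epsum (`|s| * mxn X + `|t| * mxn X) N).
Proof.
set a := `|s| * _; set b := `|t| * _.
have -> : epsum a N * epsum b N - epsum (a + b) N =
    corner (fun i j => exp_coeff a i * exp_coeff b j) N.
  rewrite /epsum /series /= mulr_suml.
  under [X in X - _]eq_bigr => i _ do rewrite mulr_sumr.
  rewrite square_corner.
  under [X in X + _ - _]eq_bigr => k _ do rewrite exp_coeff_binomial.
  by rewrite addrAC subrr add0r.
rewrite pprod /corner mulr_sumr.
apply: le_trans (mxn_sum _ _ _) _; apply: ler_sum => i _; rewrite mulr_sumr.
apply: le_trans (mxn_sum _ _ _) _; apply: ler_sum => j _.
rewrite mxnZ; apply: le_trans (ler_wpM2l (normr_ge0 _) (mxnXn _ _)) _.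
rewrite /exp_coeff /= !normrM !normfV !normrX !(ger0_norm (ler0n _ _)).
rewrite /a /b !exprMn exprD le_eqVlt; apply/orP; left; apply/eqP; ring.
Qed.

Lemma cvg_mxn (u : nat -> M) (A : M) :
  u @ \oo --> A -> (fun k => mxn (u k)) @ \oo --> mxn A.
Proof.
move=> hu; rewrite /mxn.
apply: (cvg_big add_continuous) => i _; apply: (cvg_big add_continuous) => j _.
by apply: cvg_norm; exact: cvg_entry.
Qed.

Lemma cvg_mxM (u v : nat -> M) (A B : M) :
  u @ \oo --> A -> v @ \oo --> B -> (fun k => u k *m v k) @ \oo --> A *m B.
Proof.
move=> hu hv; apply: cvg_mx => i j; rewrite mxE.
under eq_cvg do rewrite mxE.
apply: (cvg_big add_continuous) => k _; apply: cvgM; exact: cvg_entry.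
Qed.

(** On partial sums, the defect of this equation consists of corner terms. They are bounded one by
    one by the corner terms of the real series at |s| |X| and |t| |X|, whose sum tends to 0 by the
    functional equation of [expR]. *)
Lemma expmDZ (s t : R) (X : M) : expm ((s + t) *: X) = expm (s *: X) *m expm (t *: X).
Proof.
apply/esym/eqP; rewrite -subr_eq0 -mxn_eq0 eq_le mxn_ge0 andbT.
pose a := `|s| * mxn X; pose b := `|t| * mxn X.
have <- : n%:R * (expR a * expR b - expR (a + b)) = 0 by rewrite expRD subrr mulr0.
apply: (ler_cvg_to (a := \oo)
  (f := fun N => mxn (psum (s *: X) N *m psum (t *: X) N - psum ((s + t) *: X) N))
  (g := fun N => n%:R * (epsum a N * epsum b N - epsum (a + b) N))).
- exact: (cvg_mxn (cvgB (cvg_mxM (@psum_cvg _ _ (s *: X)) (@psum_cvg _ _ (t *: X)))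
    (@psum_cvg _ _ ((s + t) *: X)))).
- by apply: cvgMr; apply: cvgB; [apply: cvgM|]; exact: epsum_cvg.
- by near=> N; exact: pprod_le.
Unshelve. all: by end_near. Qed.

Lemma expm0 : expm (0 : M) = 1%:M.
Proof.
apply: cvg_lim => //; rewrite -(cvg_shiftS _).
have -> : (fun k => psum (0 : M) k.+1) = fun=> 1%:M.
  apply/funext => k; rewrite /psum /series /= big_nat_recl //= big1 ?addr0.
    by rewrite expr0 invr1 scale1r.
  by move=> i _; rewrite expr0n scaler0.
exact: cvg_cst.
Qed.

Lemma expmZN (t : R) (X : M) : expm (t *: X) *m expm (- t *: X) = 1%:M.
Proof. by rewrite -expmDZ subrr scale0r expm0. Qed.

Lemma expm_taylor (X : M) N t : `|t| <= 1 ->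
  mxn (expm (t *: X) - psum (t *: X) N) <= n%:R * expR (mxn X) * `|t| ^+ N.
Proof.
move=> t1; apply: le_trans (expm_psum _ _) _.
rewrite -mulrA ler_wpM2l ?ler0n // mulrC mxnZ.
by apply: etail_scale; rewrite ?mxn_ge0 // normr_ge0.
Qed.

Lemma psum2 (X : M) : psum X 2 = 1%:M + X.
Proof.
rewrite /psum /series /= big_nat_recr //= big_nat1 expr0 expr1.
by rewrite fact0 invr1 !scale1r.
Qed.

Lemma psum3 (X : M) : psum X 3 = 1%:M + X + 2^-1 *: (X *m X).
Proof.
rewrite [LHS]/psum /series /= big_nat_recr //=; congr (_ + _).
exact: psum2.
Qed.

End ExpProduct.

(** * Exponentials of the Lie algebra are points of the group *)

Section ExpPoint.
Variables (R : realType) (n : nat) (GG : alg_group n).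
Local Notation M := 'M[R]_n.
Local Notation ratR := (ratr : {rmorphism rat -> R}).

(** Coefficientwise domination by C exp(at). It passes to sums and products, so an equation
    evaluated at the truncated exponential satisfies it with constants independent of the order of
    truncation. *)
Definition dominated (C a : R) (p : {poly R}) :=
  forall k, `|p`_k| <= C * exp_coeff a k.

Lemma exp_coeff_le (a b : R) k : 0 <= a <= b -> exp_coeff a k <= exp_coeff b k.
Proof.
move=> /andP[a0 ab]; rewrite /exp_coeff /= ler_wpM2r ?invr_ge0 ?ler0n //.
by rewrite lerXn2r // nnegrE // (le_trans a0).
Qed.

Lemma dominatedD C a C' a' p q : 0 <= C -> 0 <= C' -> 0 <= a -> 0 <= a' ->
  dominated C a p -> dominated C' a' q -> dominated (C + C') (a + a') (p + q).
Proof.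
move=> C0 C'0 a0 a'0 hp hq k; rewrite coefD mulrDl; apply: le_trans (ler_normD _ _) _.
apply: lerD; [apply: le_trans (hp k) _|apply: le_trans (hq k) _].
  by rewrite ler_wpM2l // exp_coeff_le // a0 lerDl.
by rewrite ler_wpM2l // exp_coeff_le // a'0 lerDr.
Qed.

Lemma dominatedM C a C' a' p q :
  dominated C a p -> dominated C' a' q -> dominated (C * C') (a + a') (p * q).
Proof.
move=> hp hq k; rewrite coefM -exp_coeff_binomial big_mkord mulr_sumr.
apply: le_trans (ler_norm_sum _ _ _) _; apply: ler_sum => i _.
by rewrite normrM mulrACA; apply: ler_pM.
Qed.

Lemma dominated_texp (X : M) N i j : dominated n%:R (mxn X) (texp X N i j).
Proof.
move=> k; rewrite /texp summxE coef_sum.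
have e (l : 'I_N.+1) : ((((l`!%:R^-1)%:P * 'X^l) *: map_mx polyC (X ^+ l)) i j)`_k
    = if k == l then k`!%:R^-1 * (X ^+ k) i j else 0.
  rewrite !mxE mulrAC -polyCM coefCM coefXn.
  by case: eqP => [->|_]; rewrite ?mulr1 ?mulr0.
rewrite (eq_bigr _ (fun l _ => e l)).
have [kN|kN] := ltnP k N.+1; last first.
  rewrite big1 ?normr0 => [|l _]; first by apply: mulr_ge0; rewrite ?exp_coeff_ge0 ?mxn_ge0.
  by case: eqP => // kl; move: kN; rewrite kl leqNgt ltn_ord.
rewrite (bigD1 (Ordinal kN)) //= eqxx big1 ?addr0; last first.
  by move=> l lN; case: eqP => // kl; case/eqP: lN; exact: val_inj.
rewrite normrM ger0_norm ?invr_ge0 ?ler0n // /exp_coeff /= mulrA mulrC.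
rewrite ler_wpM2r ?invr_ge0 ?ler0n //.
exact: le_trans (mxn_entry _ _ _) (mxnXn _ _).
Qed.

Lemma dominated_poly_at (X : M) P : exists C a, [/\ 0 <= C, 0 <= a &
  forall N, dominated C a (poly_at (polyC \o ratR) P (texp X N))].
Proof.
elim/mpoly_ring_ind: P => [c|k|p q|p q].
- exists `|ratR c|, 0; split=> // N l; rewrite poly_atC /= coefC /exp_coeff /=.
  case: l => [|l] /=; first by rewrite expr0 fact0 invr1 !mulr1.
  by rewrite normr0 mulr_ge0 // mulr_ge0 ?invr_ge0 ?ler0n ?exprn_ge0.
- exists n%:R, (mxn X); split; [exact: ler0n|exact: mxn_ge0|move=> N].
  rewrite poly_atX; case/mxvec_indexP: k => i j; rewrite mxvecE.
  exact: dominated_texp.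
- move=> [C [a [C0 a0 hp]]] [C' [a' [C'0 a'0 hq]]].
  exists (C + C'), (a + a'); split; [exact: addr_ge0|exact: addr_ge0|move=> N].
  by rewrite poly_atD; exact: (dominatedD C0 C'0 a0 a'0 (hp N) (hq N)).
- move=> [C [a [C0 a0 hp]]] [C' [a' [C'0 a'0 hq]]].
  exists (C * C'), (a + a'); split; [exact: mulr_ge0|exact: addr_ge0|move=> N].
  by rewrite poly_atM; exact: (dominatedM (hp N) (hq N)).
Qed.

Lemma horner_poly_at_texp (X : M) N P :
  (poly_at (polyC \o ratR) P (texp X N)).[1] = poly_at ratR P (psum X N.+1).
Proof.
rewrite -[LHS]/(horner_eval 1 _) poly_at_rmorph.
have -> : map_mx (horner_eval 1) (texp X N) = psum X N.+1.
  apply/matrixP => i j; rewrite mxE /texp /psum /series /= !summxE big_mkord.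
  rewrite rmorph_sum; apply: eq_bigr => k _.
  by rewrite !mxE /= /horner_eval !(hornerM, hornerC, hornerXn) expr1n mulr1.
by congr (poly_at _ P _); apply/funext => q /=; rewrite /horner_eval hornerC.
Qed.

Lemma cvg_poly_at (u : nat -> M) (A : M) P : u @ \oo --> A ->
  (fun k => poly_at ratR P (u k)) @ \oo --> poly_at ratR P A.
Proof.
move=> hu; elim/mpoly_ring_ind: P => [c|k|p q hp hq|p q hp hq].
- under eq_cvg do rewrite poly_atC.
  by rewrite poly_atC; exact: cvg_cst.
- have [i [j ->]] : exists i j, k = mxvec_index i j.
    by case/mxvec_indexP: k => i j; exists i, j.
  under eq_cvg do rewrite poly_atX mxvecE.
  by rewrite poly_atX mxvecE; exact: cvg_entry.
- under eq_cvg do rewrite poly_atD.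
  by rewrite poly_atD; exact: cvgD.
- under eq_cvg do rewrite poly_atM.
  by rewrite poly_atM; exact: cvgM.
Qed.

(** The value of P at a partial sum is the value at t = 1 of a polynomial in t whose coefficients up
    to the order of truncation vanish. The remaining ones are dominated, so this value is at most C
    times a tail of an exponential series, and the tail tends to 0. *)
Lemma expm_eq0 (X : M) P : X \in lie GG R -> P \in ag_eqs GG ->
  poly_at ratR P (expm X) = 0.
Proof.
move=> hX PS; have [C [a [C0 a0 hC]]] := dominated_poly_at X P.
apply/eqP; rewrite -normr_le0 -(mulr0 C).
apply: (ler_cvg_to (a := \oo) (f := fun N => `|poly_at ratR P (psum X N)|)
  (g := fun N => C * etail a N)).
- by apply: cvg_norm; apply: cvg_poly_at; exact: psum_cvg.
- by apply: cvgMr; exact: etail_cvg.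
- exists 1%N => // -[//|N] _; rewrite /= -horner_poly_at_texp.
  set p := poly_at _ _ _.
  have pN k : (k <= N)%N -> p`_k = 0 by exact: (coef_poly_at_texp hX PS).
  (* Summing up to [m] allows the vanishing coefficients to be split off even if [p] has low
     degree. *)
  pose m := maxn N.+1 (size p).
  rewrite (@horner_coef_wide _ m) ?leq_maxr //.
  rewrite -(big_mkord xpredT (fun k => p`_k * 1 ^+ k)).
  rewrite (@big_cat_nat _ _ _ N.+1) ?leq_maxl //= big_nat big1 ?add0r; last first.
    by move=> k; rewrite ltnS => /= kN; rewrite pN // mul0r.
  apply: le_trans (ler_norm_sum _ _ _) _.
  apply: (@le_trans _ _ (\sum_(N.+1 <= k < m) C * exp_coeff a k)).
    by apply: ler_sum => k _; rewrite expr1n mulr1; exact: hC.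
  rewrite -mulr_sumr ler_wpM2l // /etail.
  apply: le_trans (lerB (epsum_le m a0) (lexx _)).
  by rewrite /epsum sub_series leq_maxl.
Qed.

Lemma expm_point (X : M) : X \in lie GG R -> point_set GG R (expm X).
Proof.
move=> hX; split; last by move=> P; exact: expm_eq0.
exists (expm (-1 *: X)); have := expmZN (-1) X; have := expmZN 1 X.
by rewrite opprK !scale1r.
Qed.

Lemma val_exp_pt (X : M) : X \in lie GG R ->
  val (exp_pt X : points GG R) = expm X.
Proof. by move=> hX; rewrite /exp_pt val_insubd (mem_set (expm_point hX)). Qed.


Lemma val_ptM (x y : points GG R) : val (x * y)%g = val x *m val y.
Proof. by []. Qed.

Lemma val_pt1 : val (1%g : points GG R) = 1%:M.
Proof. by []. Qed.

Lemma exp_ptDZ (s t : R) (X : M) : X \in lie GG R ->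
  exp_pt ((s + t) *: X) = (exp_pt (s *: X) * exp_pt (t *: X))%g :> points GG R.
Proof.
move=> hX.
have hZ u : u *: X \in lie GG R by rewrite memvZ.
apply: val_inj.
rewrite (val_exp_pt (hZ (s + t))).
rewrite (val_ptM (exp_pt (s *: X)) (exp_pt (t *: X))).
rewrite expmDZ.
apply: congr2.
exact: esym (val_exp_pt (hZ s)).
exact: esym (val_exp_pt (hZ t)).
Qed.

Lemma exp_pt0 : exp_pt 0 = 1%g :> points GG R.
Proof. by apply: val_inj; rewrite val_exp_pt ?mem0v // expm0. Qed.

Lemma exp_ptV (t : R) (X : M) : X \in lie GG R ->
  (exp_pt (t *: X))^-1%g = exp_pt (- t *: X) :> points GG R.
Proof.
move=> hX; apply: (@mulgI _ (exp_pt (t *: X))); rewrite mulgV -exp_ptDZ //.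
by rewrite subrr scale0r exp_pt0.
Qed.

End ExpPoint.

(** * Orders of magnitude and group commutators *)

Section Order.
Variables (R : realType) (T : Type) (u : T -> R) (u0 : forall x, 0 <= u x).

(** The bound holds on the fixed domain u <= 1 rather than near 0, so orders can be lowered and
    added without shrinking neighbourhoods. The gauge [u] is a parameter: it is |s| for
    one-parameter commutators and a square root for their products. *)
Definition bigOh m n (k : nat) (f : T -> 'M[R]_(m, n)) : Prop :=
  exists2 C, 0 <= C & forall x, u x <= 1 -> mxn (f x) <= C * u x ^+ k.

Lemma bigOh_ext m n k (f g : T -> 'M[R]_(m, n)) :
  (forall x, f x = g x) -> bigOh k f -> bigOh k g.
Proof. by move=> e [C C0 h]; exists C => // x ux; rewrite -e h. Qed.

Lemma bigOh_le m n j k (f : T -> 'M[R]_(m, n)) :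
  (j <= k)%N -> bigOh k f -> bigOh j f.
Proof.
move=> jk [C C0 h]; exists C => // x ux; apply: le_trans (h x ux) _.
by rewrite ler_wpM2l // ler_wiXn2l.
Qed.

Lemma bigOh_add m n k (f g : T -> 'M[R]_(m, n)) :
  bigOh k f -> bigOh k g -> bigOh k (fun x => f x + g x).
Proof.
move=> [C C0 h] [D D0 h']; exists (C + D); first exact: addr_ge0.
move=> x ux; rewrite mulrDl; apply: le_trans (mxnD _ _) _.
by apply: lerD; [exact: h|exact: h'].
Qed.

Lemma bigOh_mul m n p j k (f : T -> 'M[R]_(m, n)) (g : T -> 'M[R]_(n, p)) :
  bigOh j f -> bigOh k g -> bigOh (j + k) (fun x => f x *m g x).
Proof.
move=> [C C0 h] [D D0 h']; exists (C * D); first exact: mulr_ge0.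
move=> x ux; rewrite exprD mulrACA; apply: le_trans (mxnM _ _) _.
by apply: ler_pM; rewrite ?mxn_ge0 ?h ?h'.
Qed.

Lemma bigOh_opp m n k (f : T -> 'M[R]_(m, n)) :
  bigOh k f -> bigOh k (fun x => - f x).
Proof. by move=> [C C0 h]; exists C => // x ux; rewrite mxnN h. Qed.

Lemma bigOh_sub m n k (f g : T -> 'M[R]_(m, n)) :
  bigOh k f -> bigOh k g -> bigOh k (fun x => f x - g x).
Proof. by move=> hf hg; apply: bigOh_add => //; exact: bigOh_opp. Qed.

Lemma bigOh_scale m n k (a : T -> R) (A : 'M[R]_(m, n)) :
  (forall x, `|a x| <= u x ^+ k) -> bigOh k (fun x => a x *: A).
Proof.
move=> h; exists (mxn A); first exact: mxn_ge0.
by move=> x ux; rewrite mxnZ mulrC ler_wpM2l ?mxn_ge0.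
Qed.

Lemma bigOh_cst m n (A : 'M[R]_(m, n)) : bigOh 0 (fun=> A).
Proof.
by exists (mxn A) => [|x _]; rewrite ?mxn_ge0 // expr0 mulr1.
Qed.

End Order.

Section Commutators.
Variables (R : realType) (n : nat).
Local Notation M := 'M[R]_n.
Local Notation O k f := (@bigOh R R (fun s => `|s|) n n k f).

Lemma bigOh_pow k (A : M) : O k (fun s => s ^+ k *: A).
Proof. by apply: bigOh_scale => s; rewrite normrX. Qed.

Lemma bigOh_expm N (X : M) : O N (fun s => expm (s *: X) - psum (s *: X) N).
Proof.
exists (n%:R * expR (mxn X)); first by rewrite mulr_ge0 ?ler0n ?expR_ge0.
by move=> s s1; exact: expm_taylor.
Qed.

Let u0 (s : R) : 0 <= `|s|. Proof. exact: normr_ge0. Qed.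

Lemma bigOh_expm1 (X : M) : O 1 (fun s => expm (s *: X) - 1%:M).
Proof.
have := bigOh_expm 1 X; apply: bigOh_ext => s.
by rewrite /psum /series /= big_nat1 expr0 fact0 invr1 scale1r.
Qed.

Definition group_comm (Y Z : M) (s : R) : M :=
  expm (s *: Y) *m expm (s *: Z) *m (expm (- s *: Y) *m expm (- s *: Z)).

Lemma bracketZ (a b : R) (Y Z : M) : bracket (a *: Y) (b *: Z) = (a * b) *: bracket Y Z.
Proof.
by rewrite /bracket -!scalemxAl -!scalemxAr !scalerA [b * a]mulrC scalerBr.
Qed.

(** The commutator minus 1 is D V, where D = exp(sY) exp(sZ) - exp(sZ) exp(sY) and V = exp(-sY)
    exp(-sZ). All cancellation takes place in D, which is s^2 [Y, Z] up to order 3, while V is 1 up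
    to order 1. *)
Lemma bigOh_group_comm (Y Z : M) :
  O 3 (fun s => group_comm Y Z s - 1%:M - s ^+ 2 *: bracket Y Z).
Proof.
pose r (X : M) (s : R) := expm (s *: X) - psum (s *: X) 3.
have hr (X : M) : O 3 (r X) by exact: bigOh_expm.
pose D (s : R) := expm (s *: Y) *m expm (s *: Z) - expm (s *: Z) *m expm (s *: Y).
have hD : O 3 (fun s => D s - s ^+ 2 *: bracket Y Z).
  have hp (X : M) : O 0 (fun s => psum (s *: X) 3).
    have e (s : R) : 1%:M + s ^+ 1 *: X + s ^+ 2 *: (2^-1 *: (X *m X)) = psum (s *: X) 3.
      rewrite psum3 expr1 -scalemxAl -scalemxAr !scalerA; congr (_ + _ *: _).
      by ring.
    apply: (bigOh_ext e); apply: bigOh_add; first apply: bigOh_add.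
    - exact: bigOh_cst.
    - by apply: (@bigOh_le _ _ _ _ _ _ 0 1) => //; exact: bigOh_pow.
    - by apply: (@bigOh_le _ _ _ _ _ _ 0 2) => //; exact: bigOh_pow.
  pose A (s : R) := psum (s *: Y) 3 *m psum (s *: Z) 3 - psum (s *: Z) 3 *m psum (s *: Y) 3.
  have hA : O 3 (fun s => A s - s ^+ 2 *: bracket Y Z).
    (* The exact difference for the quadratic Taylor polynomials: only terms of degree 3 and 4 in s
       survive. *)
    have e (s : R) : s ^+ 3 *: (2^-1 *: (bracket Y (Z *m Z) + bracket (Y *m Y) Z)) +
        s ^+ 4 *: (2^-1 *: (2^-1 *: bracket (Y *m Y) (Z *m Z))) =
        A s - s ^+ 2 *: bracket Y Z.
      have sq (X : M) : (s *: X) *m (s *: X) = (s ^+ 2) *: (X *m X).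
        by rewrite -scalemxAl -scalemxAr scalerA expr2.
      have E : s ^+ 2 *: bracket Y Z = bracket (s *: Y) (s *: Z).
        by rewrite bracketZ expr2.
      have E3 : s ^+ 3 *: (2^-1 *: (bracket Y (Z *m Z) + bracket (Y *m Y) Z)) =
          2^-1 *: (bracket (s *: Y) ((s *: Z) *m (s *: Z)) +
                   bracket ((s *: Y) *m (s *: Y)) (s *: Z)).
        by rewrite !sq !bracketZ -exprS -exprSr -scalerDr !scalerA mulrC.
      have E4 : s ^+ 4 *: (2^-1 *: (2^-1 *: bracket (Y *m Y) (Z *m Z))) =
          2^-1 *: (2^-1 *: bracket ((s *: Y) *m (s *: Y)) ((s *: Z) *m (s *: Z))).
        by rewrite !sq bracketZ -exprD !scalerA mulrC mulrA.
      rewrite E E3 E4 /A !psum3; move: (s *: Y) (s *: Z) => a b.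
      rewrite /bracket !(mulmxDl, mulmxDr) !(mul1mx, mulmx1) -!scalemxAl -!scalemxAr.
      move: (a *m b) (b *m a) (a *m a *m b) (b *m (a *m a)) (a *m (b *m b)) (b *m b *m a).
      move: (a *m a *m (b *m b)) (b *m b *m (a *m a)) (a *m a) (b *m b).
      move=> x1 x2 x3 x4 x5 x6 x7 x8 x9 x10; apply/matrixP => i j; rewrite !mxE; ring.
    apply: (bigOh_ext e); apply: bigOh_add; first exact: bigOh_pow.
    by apply: (@bigOh_le _ _ _ _ _ _ 3 4) => //; exact: bigOh_pow.
  have e (s : R) : (A s - s ^+ 2 *: bracket Y Z) +
      (psum (s *: Y) 3 *m r Z s - r Z s *m psum (s *: Y) 3) +
      (r Y s *m psum (s *: Z) 3 - psum (s *: Z) 3 *m r Y s) +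
      (r Y s *m r Z s - r Z s *m r Y s) = D s - s ^+ 2 *: bracket Y Z.
    rewrite /A /D.
    have -> : expm (s *: Y) = psum (s *: Y) 3 + r Y s by rewrite /r addrC subrK.
    have -> : expm (s *: Z) = psum (s *: Z) 3 + r Z s by rewrite /r addrC subrK.
    move: (psum (s *: Y) 3) (psum (s *: Z) 3) (r Y s) (r Z s) (s ^+ 2 *: bracket Y Z) => p q a b c.
    rewrite !mulmxDl !mulmxDr.
    move: (p *m q) (q *m p) (p *m b) (b *m p) (a *m q) (q *m a) (a *m b) (b *m a).
    move=> x1 x2 x3 x4 x5 x6 x7 x8.
    apply/matrixP => i j; rewrite !mxE; ring.
  apply: (bigOh_ext e); apply: bigOh_add; [apply: bigOh_add; [apply: bigOh_add; first by []|]|].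
  - apply: bigOh_sub; first exact: (bigOh_mul (hp Y) (hr Z)).
    exact: (bigOh_mul (hr Z) (hp Y)).
  - by apply: bigOh_sub; [exact: (bigOh_mul (hr Y) (hp Z))|exact: (bigOh_mul (hp Z) (hr Y))].
  - apply: (@bigOh_le _ _ _ _ _ _ 3 6) => //.
    by apply: bigOh_sub; [exact: (bigOh_mul (hr Y) (hr Z))|exact: (bigOh_mul (hr Z) (hr Y))].
pose V (s : R) := expm (- s *: Y) *m expm (- s *: Z).
have hN (X : M) : O 1 (fun s => expm (- s *: X) - 1%:M).
  have := bigOh_expm1 (- X); apply: bigOh_ext => s.
  by rewrite scalerN scaleNr.
have hV : O 1 (fun s => V s - 1%:M).
  have e (s : R) : (expm (- s *: Y) - 1%:M) *m (expm (- s *: Z) - 1%:M) +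
      (expm (- s *: Y) - 1%:M) + (expm (- s *: Z) - 1%:M) = V s - 1%:M.
    rewrite /V !mulmxBl !mulmxBr mul1mx !mulmx1.
    move: (expm (- s *: Y)) (expm (- s *: Z)) => y z; move: (y *m z) => x.
    apply/matrixP => i j; rewrite !mxE; ring.
  apply: (bigOh_ext e); apply: bigOh_add => //; apply: bigOh_add => //.
  by apply: (@bigOh_le _ _ _ _ _ _ 1 2) => //; exact: (bigOh_mul (hN Y) (hN Z)).
have hV0 : O 0 V.
  have e (s : R) : 1%:M + (V s - 1%:M) = V s by rewrite addrC subrK.
  apply: (bigOh_ext e); apply: bigOh_add; first exact: bigOh_cst.
  exact: (@bigOh_le _ _ _ _ _ _ 0 1).
have e (s : R) : (D s - s ^+ 2 *: bracket Y Z) *m V s + (s ^+ 2 *: bracket Y Z) *m (V s - 1%:M)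
    = group_comm Y Z s - 1%:M - s ^+ 2 *: bracket Y Z.
  have -> : group_comm Y Z s - 1%:M = D s *m V s.
    rewrite /group_comm -/(V s) /D mulmxBl; congr (_ - _).
    rewrite /V mulmxA -(mulmxA (expm (s *: Z))) expmZN mulmx1.
    by rewrite expmZN.
  by rewrite mulmxBl mulmxBr mulmx1 addrA subrK.
apply: (bigOh_ext e); apply: bigOh_add; first exact: (bigOh_mul hD hV0).
exact: (bigOh_mul (@bigOh_pow 2 _) hV).
Qed.

End Commutators.

Section LinearBound.
Variable R : realType.

Lemma linear_bound a b c d (f : 'M[R]_(a, b) -> 'M[R]_(c, d)) : linear f ->
  exists2 C, 0 <= C & forall A, mxn (f A) <= C * mxn A.
Proof.
move=> lf; pose F : {linear 'M[R]_(a, b) -> 'M[R]_(c, d)} :=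
  HB.pack f (GRing.isLinear.Build _ _ _ _ f lf).
exists (\sum_i \sum_j mxn (F (delta_mx i j))).
  by apply: sumr_ge0 => i _; apply: sumr_ge0 => j _; exact: mxn_ge0.
move=> A; rewrite -[f A]/(F A) {1}[A]matrix_sum_delta linear_sum mulr_suml.
apply: le_trans (mxn_sum _ _ _) _; apply: ler_sum => i _.
rewrite linear_sum mulr_suml; apply: le_trans (mxn_sum _ _ _) _.
apply: ler_sum => j _; rewrite linearZ mxnZ mulrC ler_wpM2l ?mxn_ge0 //.
exact: mxn_entry.
Qed.

End LinearBound.

(** * The group near 1 *)

Section Tangent.
Variables (R : realType) (n : nat) (GG : alg_group n).
Local Notation M := 'M[R]_n.
Local Notation ratR := (ratr : {rmorphism rat -> R}).

Lemma diff_at1D P Q (X : M) : diff_at1 (P + Q) X = diff_at1 P X + diff_at1 Q X.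
Proof.
rewrite /diff_at1 -big_split; apply: eq_bigr => k _ /=.
by rewrite mderivD (poly_atD ratR) mulrDl.
Qed.

Lemma diff_at1M P Q (X : M) : diff_at1 (P * Q) X =
  poly_at ratr P 1%:M * diff_at1 Q X + poly_at ratr Q 1%:M * diff_at1 P X.
Proof.
rewrite /diff_at1 [X in _ = X + _]mulr_sumr [X in _ = _ + X]mulr_sumr -big_split.
apply: eq_bigr => k _ /=.
by rewrite mderivM (poly_atD ratR) !(poly_atM ratR); ring.
Qed.

Lemma diff_at1_bound P : exists2 C, 0 <= C &
  forall X : M, `|diff_at1 P X| <= C * mxn X.
Proof.
exists (\sum_k `|poly_at ratr (mderiv k P) (1%:M : M)|); first by apply: sumr_ge0.
move=> X; rewrite mulr_suml; apply: le_trans (ler_norm_sum _ _ _) _.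
apply: ler_sum => k _; rewrite normrM ler_wpM2l //.
by case/mxvec_indexP: k => i j; rewrite mxvecE mxn_entry.
Qed.

Lemma poly_at_taylor P : exists2 C, 0 <= C & forall B : M, mxn B <= 1 ->
  `|poly_at ratr P (1%:M + B) - poly_at ratr P 1%:M - diff_at1 P B| <= C * mxn B ^+ 2.
Proof.
elim/mpoly_ring_ind: P => [c|k|p q [C C0 hp] [D D0 hq]|p q [C C0 hp] [D D0 hq]].
- exists 0 => // B _; rewrite !(poly_atC ratR) subrr /diff_at1 big1 ?subrr ?normr0 ?mul0r //.
  by move=> k _; rewrite mderivC /poly_at (mmap0 _ ratR) mul0r.
- exists 0 => // B _; rewrite !(poly_atX ratR) /diff_at1 (bigD1 k) //= big1 ?addr0.
    rewrite mderivX mnm1E eqxx scale1r.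
    have -> : mnm_sub (mnm1 k) (mnm1 k) = mnm0.
      by apply/mnmP => j; rewrite mnmBE subnn mnm0E.
    rewrite mpolyX0 -mpolyC1 (poly_atC ratR).
    rewrite (rmorph1 ratR) mul1r raddfD mxE.
    by rewrite [_ + mxvec B 0 k]addrC addrK subrr normr0 mul0r.
  by move=> j jk; rewrite mderivX mnm1E eq_sym (negPf jk) scale0r /poly_at (mmap0 _ ratR) mul0r.
- exists (C + D); first exact: addr_ge0.
  move=> B B1; rewrite !(poly_atD ratR) diff_at1D mulrDl.
  apply: le_trans (lerD (hp B B1) (hq B B1)); apply: le_trans (ler_normD _ _).
  by rewrite le_eqVlt; apply/orP; left; apply/eqP; congr `|_|; ring.
- have [C' C'0 hp'] := diff_at1_bound p; have [D' D'0 hq'] := diff_at1_bound q.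
  set p0 := poly_at ratr p 1%:M in hp; set q0 := poly_at ratr q 1%:M in hq.
  exists ((C' + C) * (D' + D) + `|p0| * D + `|q0| * C).
    by rewrite !addr_ge0 ?mulr_ge0 ?addr_ge0.
  move=> B B1; rewrite !(poly_atM ratR) diff_at1M -/p0 -/q0.
  move: (poly_at ratr p (1%:M + B)) (poly_at ratr q (1%:M + B)) (hp B B1) (hq B B1) => x y {}hp {}hq.
  move: (diff_at1 p B) (diff_at1 q B) (hp' B) (hq' B) hp hq => p' q' {}hp' {}hq' hp hq.
  set b := mxn B in hp hq hp' hq' B1 *; have b0 : 0 <= b := mxn_ge0 B.
  have b2 : b ^+ 2 <= b by rewrite expr2 ler_piMl.
  have small (z z0 z' E E' : R) : 0 <= E -> `|z - z0 - z'| <= E * b ^+ 2 -> `|z'| <= E' * b ->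
      `|z - z0| <= (E' + E) * b.
    move=> E0 h h'; rewrite -[z - z0](subrK z') mulrDl addrC.
    apply: le_trans (ler_normD _ _) _; apply: lerD => //.
    by apply: le_trans h _; rewrite ler_wpM2l.
  have -> : x * y - p0 * q0 - (p0 * q' + q0 * p') =
      (x - p0) * (y - q0) + p0 * (y - q0 - q') + q0 * (x - p0 - p') by ring.
  rewrite [leRHS]mulrDl [X in _ <= X + _]mulrDl; apply: le_trans (ler_normD _ _) _; apply: lerD.
    apply: le_trans (ler_normD _ _) _; apply: lerD.
      rewrite normrM expr2 mulrACA; apply: ler_pM => //.
        exact: small hp hp'.
      exact: small hq hq'.
    by rewrite normrM -mulrA ler_wpM2l.
  by rewrite normrM -mulrA ler_wpM2l.
Qed.

(* The differentials at 1 of the equations of GG are of second order on g - 1, so g - 1 is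
   within second order of their common kernel. *)
Lemma near_lie : exists2 C, 0 <= C & forall g : points GG R,
  mxn (val g - 1%:M) <= 1 -> exists2 b, b \in lie GG R &
    mxn (val g - 1%:M - b) <= C * mxn (val g - 1%:M) ^+ 2.
Proof.
pose eqs := ag_eqs GG; pose r := size eqs.
pose L (X : M) : 'rV[R]_r := \row_j diff_at1 eqs`_j X.
have lL : linear L by move=> a X Y; apply/rowP => j; rewrite !mxE linearP.
pose Ll : {linear M -> 'rV[R]_r} := HB.pack L (GRing.isLinear.Build _ _ _ _ L lL).
pose f := linfun Ll.
have [C C0 hC] := @linear_bound R _ _ _ _ (f^-1)%VF (linearP _).
have [D D0 hD] : exists2 D, 0 <= D & forall g : points GG R,
    mxn (val g - 1%:M) <= 1 -> mxn (L (val g - 1%:M)) <= D * mxn (val g - 1%:M) ^+ 2.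
  have /choice[E hE] : forall j : 'I_r, exists C, 0 <= C /\ forall B : M, mxn B <= 1 ->
      `|poly_at ratr eqs`_j (1%:M + B) - poly_at ratr eqs`_j 1%:M - diff_at1 eqs`_j B|
      <= C * mxn B ^+ 2.
    by move=> j; have [E E0 h] := poly_at_taylor eqs`_j; exists E.
  exists (\sum_j E j); first by apply: sumr_ge0 => j _; case: (hE j).
  move=> g hg; rewrite /mxn big_ord1 mulr_suml; apply: ler_sum => j _.
  rewrite mxE; have [_ /(_ _ hg)] := hE j.
  have jS : eqs`_j \in eqs by apply: mem_nth.
  have z (h : points GG R) : poly_at ratr eqs`_j (val h) = 0.
    by case: (pointP h) => _; exact.
  by rewrite [1%:M + _]addrC subrK z (z 1%g) subrr sub0r normrN.
exists (C * D); first exact: mulr_ge0.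
move=> g hg; set B := val g - 1%:M in hg *.
(* [f^-1] is a linear right inverse of [f] on its image. Subtracting this correction lands in the
   kernel of [f], and its size is that of [L B], which is of second order. *)
exists (B - (f^-1)%VF (L B)).
  apply/lieP => P /(nthP 0)[j jr <-].
  have : f (B - (f^-1)%VF (L B)) = 0.
    have fE X : f X = L X by rewrite lfunE.
    rewrite raddfB /= limg_lfunVK; first by rewrite fE subrr.
    by rewrite -fE memv_img ?memvf.
  by rewrite lfunE /= => /rowP/(_ (Ordinal jr)); rewrite !mxE.
rewrite opprB addrC subrK; apply: le_trans (hC _) _.
by rewrite -mulrA ler_wpM2l // hD.
Qed.

End Tangent.

(** * The Lie algebra equals its derived algebra *)

Section KillingPerfect.
Variables (R : realType) (n : nat) (GG : alg_group n).
Local Notation M := 'M[R]_n.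
Local Notation g := (lie GG R).
Local Notation b := (vbasis (lie GG R)).

Lemma bracket_linearl (Y : M) : linear (fun X : M => bracket X Y).
Proof.
move=> a X X'; rewrite /bracket mulmxDl mulmxDr -scalemxAl -scalemxAr.
by rewrite scalerBr opprD addrACA.
Qed.

Lemma bracket_linearr (X : M) : linear (fun Y : M => bracket X Y).
Proof.
move=> a Y Y'; rewrite /bracket mulmxDl mulmxDr -scalemxAl -scalemxAr.
by rewrite scalerBr opprD addrACA.
Qed.

HB.instance Definition _ X := GRing.isLinear.Build R M M *:%R (@bracket n R X) (bracket_linearr X).

Lemma bracketDZl a (X X' Y : M) : bracket (a *: X + X') Y = a *: bracket X Y + bracket X' Y.
Proof. exact: (bracket_linearl Y). Qed.

Lemma jacobi (X Y Z : M) :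
  bracket (bracket X Y) Z = bracket X (bracket Y Z) - bracket Y (bracket X Z).
Proof.
rewrite /bracket !mulmxBl !mulmxBr !mulmxA.
move: (X *m Y *m Z) (Y *m X *m Z) (Z *m X *m Y) (Z *m Y *m X) (X *m Z *m Y) (Y *m Z *m X).
by move=> x1 x2 x3 x4 x5 x6; apply/matrixP => i j; rewrite !mxE; ring.
Qed.

Lemma killing_linearl (Y : M) a X X' :
  killing GG (a *: X + X') Y = a * killing GG X Y + killing GG X' Y.
Proof.
rewrite /killing /= mulr_sumr -big_split; apply: eq_bigr => i _ /=.
by rewrite bracketDZl linearP.
Qed.

Lemma killing_linearr (X : M) a Y Y' :
  killing GG X (a *: Y + Y') = a * killing GG X Y + killing GG X Y'.
Proof.
rewrite /killing /= mulr_sumr -big_split; apply: eq_bigr => i _ /=.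
by rewrite bracketDZl linearP linearP.
Qed.

(** The matrix of ad X acting on rows, so products of these matrices are in the reverse order of the
    compositions. *)
Let adm (X : M) : 'M[R]_(\dim g) := \matrix_(i, j) coord b j (bracket X b`_i).

Let b_lie (i : 'I_(\dim g)) : b`_i \in g.
Proof. by apply: vbasis_mem; rewrite mem_nth // size_tuple. Qed.

Let admE (X : M) (i : 'I_(\dim g)) : X \in g -> bracket X b`_i = \sum_j adm X i j *: b`_j.
Proof.
move=> hX; rewrite {1}(coord_vbasis (lie_bracket hX (b_lie i))).
by apply: eq_bigr => j _; rewrite mxE.
Qed.

Let killingE (X Y : M) : X \in g -> Y \in g -> killing GG X Y = \tr (adm Y *m adm X).
Proof.
move=> hX hY; rewrite /killing /= /mxtrace; apply: eq_bigr => i _.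
rewrite admE // linear_sum linear_sum mxE; apply: eq_bigr => j _.
by rewrite linearZ linearZ /= [adm X j i]mxE.
Qed.

Let adm_bracket (X Y : M) : X \in g -> Y \in g ->
  adm (bracket X Y) = adm Y *m adm X - adm X *m adm Y.
Proof.
have h (Z Z' : M) (i k : 'I_(\dim g)) : Z \in g -> Z' \in g ->
    coord b k (bracket Z (bracket Z' b`_i)) = (adm Z' *m adm Z) i k.
  move=> hZ hZ'; rewrite admE // linear_sum linear_sum mxE; apply: eq_bigr => j _.
  by rewrite linearZ linearZ /= [adm Z j k]mxE.
move=> hX hY; apply/matrixP => i k; rewrite mxE jacobi linearB /= !h //.
by rewrite [RHS]mxE [X in _ = _ + X]mxE.
Qed.

Lemma killing_invariant (X Y Z : M) : X \in g -> Y \in g -> Z \in g ->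
  killing GG X (bracket Y Z) = killing GG (bracket X Y) Z.
Proof.
move=> hX hY hZ; rewrite !killingE ?lie_bracket // !adm_bracket //.
rewrite mulmxBl mulmxBr !raddfB /= mulmxA; congr (_ - _).
by rewrite -mulmxA mxtrace_mulC mulmxA.
Qed.

Definition brackets (c : 'M[R]_(\dim g)) : M :=
  \sum_i \sum_j c i j *: bracket b`_i b`_j.

Lemma brackets_linear : linear brackets.
Proof.
move=> a c c'; rewrite /brackets scaler_sumr -big_split; apply: eq_bigr => i _.
rewrite scaler_sumr -big_split; apply: eq_bigr => j _ /=.
by rewrite !mxE scalerDl scalerA.
Qed.
HB.instance Definition _ :=
  GRing.isLinear.Build R 'M[R]_(\dim g) M *:%R brackets brackets_linear.

(** If [g, g] were smaller than g, a dimension count would give X <> 0 in g orthogonal to it for the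
    Killing form B. Invariance gives B([X, Y], Z) = B(X, [Y, Z]) = 0, hence [X, Y] = 0 for all Y in
    g by nondegeneracy. Then ad X = 0 on g, so X is in the radical of B, a contradiction. *)
Lemma lie_sub_brackets : semisimple_lie GG R -> (g <= limg (linfun brackets))%VS.
Proof.
move=> ss; set D := limg _.
have Dg : (D <= g)%VS.
  apply/subvP => _ /memv_imgP[c _ ->]; rewrite lfunE; apply: memv_suml => i _.
  by apply: memv_suml => j _; rewrite memvZ // lie_bracket.
have inD Y Z : Y \in g -> Z \in g -> bracket Y Z \in D.
  move=> hY hZ; rewrite (coord_vbasis hY) (coord_vbasis hZ).
  have -> : bracket (\sum_i coord b i Y *: b`_i) (\sum_j coord b j Z *: b`_j) =
      linfun brackets (\matrix_(i, j) (coord b i Y * coord b j Z)).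
    rewrite lfunE /= /brackets.
    pose F : {linear M -> M} := HB.pack (fun X : M => bracket X (\sum_j coord b j Z *: b`_j))
      (GRing.isLinear.Build _ _ _ _ _ (bracket_linearl _)).
    rewrite -[LHS]/(F _) linear_sum; apply: eq_bigr => i _.
    rewrite linearZ /= linear_sum scaler_sumr; apply: eq_bigr => j _.
    by rewrite linearZ /= scalerA mxE.
  by rewrite memv_img ?memvf.
have [->|gD] := eqVneq (D : {vspace M}) g; first exact: subvv.
have dimD : (\dim D < \dim g)%N.
  rewrite ltn_neqAle dimvS // andbT; apply: contraNneq gD => e.
  by rewrite eqEdim Dg e leqnn.
pose Phi (X : M) : 'rV[R]_(\dim D) := \row_j killing GG X (vbasis D)`_j.
have lPhi : linear Phi.
  by move=> a X X'; apply/rowP => j; rewrite !mxE killing_linearl.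
pose PhiL : {linear M -> 'rV[R]_(\dim D)} := HB.pack Phi (GRing.isLinear.Build _ _ _ _ Phi lPhi).
have : (g :&: lker (linfun PhiL))%VS != 0%VS.
  rewrite -dimv_eq0 -lt0n; have := limg_ker_dim (linfun PhiL) g.
  have : (\dim (linfun PhiL @: g) <= \dim D)%N.
    by apply: leq_trans (dimvS (subvf _)) _; rewrite dimvf /dim /= mul1n.
  move=> h e; rewrite -(ltn_add2r (\dim (linfun PhiL @: g))) add0n e.
  exact: leq_ltn_trans h dimD.
rewrite -vpick0; set X := vpick _ => X0.
have /memv_capP[Xg] : X \in (g :&: lker (linfun PhiL))%VS by exact: memv_pick.
rewrite memv_ker lfunE /= => /eqP PhiX.
have kD Y : Y \in D -> killing GG X Y = 0.
  move=> /coord_vbasis ->.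
  pose F : {linear M -> R^o} := HB.pack (fun Y : M => killing GG X Y : R^o)
    (GRing.isLinear.Build _ _ R^o _ (fun Y : M => killing GG X Y) (@killing_linearr X)).
  rewrite -[LHS]/(F _) linear_sum big1 // => j _; rewrite linearZ /=.
  by have /rowP/(_ j) := PhiX; rewrite !mxE => ->; rewrite scaler0.
have ad0 Y : Y \in g -> bracket X Y = 0.
  move=> hY; apply: ss; first exact: lie_bracket.
  by move=> Z hZ; rewrite -killing_invariant // kD // inD.
case/eqP: X0; apply: ss => // Y hY; rewrite /killing /= big1 // => i _.
by rewrite ad0 ?linear0 // lie_bracket.
Qed.

(** A linear right inverse of the bracket map chooses the coefficients, so their size is controlled
    by that of X. *)
Lemma lie_brackets : semisimple_lie GG R -> exists2 C, 0 <= C &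
  forall X, X \in g -> exists2 c, X = brackets c & mxn c <= C * mxn X.
Proof.
move=> ss; have [C C0 hC] := @linear_bound R _ _ _ _ ((linfun brackets)^-1)%VF (linearP _).
exists C => // X hX; exists (((linfun brackets)^-1)%VF X); last exact: hC.
rewrite -[brackets _](lfunE brackets) limg_lfunVK //.
exact: (subvP (lie_sub_brackets ss)).
Qed.

End KillingPerfect.

Section PointTopology.
Variables (R : realType) (n : nat) (GG : alg_group n).
Local Notation M := 'M[R]_n.
Local Notation G := (points GG R).

Lemma nbhs_mxn (A : M) (e : R) : 0 < e -> nbhs A [set B : M | mxn (B - A) < e].
Proof.
(* Passing from the maximum of the entries to their sum costs the number of entries. The successor
   makes the final inequality strict and the radius positive when n = 0. *)
move=> e0; apply/nbhs_ballP; exists (e / (n * n).+1%:R); first by rewrite /= divr_gt0.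
move=> B; rewrite /= => -[_ hB].
apply: (@le_lt_trans _ _ ((n * n)%:R * (e / (n * n).+1%:R))); last first.
  by rewrite mulrC -mulrA gtr_pMr // mulrC ltr_pdivrMr // mul1r ltr_nat.
apply: (@le_trans _ _ (\sum_(i < n) \sum_(j < n) (e / (n * n).+1%:R))); last first.
  by rewrite !sumr_const !card_ord -mulrnA mulr_natl.
apply: ler_sum => i _; apply: ler_sum => j _.
by apply: ltW; have := hB i j; rewrite /ball /= !mxE distrC.
Qed.

Lemma nbhs_pt (g0 : G) (e : R) : 0 < e ->
  nbhs g0 [set g : G | mxn (val g - val g0) < e].
Proof.
move=> e0; exact: (@initial_continuous _ _ (val : G -> M) g0 _ (nbhs_mxn (val g0) e0)).
Qed.

Lemma nbhs_ptP (g0 : G) (U : set G) : nbhs g0 U ->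
  exists2 e : R, 0 < e & forall g, mxn (val g - val g0) <= e -> U g.
Proof.
rewrite nbhsE => -[V [[A Aop AV] Vg0] VU].
have : nbhs (val g0) A by apply: open_nbhs_nbhs; split=> //; rewrite -AV in Vg0.
move=> /nbhs_ballP[e /= e0 eA]; exists (e / 2); first by rewrite divr_gt0.
move=> g hg; apply: VU; rewrite -AV; apply: eA.
rewrite -ball_normE /= /Num.Def.normr /= mx_normrE.
apply/bigmax_ltP; split=> // ij _.
have := mxn_entry (val g - val g0) ij.1 ij.2; rewrite !mxE distrC => h.
apply: le_lt_trans h _; apply: le_lt_trans hg _.
by rewrite ltr_pdivrMr // ltr_pMr // ltr1n.
Qed.


End PointTopology.

(** * Density of commutators *)

Section Perfect.
Variables (R : realType) (n : nat) (GG : alg_group n).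
Local Notation M := 'M[R]_n.
Local Notation G := (points GG R).
Local Notation g := (lie GG R).
Local Notation b := (vbasis (lie GG R)).
Local Notation D := (\dim (lie GG R)).

Definition pt_comm (Y Z : M) (s : R) : G :=
  (exp_pt (s *: Y) * exp_pt (s *: Z) * (exp_pt (- s *: Y) * exp_pt (- s *: Z)))%g.

Lemma mulmx_1D (A B : M) : (1%:M + A) *m (1%:M + B) = 1%:M + A + B + A *m B.
Proof. by rewrite mulmxDl mul1mx mulmxDr mulmx1 addrA [1%:M + B + A]addrAC. Qed.

Lemma val_pt_comm (Y Z : M) s : Y \in g -> Z \in g ->
  val (pt_comm Y Z s) = group_comm Y Z s.
Proof.
move=> hY hZ; have hv (t : R) (X : M) : X \in g -> val (exp_pt (t *: X) : G) = expm (t *: X).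
  by move=> hX; apply: val_exp_pt; rewrite memvZ.
apply: etrans (val_ptM _ _) _; apply: congr2.
  by apply: etrans (val_ptM _ _) _; apply: congr2; exact: hv.
by apply: etrans (val_ptM _ _) _; apply: congr2; exact: hv.
Qed.

(* A commutator in G that is 1 + c [Y, Z] to first order in c. *)
Definition scaled_comm (Y Z : M) (c : R) : G :=
  if 0 <= c then pt_comm Y Z (Num.sqrt c) else pt_comm Z Y (Num.sqrt (- c)).

Let b_lie (i : 'I_D) : b`_i \in g.
Proof. by apply: vbasis_mem; rewrite mem_nth // size_tuple. Qed.

Local Notation u := (fun c : 'M[R]_D => Num.sqrt (mxn c)).
Local Notation O k f := (bigOh u k f).

Let u_entry (c : 'M[R]_D) i j : `|c i j| <= u c ^+ 2.
Proof. by rewrite sqr_sqrtr ?mxn_ge0 // mxn_entry. Qed.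

(** Orders are counted in [u], the square root of the size of [c], because a commutator at time s is
    1 + s^2 [Y, Z] to leading order. For a negative coefficient the two elements are exchanged,
    which changes the sign of the bracket. *)
Lemma bigOh_scaled_comm (i j : 'I_D) : O 3 (fun c : 'M[R]_D =>
  val (scaled_comm b`_i b`_j (c i j)) - 1%:M - c i j *: bracket b`_i b`_j).
Proof.
have [C C0 hC] := @bigOh_group_comm R n b`_i b`_j.
have [C' C'0 hC'] := @bigOh_group_comm R n b`_j b`_i.
exists (C + C'); first exact: addr_ge0.
move=> c uc; rewrite /scaled_comm.
have sqrt_le (x : R) : x <= `|c i j| -> `|Num.sqrt x| <= u c.
  move=> h; rewrite ger0_norm ?sqrtr_ge0 // ler_sqrt ?mxn_ge0 //.
  exact: le_trans h (mxn_entry _ _ _).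
have le3 (x : R) : x <= `|c i j| -> `|Num.sqrt x| ^+ 3 <= u c ^+ 3.
  by move=> h; rewrite lerXn2r ?nnegrE ?sqrtr_ge0 // sqrt_le.
case: ifPn => [c0|]; last rewrite -ltNge => c0; rewrite val_pt_comm //.
  have h : c i j <= `|c i j| by rewrite ler_norm.
  have := hC (Num.sqrt (c i j)) (le_trans (sqrt_le _ h) uc); rewrite sqr_sqrtr //.
  move=> /le_trans; apply; by apply: ler_pM; rewrite ?exprn_ge0 ?lerDl ?le3.
have h : - c i j <= `|c i j| by rewrite -normrN ler_norm.
have := hC' (Num.sqrt (- c i j)) (le_trans (sqrt_le _ h) uc).
rewrite sqr_sqrtr; last by rewrite oppr_ge0 ltW.
have -> : - c i j *: bracket b`_j b`_i = c i j *: bracket b`_i b`_j.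
  by rewrite scaleNr -scalerN /bracket opprB.
move=> /le_trans; apply; by apply: ler_pM; rewrite ?exprn_ge0 ?lerDr ?le3.
Qed.

Definition prod_comm (s : seq ('I_D * 'I_D)) (c : 'M[R]_D) : G :=
  foldr (fun (p : 'I_D * 'I_D) x => (scaled_comm b`_p.1 b`_p.2 (c p.1 p.2) * x)%g) 1%g s.

(** Each factor is 1 plus a term of order 2, so cross terms have order 4 and the terms linear in [c]
    simply add up. *)
Lemma bigOh_prod_comm s : O 3 (fun c => val (prod_comm s c) - 1%:M -
   \sum_(p <- s) c p.1 p.2 *: bracket b`_p.1 b`_p.2).
Proof.
have u0 c : 0 <= u c by exact: sqrtr_ge0.
elim: s => [|p s IH].
  exists 0 => // c _; rewrite big_nil subr0 mul0r /prod_comm /= subrr mxn0 //.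
set sm := fun c : 'M[R]_D => \sum_(p <- s) c p.1 p.2 *: bracket b`_p.1 b`_p.2 in IH *.
pose a (c : 'M[R]_D) := c p.1 p.2 *: bracket b`_p.1 b`_p.2.
have ha : O 2 a by apply: bigOh_scale => c; exact: u_entry.
have hsm : O 2 sm.
  rewrite /sm; elim: (s) => [|q t IHt].
    by exists 0 => // c _; rewrite big_nil mxn0 mul0r.
  apply: (@bigOh_ext _ _ _ _ _ _ (fun c : 'M[R]_D => c q.1 q.2 *: bracket b`_q.1 b`_q.2 +
    \sum_(p <- t) c p.1 p.2 *: bracket b`_p.1 b`_p.2)).
    by move=> c; rewrite big_cons.
  by apply: bigOh_add => //; apply: bigOh_scale => c; exact: u_entry.
pose e (c : 'M[R]_D) := val (scaled_comm b`_p.1 b`_p.2 (c p.1 p.2)) - 1%:M - a c.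
pose f (c : 'M[R]_D) := val (prod_comm s c) - 1%:M - sm c.
have he : O 3 e by exact: bigOh_scaled_comm.
have hae : O 2 (fun c => a c + e c).
  by apply: bigOh_add => //; exact: (@bigOh_le _ _ _ u0 _ _ 2 3).
have hsf : O 2 (fun c => sm c + f c).
  by apply: bigOh_add => //; exact: (@bigOh_le _ _ _ u0 _ _ 2 3).
have E (c : 'M[R]_D) : e c + f c + (a c + e c) *m (sm c + f c) = val (prod_comm (p :: s) c) - 1%:M -
   \sum_(p <- (p :: s)) c p.1 p.2 *: bracket b`_p.1 b`_p.2.
  rewrite big_cons -/(a c) -/(sm c).
  have -> : val (prod_comm (p :: s) c) =
    val (scaled_comm b`_p.1 b`_p.2 (c p.1 p.2)) *m val (prod_comm s c) by [].
  have -> : val (scaled_comm b`_p.1 b`_p.2 (c p.1 p.2)) = 1%:M + (a c + e c).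
    by rewrite /e; move: (val _) (a c) => x y; apply/matrixP => i j; rewrite !mxE; ring.
  have -> : val (prod_comm s c) = 1%:M + (sm c + f c).
    by rewrite /f; move: (val _) (sm c) => x y; apply/matrixP => i j; rewrite !mxE; ring.
  rewrite mulmx_1D; move: ((a c + e c) *m (sm c + f c)) (a c) (e c) (sm c) (f c) => w x y z t.
  by apply/matrixP => i j; rewrite !mxE; ring.
apply: (bigOh_ext E); apply: bigOh_add; first exact: bigOh_add.
by apply: (@bigOh_le _ _ _ u0 _ _ 3 4) => //; exact: (bigOh_mul hae hsf).
Qed.

Variable S : set G.
Hypothesis (S1 : S 1%g) (SM : forall x y, S x -> S y -> S (x * y)%g)
  (SV : forall x, S x -> S x^-1%g)
  (Scomm : forall Y Z s, Y \in g -> Z \in g -> S (pt_comm Y Z s))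
  (Sclosed : forall x, (forall e : R, 0 < e ->
     exists2 q, S q & mxn (val (x * q)%g - 1%:M) <= e) -> S x).
Hypotheses (ss : semisimple_lie GG R) (conn : connected [set: G]).

(** For x = 1 + B, take b0 in the Lie algebra within O(|B|^2) of B, write - b0 as a combination of
    brackets with coefficients of size O(|B|), and let Q be the product of the corresponding
    commutators. Then Q is 1 - b0 up to O(|B|^(3/2)), so it cancels the first-order part of x, and
    the remainder is at most |B| / 2 once |B| is small. *)
Lemma halving : exists2 d : R, 0 < d & forall x : G, mxn (val x - 1%:M) <= d ->
  exists2 q, S q & mxn (val (x * q)%g - 1%:M) <= 2^-1 * mxn (val x - 1%:M).
Proof.
have [C1 C10 h1] := @near_lie R n GG.
have [C2 C20 h2] := lie_brackets ss.
have [C4 C40 h4] := bigOh_prod_comm (enum {: 'I_D * 'I_D}).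
pose C3 := C2 * (1 + C1).
have C30 : 0 <= C3 by rewrite mulr_ge0 // addr_ge0.
pose C5 := C4 * Num.sqrt C3 ^+ 3.
have C50 : 0 <= C5 by rewrite mulr_ge0 ?exprn_ge0 ?sqrtr_ge0.
(* With w the square root of |B|, the three errors B - b0, e and B (e - b0) in x Q are at most [C1],
   [C5] and [1 + C1 + C5] times w^3. *)
pose C6 := C1 + C5 + (1 + C1) + C5.
have C60 : 0 <= C6 by rewrite !addr_ge0.
(* For w <= w0 each of w, C3 w and C6 w is at most 1/2. The first two put |B| and the coefficients
   in the range of the estimates; the third makes the total error C6 w^3 at most half of |B| =
   w^2. *)
pose w0 := (2 * (1 + C3 + C6))^-1.
have w00 : 0 < w0 by rewrite invr_gt0 mulr_gt0 // ltr_pwDl // ltr_pwDl.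
exists (w0 ^+ 2); first by rewrite exprn_gt0.
move=> x; set B := val x - 1%:M; set beta := mxn B => hbeta.
have beta0 : 0 <= beta by exact: mxn_ge0.
pose w := Num.sqrt beta.
have wE : w ^+ 2 = beta by rewrite sqr_sqrtr.
have w_ge0 : 0 <= w by exact: sqrtr_ge0.
have ww0 : w <= w0.
  by rewrite -(@ler_pXn2r _ 2) ?nnegrE // ?wE // ltW.
have wk (C : R) : C <= 1 + C3 + C6 -> C * w <= 2^-1.
  move=> hC; apply: (@le_trans _ _ ((1 + C3 + C6) * w0)).
    apply: (@le_trans _ _ ((1 + C3 + C6) * w)); first by rewrite ler_wpM2r.
    by rewrite ler_wpM2l // !addr_ge0.
  rewrite /w0 invfM mulrCA mulfV ?mulr1 //.
  by rewrite gt_eqF // ltr_pwDl // ltr_pwDl.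
have w1 : w <= 2^-1.
  by rewrite -[w]mul1r wk // -addrA lerDl addr_ge0.
have w3 : C3 * w <= 2^-1 by rewrite wk // addrAC lerDr addr_ge0.
have w6 : C6 * w <= 2^-1 by rewrite wk // lerDr addr_ge0.
have half1 : 2^-1 <= 1 :> R by rewrite invf_le1 ?ler1n.
have wle1 : w <= 1 by exact: le_trans w1 half1.
have beta1 : beta <= 1 by rewrite -wE exprn_ile1.
have [b0 hb0 hb] := h1 x beta1; rewrite -/B -/beta in hb.
have nb0 : mxn b0 <= (1 + C1) * w ^+ 2.
  rewrite wE -[b0](subKr B); apply: le_trans (mxnB _ _) _.
  rewrite mulrDl mul1r lerD2l; apply: le_trans hb _.
  by rewrite ler_wpM2l // expr2 ler_piMl.
have nb0g : - b0 \in g by rewrite memvN.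
have [c hc nc] := h2 _ nb0g.
have {}nc : mxn c <= C3 * w ^+ 2.
  by apply: le_trans nc _; rewrite mxnN /C3 -mulrA ler_wpM2l.
have uc : u c <= Num.sqrt C3 * w.
  rewrite -[w in X in _ <= X]ger0_norm // -sqrtr_sqr -sqrtrM // ler_sqrt //.
  by rewrite mulr_ge0 ?exprn_ge0.
have uc1 : u c <= 1.
  rewrite -sqrtr1 ler_sqrt //; apply: le_trans nc _.
  rewrite expr2 mulrA; apply: mulr_ile1 => //; first by rewrite mulr_ge0.
  exact: le_trans w3 half1.
set Q := prod_comm (enum {: 'I_D * 'I_D}) c.
exists Q.
  by rewrite /Q /prod_comm; elim: (enum _) => [//|p s IH] /=; apply: SM => //;
     rewrite /scaled_comm; case: ifP => _; exact: Scomm.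
pose e := val Q - 1%:M + b0.
have ne : mxn e <= C5 * w ^+ 3.
  have := h4 c uc1; rewrite -/Q.
  have -> : \sum_(p <- enum {: 'I_D * 'I_D}) c p.1 p.2 *: bracket b`_p.1 b`_p.2 = - b0.
    by rewrite hc /brackets pair_bigA /= big_enum.
  rewrite opprK -/e => /le_trans; apply; rewrite /C5 -mulrA -exprMn ler_wpM2l //.
  by rewrite lerXn2r // nnegrE ?sqrtr_ge0 // mulr_ge0 ?sqrtr_ge0.
have -> : val (x * Q)%g - 1%:M = (B - b0) + e + B *m (e - b0).
  rewrite val_ptM.
  have -> : val x = 1%:M + B by rewrite /B addrC subrK.
  have -> : val Q = 1%:M + (e - b0) by rewrite /e addrK addrC subrK.
  rewrite mulmx_1D; move: (B *m (e - b0)) => y; clear ne; move: e => z.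
  by apply/matrixP => i j; rewrite !mxE; ring.
apply: (@le_trans _ _ (C6 * w * w ^+ 2)); last by rewrite wE ler_wpM2r.
have wp k l : (k <= l)%N -> w ^+ l <= w ^+ k by move=> kl; rewrite ler_wiXn2l.
have -> : C6 * w * w ^+ 2 = C1 * w ^+ 3 + C5 * w ^+ 3 + (1 + C1 + C5) * w ^+ 3.
  by rewrite /C6; ring.
apply: le_trans (mxnD _ _) _; apply: lerD.
  apply: le_trans (mxnD _ _) _; apply: lerD => //.
  apply: le_trans hb _; rewrite -wE -exprM ler_wpM2l //; exact: wp.
apply: le_trans (mxnM _ _) _; rewrite -/beta -wE.
apply: (@le_trans _ _ (w ^+ 2 * ((1 + C1 + C5) * w ^+ 2))).
  rewrite ler_wpM2l ?exprn_ge0 //; apply: le_trans (mxnB _ _) _.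
  rewrite addrC [X in _ <= X]mulrDl; apply: lerD => //.
  by apply: le_trans ne _; rewrite ler_wpM2l // wp.
by rewrite mulrCA -exprD ler_wpM2l ?wp // !addr_ge0.
Qed.

(** Iterating [halving] gives elements q of S for which x q tends to 1 geometrically, which is the
    condition that [Sclosed] asks of x. *)
Lemma near1_in_S : exists2 d : R, 0 < d &
  forall x : G, mxn (val x - 1%:M) <= d -> S x.
Proof.
have [d d0 hd] := halving; exists d => // x hx; apply: Sclosed => e e0.
have iter k : exists2 q, S q & mxn (val (x * q)%g - 1%:M) <= 2^-1 ^+ k * d.
  elim: k => [|k [q Sq hq]]; first by exists 1%g => //; rewrite mulg1 expr0 mul1r.
  have [|q' Sq' hq'] := hd (x * q)%g.
    apply: le_trans hq _; apply: ler_piMl; first exact: ltW.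
    by apply: exprn_ile1; rewrite ?invr_ge0 // invf_le1 ?ler1n.
  exists (q * q')%g; first exact: SM.
  rewrite mulgA; apply: le_trans hq' _; rewrite exprS -mulrA.
  by rewrite ler_wpM2l ?invr_ge0.
have [k hk] : exists k, 2^-1 ^+ k * d <= e.
  have c0 : (fun k => 2^-1 ^+ k * d) @ \oo --> (0 : R).
    rewrite -(mul0r d); apply: cvgMl; apply: cvg_expr.
    by rewrite ger0_norm ?invr_ge0 // invf_lt1 ?ltr1n.
  move/cvgr_le: c0 => /(_ _ e0)[k _ hk]; exists k; exact: hk (leqnn k).
by have [q Sq hq] := iter k; exists q => //; exact: le_trans hq hk.
Qed.

(** S contains a neighbourhood of 1, so its cosets are open; hence S is open, closed and nonempty in
    a connected group. *)
Lemma topologically_perfect x : S x.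
Proof.
have [d d0 hd] := near1_in_S.
have near (y : G) : exists2 U : set G, nbhs y U & forall z, U z -> S (y^-1 * z)%g.
  pose C := mxn (val (y^-1)%g).
  have C0 : 0 <= C by exact: mxn_ge0.
  (* Left translation by y^-1 expands distances by at most [C]; the summand 1 keeps the radius
     positive even if [C] is 0. *)
  exists [set z : G | mxn (val z - val y) < d / (C + 1)].
    by apply: nbhs_pt; rewrite divr_gt0 // ltr_wpDl.
  move=> z /= hz; apply: hd.
  have -> : val (y^-1 * z)%g - 1%:M = val (y^-1)%g *m (val z - val y).
    by rewrite mulmxBr -!val_ptM mulVg.
  apply: le_trans (mxnM _ _) _; rewrite -/C.
  apply: (@le_trans _ _ (C * (d / (C + 1)))); first by rewrite ler_wpM2l // ltW.
  rewrite mulrCA; apply: ler_piMr; first exact: ltW.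
  by rewrite ler_pdivrMr ?ltr_wpDl // mul1r lerDl.
have op : open S.
  rewrite openE => y Sy; have [U hU h] := near y.
  by apply: filterS hU => z /h Sz; rewrite -[z](mulVKg y); exact: SM.
have cl : closed S.
  rewrite -openC openE => y nSy; have [U hU h] := near y.
  apply: filterS hU => z /h Sz Sz'; apply: nSy.
  have -> : y = (z * (y^-1 * z)^-1)%g by rewrite invgM invgK mulVKg.
  by apply: SM => //; exact: SV.
suff -> : S = setT by [].
apply: conn; first by exists 1%g.
  by exists S => //; rewrite setTI.
by exists S => //; rewrite setTI.
Qed.

End Perfect.

(** * Moderate growth *)

Section Spectral.
Variable R : realType.
Local Notation C := R[i].

(** The bound 1 / (1 + sum of the 1 / f i) also covers an empty index type, where there is no
    minimum. *)
Lemma uniform_lower_bound (I : finType) (f : I -> R) : (forall i, 0 < f i) ->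
  exists2 m, 0 < m & forall i, m <= f i.
Proof.
move=> f0; pose s := 1 + \sum_i (f i)^-1.
have s0 : 0 < s.
  by rewrite ltr_wpDr // sumr_ge0 // => i _; rewrite invr_ge0 ltW.
exists s^-1; first by rewrite invr_gt0.
move=> i; rewrite -[f i]invrK lef_pV2 ?posrE ?invr_gt0 //.
rewrite /s (bigD1 i) //= addrCA lerDl addr_ge0 // sumr_ge0 // => j _.
by rewrite invr_ge0 ltW.
Qed.

(** If all entries were at most e = 1 / (2 d!), the d! terms of the Leibniz formula would give |det
    B| <= d! e^d <= d! e = 1/2. The second inequality uses d > 0 and e <= 1. *)
Lemma big_entry d (B : 'M[C]_d) : (0 < d)%N -> `|\det B| = 1 ->
  exists i j, (2 * d`!%:R)^-1 < `|B i j|.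
Proof.
move=> d0 detB; pose e : C := (2 * d`!%:R)^-1.
have f0 : 0 < d`!%:R :> C by rewrite ltr0n fact_gt0.
have e0 : 0 <= e by rewrite invr_ge0 mulr_ge0 // ltW.
have e1 : e <= 1.
  rewrite invf_le1 ?mulr_gt0 // -natrM ler1n muln_gt0 /= fact_gt0 //.
have [[i [j h]]|no] := pselect (exists i j, e < `|B i j|); first by exists i, j.
have le i j : `|B i j| <= e.
  rewrite real_leNgt ?normr_real ?ger0_real //.
  by apply/negP => h; apply: no; exists i, j.
have : `|\det B| <= 2^-1.
  apply: (@le_trans _ _ (\sum_(s : 'S_d) e)).
    apply: le_trans (ler_norm_sum _ _ _) _; apply: ler_sum => s _.
    rewrite normrM normrX normrN1 expr1n mul1r normr_prod.
    apply: (@le_trans _ _ (\prod_(i < d) e)).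
      by apply: ler_prod => i _; rewrite normr_ge0 le.
    rewrite prodr_const card_ord -[d in _ ^+ d](prednK d0) exprS.
    by rewrite ler_piMr // exprn_ile1.
  rewrite sumr_const -[#|_|]/(#|'S_d|) card_Sn -[_ *+ _]mulr_natr.
  suff -> : e * d`!%:R = 2^-1 by [].
  by rewrite /e invfM -mulrA mulVf ?mulr1 // gt_eqF.
by rewrite detB invf_ge1 // lern1.
Qed.


Local Notation "A ^H" := (map_mx conjc A^T) (at level 2, format "A ^H").

Lemma lec_norm (a : R) (z : C) : (a%:C)%C <= `|z| -> a <= Normc.normc z.
Proof. by rewrite -lecR. Qed.

Lemma trace_conj (F : comNzRingType) d (P Q D D' A A' : 'M[F]_d) :
  \tr ((Q *m D' *m P) *m A' *m (Q *m D *m P) *m A) =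
  \tr (D' *m (P *m A' *m Q) *m (D *m (P *m A *m Q))).
Proof. by rewrite -!mulmxA mxtrace_mulC !mulmxA. Qed.

Lemma mul_conj_diag (F : comNzRingType) d (P Q D D' : 'M[F]_d) :
  P *m Q = 1%:M -> Q *m P = 1%:M -> D *m D' = 1%:M ->
  (Q *m D *m P) *m (Q *m D' *m P) = 1%:M.
Proof.
move=> PQ QP DD; rewrite !mulmxA -(mulmxA _ P) PQ mulmx1.
by rewrite -(mulmxA _ D) DD mulmx1.
Qed.

(* Diagonalising H = P^* D P with P unitary turns the squared norm of A into the
   sum of the d_j / d_i |B_ji|^2, where B = P A P^*. *)
Lemma trace_adjoint_lower_bound d (H : 'M[C]_d) : (0 < d)%N -> H^H = H ->
  (forall v : 'cV[C]_d, v != 0 -> 0 < (v^H *m H *m v) 0 0) ->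
  exists2 c : R, 0 < c & forall A : 'M[C]_d, `|\det A| = 1 ->
    c <= Normc.normc (\tr (adjoint H A *m A)).
Proof.
move=> d0 hermH posH; pose P := spectralmx H; pose D := spectral_diag H.
have herm : H \is hermsymmx.
  by apply/is_hermitianmxP; rewrite expr0 scale1r -[LHS]hermH.
have HE : H = invmx P *m diag_mx D *m P.
  exact: (orthomx_spectralP (hermitian_normalmx herm)).
have PU : P \is unitarymx by exact: spectral_unitarymx.
have Pu : P \in unitmx by exact: unitarymx_unit.
have PV : invmx P = P^H by rewrite invmx_unitary.
have PP : P *m P^H = 1%:M by rewrite -PV mulmxV.
have HC a b c (X : 'M[C]_(a, b)) (Y : 'M[C]_(b, c)) : (X *m Y)^H = Y^H *m X^H.
  by rewrite trmx_mul map_mxM.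
have HK a b (X : 'M[C]_(a, b)) : X^H^H = X.
  by apply/matrixP => i j; rewrite !mxE conjcK.
have D0 i : 0 < D 0 i.
  pose v : 'cV[C]_d := P^H *m delta_mx i 0.
  have v0 : v != 0.
    apply/eqP => /(congr1 (mulmx P)); rewrite /v mulmxA PP mul1mx mulmx0.
    by move=> /matrixP/(_ i 0); rewrite !mxE !eqxx => /eqP; rewrite oner_eq0.
  have := posH v v0; rewrite /v HC HK {1}HE PV.
  rewrite !mulmxA -(mulmxA _ P) PP mulmx1 -(mulmxA _ P) PP mulmx1.
  have -> : (delta_mx i 0 : 'cV[C]_d)^H = delta_mx 0 i.
    by apply/matrixP => k l; rewrite !mxE andbC; case: (_ && _); rewrite /= ?oppr0.
  by rewrite -rowE -colE !mxE eqxx mulr1n.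
have posRe (z : C) : 0 < z -> z = (complex.Re z)%:C%C /\ 0 < complex.Re z.
  by case: z => x y; rewrite ltcE /= => /andP[/eqP -> x0].
have Dq k l : 0 < D 0 l / D 0 k by rewrite divr_gt0.
have [m m0 hm] := @uniform_lower_bound ('I_d * 'I_d)%type
  (fun kl => complex.Re (D 0 kl.2 / D 0 kl.1)) (fun kl => (posRe _ (Dq kl.1 kl.2)).2).
pose e : R := (2 * d`!%:R)^-1.
have e0 : 0 < e by rewrite invr_gt0 mulr_gt0 // ltr0n fact_gt0.
(* One term of the sum is enough: the quotient of eigenvalues is at least [m], the entry of B found
   by [big_entry] is at least [e] in modulus, and all other terms are nonnegative. *)
exists (m * e ^+ 2); first by rewrite mulr_gt0 // exprn_gt0.
move=> A detA; pose B := P *m A *m invmx P.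
have [|i [j Bij]] := @big_entry d B d0.
  by rewrite !det_mulmx mulrAC -det_mulmx mulmxV // det1 mul1r.
have HV : invmx H = P^H *m diag_mx (map_mx GRing.inv D) *m P.
  set X := P^H *m _ *m P.
  have DD : diag_mx D *m diag_mx (map_mx GRing.inv D) = 1%:M.
    apply/matrixP => k l; rewrite mul_diag_mx !mxE.
    by case: eqP => [->|_]; rewrite ?mulr0n ?mulr0 // !mulr1n mulfV // gt_eqF.
  have HX : H *m X = 1%:M.
    rewrite HE PV /X; apply: mul_conj_diag => //.
    by rewrite -PV mulVmx.
  have [Hu _] := mulmx1_unit HX.
  exact: (etrans (esym (mulmx1 _)) (etrans (congr1 (mulmx (invmx H)) (esym HX)) (mulKmx Hu X))).
have trE : \tr (adjoint H A *m A) = \sum_k \sum_l (D 0 l / D 0 k) * `|B l k| ^+ 2.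
  have BH : B^H = P *m A^H *m P^H by rewrite /B PV !HC HK mulmxA.
  have -> : \tr (adjoint H A *m A) =
      \tr (diag_mx (map_mx GRing.inv D) *m B^H *m (diag_mx D *m B)).
    set Di := diag_mx (map_mx _ _); set Dm := diag_mx D; rewrite BH /B PV.
    rewrite -trace_conj /adjoint HV; congr (\tr (_ *m _ *m _ *m _)).
    by rewrite -PV; exact: HE.
  clearbody B; apply: eq_bigr => k _; rewrite mxE; apply: eq_bigr => l _.
  rewrite mul_diag_mx mul_diag_mx !mxE normCK.
  rewrite -[Num.conj (B l k)]/(conjc (B l k)); ring.
have term k l : 0 <= (D 0 l / D 0 k) * `|B l k| ^+ 2.
  by rewrite mulr_ge0 ?exprn_ge0 // ltW.
have tr_ge : ((m * e ^+ 2)%:C)%C <= \tr (adjoint H A *m A).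
  rewrite trE (bigD1 j) //= (bigD1 i) //= -addrA.
  apply: ler_wpDr; first by apply: addr_ge0; apply: sumr_ge0 => // k _; apply: sumr_ge0.
  rewrite rmorphM rmorphXn; apply: ler_pM.
  - by rewrite lecR ltW.
  - by rewrite exprn_ge0 // lecR ltW.
  - by rewrite (posRe _ (Dq j i)).1 lecR; exact: hm (j, i).
  - have eC : (e%:C)%C = (2 * d`!%:R)^-1 :> C.
      by rewrite /e (fmorphV (real_complex R)) rmorphM !rmorph_nat.
    have le_e : (e%:C)%C <= `|B i j| by rewrite eC ltW.
    have e_ge0 : 0 <= (e%:C)%C by rewrite lecR ltW.
    by apply: lerXn2r; [exact: e_ge0|exact: normr_ge0|exact: le_e].
apply: lec_norm; by apply: le_trans tr_ge _; rewrite ger0_norm // trE; do 2!apply: sumr_ge0 => ? _.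
Qed.

End Spectral.


Lemma pt_commE (R : realType) n (GG : alg_group n) (Y Z : 'M[R]_n) s :
  Y \in lie GG R -> Z \in lie GG R ->
  pt_comm GG Y Z s = (exp_pt (s *: Y) * exp_pt (s *: Z) *
    ((exp_pt (s *: Y))^-1 * (exp_pt (s *: Z))^-1))%g.
Proof.
move=> hY hZ; rewrite /pt_comm; apply: congr2 => //.
by apply: congr2; apply: esym; exact: exp_ptV.
Qed.

Section ModerateGrowth.
Variables (R : realType) (n : nat) (GG : alg_group n).
Local Notation C := R[i].
Local Notation G := (points GG R).
Hypothesis G_ss : connected_semisimple_real GG R.
Variables (K : set G) (d : nat) (sigma : G -> 'M[C]_d) (H : 'M[C]_d).
Hypothesis sigmaP : norm_data K sigma H.

Lemma det_continuous : continuous (fun x : G => \det (sigma x) : C^o).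
Proof.
case: sigmaP => -[_ _ cs] _ _ _ _.
have c i j : continuous (fun x : G => sigma x i j : C^o).
  move=> x; apply: (@continuous_comp _ _ _ (sigma : G -> 'M[C^o]_d) (fun A => A i j)).
    exact: cs.
  exact: coord_continuous.
rewrite /determinant; apply: (continuous_big add_continuous) => s _.
have cp : continuous (fun x : G => \prod_(i < d) sigma x i (s i) : C^o).
  by apply: (continuous_big mul_continuous) => i _; exact: c.
move=> x; apply: (@continuous_comp _ _ _ (fun x : G => \prod_(i < d) sigma x i (s i) : C^o)
  (fun y : C^o => (-1) ^+ s * y)); first exact: cp.
exact: mulrl_continuous.
Qed.

(** The kernel of a homomorphism to a commutative group contains all commutators. If x q tends to 1
    with q in the kernel, then det sigma(x) = det sigma(x q) tends to 1 by continuity, so x is in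
    the kernel. *)
Lemma det_sigma (x : G) : \det (sigma x) = 1.
Proof.
case: (sigmaP) => -[s1 sM cs] _ _ _ _; case: (G_ss) => conn ss _.
pose S : set G := [set x | \det (sigma x) = 1].
have detM y z : \det (sigma (y * z)%g) = \det (sigma y) * \det (sigma z).
  by rewrite sM det_mulmx.
have S1 : S 1%g by rewrite /S /= s1 det1.
have detV y : \det (sigma y) * \det (sigma y^-1%g) = 1.
  by rewrite -detM mulgV s1 det1.
apply: (@topologically_perfect R n GG S) => //.
- by move=> y z Sy Sz; rewrite /S /= detM Sy Sz mulr1.
- by move=> y Sy; rewrite /S /=; have := detV y; rewrite Sy mul1r.
- move=> Y Z s hY hZ; rewrite (pt_commE s hY hZ).
  move: (exp_pt _) (exp_pt _) => a b; rewrite /S /= !detM.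
  by rewrite mulrACA !detV mulr1.
- move=> y hy; apply/eqP; rewrite -subr_eq0 -normr_le0.
  rewrite real_leNgt ?normr_real ?real0 //; apply/negP => pos.
  have cvg1 : (fun x : G => \det (sigma x) : C^o) @ nbhs (1%g : G) --> (1 : C^o).
    by rewrite -[X in _ --> X](det1 _ d) -s1; exact: det_continuous.
  move/cvgrPdist_lt: cvg1 => /(_ _ pos) /nbhs_ptP[e e0 he].
  have [q Sq hq] := hy e e0.
  have : `|1 - \det (sigma (y * q)%g)| < `|\det (sigma y) - 1| by exact: (he _ hq).
  by rewrite detM Sq mulr1 distrC ltxx.
Qed.

Lemma gnorm_ge0 x : 0 <= Defs.gnorm sigma H x. Proof. exact: sqrtr_ge0. Qed.

Lemma gnorm_lower_bound : (0 < d)%N ->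
  exists2 c : R, 0 < c & forall x, c <= Defs.gnorm sigma H x.
Proof.
move=> d0; case: (sigmaP) => _ _ _ [hH posH] _.
have [c c0 hc] := trace_adjoint_lower_bound d0 hH posH.
exists (Num.sqrt c); first by rewrite sqrtr_gt0.
move=> x; rewrite /Defs.gnorm ler_sqrt; first by apply: hc; rewrite det_sigma normr1.
by apply: le_trans (hc (sigma x) _); rewrite ?ltW // det_sigma normr1.
Qed.

(** Raises an exponent, so that two growth bounds can be given a common one. *)
Lemma gnorm_pow m k : (0 < m)%N -> exists2 c : R, 0 <= c &
  forall x, Defs.gnorm sigma H x ^+ m <= c * Defs.gnorm sigma H x ^+ (m + k).
Proof.
(* If d = 0 the norm vanishes identically and has no positive lower bound; its power is then 0
   because m > 0. *)
move=> m0; have [d0|] := posnP d.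
  exists 0 => // x; rewrite mul0r /Defs.gnorm.
  have -> : \tr (adjoint H (sigma x) *m sigma x) = 0.
    rewrite /mxtrace big1 // => i _.
    by have := ltn_ord i; rewrite [X in (_ < X)%N]d0 ltn0.
  by rewrite Normc.normc0 sqrtr0 expr0n (gtn_eqF m0).
move=> /gnorm_lower_bound[c c0 hc]; exists ((c ^+ k)^-1).
  by rewrite invr_ge0 exprn_ge0 // ltW.
move=> x; rewrite exprD mulrCA ler_peMr ?exprn_ge0 ?gnorm_ge0 //.
rewrite mulrC ler_pdivlMr ?exprn_gt0 // mul1r lerXn2r // nnegrE ?gnorm_ge0 //.
exact: ltW.
Qed.

Lemma normcM (x y : C) : Normc.normc (x * y) = Normc.normc x * Normc.normc y.
Proof. by apply: complexI; rewrite rmorphM; exact: normrM. Qed.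

Lemma normcD (x y : C) : Normc.normc (x + y) <= Normc.normc x + Normc.normc y.
Proof. by rewrite -lecR rmorphD; exact: (ler_normD x y). Qed.

Lemma normc_ge0 (x : C) : 0 <= Normc.normc x.
Proof. by rewrite -lecR; exact: (normr_ge0 x). Qed.

Lemma moderate_growth_lin (a : C) f g : moderate_growth sigma H f ->
  moderate_growth sigma H g -> moderate_growth sigma H (a *: f + g).
Proof.
move=> [m [m0 [c hf]]] [k [k0 [c' hg]]].
have [u u0 hu] := gnorm_pow k m0; have [v v0 hv] := gnorm_pow m k0.
exists (m + k)%N; split; first by rewrite addn_gt0 m0.
(* Both bounds are raised to the exponent m + k. Absolute values are taken because the constants
   come without a sign. *)
exists (Normc.normc a * `|c| * u + `|c'| * v) => x.
apply: le_trans (normcD _ _) _; rewrite mulrDl; apply: lerD.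
  rewrite -[_ x]/(a * f x) normcM -!mulrA ler_wpM2l ?normc_ge0 //.
  apply: le_trans (hf x) _; apply: (@le_trans _ _ (`|c| * Defs.gnorm sigma H x ^+ m)).
    by rewrite ler_wpM2r ?exprn_ge0 ?gnorm_ge0 // ler_norm.
  by rewrite ler_wpM2l.
apply: le_trans (hg x) _; apply: (@le_trans _ _ (`|c'| * Defs.gnorm sigma H x ^+ k)).
  by rewrite ler_wpM2r ?exprn_ge0 ?gnorm_ge0 // ler_norm.
by rewrite -mulrA ler_wpM2l // addnC.
Qed.

Lemma moderate_growthM f g : moderate_growth sigma H f ->
  moderate_growth sigma H g -> moderate_growth sigma H (fun x => f x * g x).
Proof.
move=> [m [m0 [c hf]]] [k [k0 [c' hg]]].
exists (m + k)%N; split; first by rewrite addn_gt0 m0.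
exists (c * c') => x; rewrite normcM exprD mulrACA.
by apply: ler_pM; rewrite ?normc_ge0.
Qed.

Lemma moderate_growth0 : moderate_growth sigma H 0.
Proof.
exists 1%N; split=> //; exists 0 => x.
by rewrite mul0r -[(_ : G -> C) x]/(0 : C) Normc.normc0.
Qed.

End ModerateGrowth.

(** * Smooth functions and derivations *)

Section NearDiff.
Variables (R : realType) (V W : normedModType R).

Lemma near_eq_diff (f g : V -> W) x : (\near x, f x = g x) ->
  differentiable f x -> differentiable g x /\ ('d g x : V -> W) = 'd f x.
Proof.
move=> fg df; have [cf /eqaddoP hf] := (diff_locallyP _ _).1 df.
have fgx : f x = g x by exact: nbhs_singleton fg.
have fg0 : \forall h \near (0 : V), f (h + x) = g (h + x).
  have : {for 0, continuous (fun h : V => h + x)}.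
    by apply: continuousD; [exact: id|exact: cst_continuous].
  by move=> /(_ [set z | f z = g z]); rewrite add0r; exact.
have hg e : 0 < e ->
    \forall h \near (0 : V), `|(g \o shift x - (cst (g x) + 'd f x)) h| <= e * `|h|.
  move=> e0; have := hf e e0; apply: filterS2 fg0 => h /= fgh.
  by rewrite !fctE /= /shift /= fgh -fgx.
have dg : 'd g x = 'd f x :> (V -> W).
  by apply: diff_unique => //; apply/eqaddoP; exact: hg.
split; last exact: dg.
apply/diff_locallyP; split; first by rewrite dg.
by apply/eqaddoP; rewrite dg; exact: hg.
Qed.

End NearDiff.

Section SmoothMaps.
Variables (R : realType) (n : nat).
Local Notation M := 'M[R]_n.
Implicit Types (U : set M) (F G : M -> R).

Lemma Ck_ext k U F G : open U -> (forall x, U x -> F x = G x) ->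
  Ck k U F -> Ck k U G.
Proof.
move=> oU; have nU x : U x -> \near x, U x by move=> Ux; exact: open_nbhs_nbhs.
elim: k F G => [|k IH] F G FG /=.
  move=> cF x Ux; have h : G @ nbhs x --> F x.
    apply: cvg_trans (cF x Ux); apply: near_eq_cvg.
    by apply: filterS (nU x Ux) => y /FG.
  by rewrite (FG x Ux) in h.
move=> [dF hF].
have E x : U x -> differentiable G x /\ ('d G x : M -> R) = 'd F x.
  move=> Ux; apply: near_eq_diff (dF x Ux).
  by apply: filterS (nU x Ux) => y /FG.
split=> [x Ux|v]; first exact: (E x Ux).1.
apply: (IH (fun x => 'd F x v)) (hF v) => x Ux.
exact: (esym (congr1 (@^~ v) (E x Ux).2)).
Qed.

Lemma Ck_restrict k U U' F : U' `<=` U -> Ck k U F -> Ck k U' F.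
Proof.
move=> UU'; elim: k F => [|k IH] F /=; first by move=> h x /UU'; exact: h.
by move=> [dF hF]; split=> [x /UU'|v]; [exact: dF|exact: IH].
Qed.

Lemma smooth_restrict U U' F : U' `<=` U -> smooth_on U F -> smooth_on U' F.
Proof. by move=> UU' h k; exact: Ck_restrict (h k). Qed.

Lemma smooth_diff U F : smooth_on U F -> forall v, smooth_on U (fun x => 'd F x v).
Proof. by move=> h v k; exact: (h k.+1).2 v. Qed.

Lemma smooth_differentiable U F x : smooth_on U F -> U x -> differentiable F x.
Proof. by move=> h Ux; exact: (h 1%N).1 x Ux. Qed.

Lemma smooth_cst U (c : R) : smooth_on U (fun=> c).
Proof.
move=> k; elim: k c => [|k IH] c /=; first by move=> x _; exact: cst_continuous.
split=> [x _|v]; first exact: differentiable_cst.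
have -> : (fun x : M => 'd (fun=> c) x v) = fun=> 0.
  by apply/funext => x; rewrite (diff_cst c x).
exact: IH.
Qed.

Lemma Ck_lin k U (a b : R) F G : open U -> Ck k U F -> Ck k U G ->
  Ck k U (fun x => a * F x + b * G x).
Proof.
move=> oU; elim: k F G => [|k IH] F G /=.
  move=> hF hG x Ux; apply: continuousD; apply: continuousM.
  - exact: cst_continuous.
  - exact: hF.
  - exact: cst_continuous.
  - exact: hG.
move=> [dF hF] [dG hG].
have dFG x : U x -> is_diff x (a *: F + b *: G) (a *: ('d F x : M -> R) + b *: ('d G x : M -> R)).
  move=> Ux; have := differentiableP (dF x Ux); have := differentiableP (dG x Ux).
  by move=> ? ?; exact: is_diffD.
split=> [x Ux|v]; first by have [] := dFG x Ux.
apply: (@Ck_ext k U (fun x => a * 'd F x v + b * 'd G x v)) => //.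
  move=> x Ux; case: (dFG x Ux) => _ e.
  exact: (esym (congr1 (fun h : M -> R => h v) e)).
exact: (IH _ _ (hF v) (hG v)).
Qed.

Lemma smooth_lin U (a b : R) F G : open U -> smooth_on U F -> smooth_on U G ->
  smooth_on U (fun x => a * F x + b * G x).
Proof. by move=> oU hF hG k; apply: Ck_lin. Qed.

(** The factors stay smooth throughout the induction on the order of the product, since the Leibniz
    rule asks a factor and the differential of the other for the same order. *)
Lemma smooth_mul U F G : open U -> smooth_on U F -> smooth_on U G ->
  smooth_on U (fun x => F x * G x).
Proof.
move=> oU + + k; elim: k F G => [|k IH] F G hF hG /=.
  by move=> x Ux; apply: continuousM; [exact: (hF 0%N)|exact: (hG 0%N)].
have dFG x : U x -> is_diff x (F * G) (F x *: ('d G x : M -> R) + G x *: ('d F x : M -> R)).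
  move=> Ux; have := differentiableP (smooth_differentiable hF Ux).
  have := differentiableP (smooth_differentiable hG Ux).
  by move=> ? ?; exact: is_diffM.
split=> [x Ux|v]; first by have [] := dFG x Ux.
apply: (@Ck_ext k U (fun x => 1 * (F x * 'd G x v) + 1 * ('d F x v * G x))) => //.
  move=> x Ux; rewrite !mul1r [_ * G x]mulrC; case: (dFG x Ux) => _ e.
  exact: (esym (congr1 (fun h : M -> R => h v) e)).
by apply: Ck_lin => //; apply: IH => //; exact: smooth_diff.
Qed.

End SmoothMaps.

Section ComplexCurves.
Variable R : realType.
Local Notation C := R[i].
Implicit Types (h k : R -> C) (t : R).

Definition is_derivC h t (l : C) : Prop :=
  is_derive t 1 (fun s => complex.Re (h s)) (complex.Re l) /\
  is_derive t 1 (fun s => complex.Im (h s)) (complex.Im l).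

Lemma derivC_val h t l : is_derivC h t l -> Defs.derivC h t = l.
Proof.
by move=> [[_ e1] [_ e2]]; rewrite /Defs.derivC !derive1E e1 e2; case: l {e1 e2}.
Qed.

Lemma is_derivC_cst (c : C) t : is_derivC (fun=> c) t 0.
Proof. by split; exact: is_derive_cst. Qed.

Lemma cReM (a b : C) : complex.Re (a * b) =
  complex.Re a * complex.Re b - complex.Im a * complex.Im b.
Proof. by case: a; case: b. Qed.

Lemma cImM (a b : C) : complex.Im (a * b) =
  complex.Re a * complex.Im b + complex.Im a * complex.Re b.
Proof. by case: a => a a'; case: b => b b' /=. Qed.

Lemma cReD (a b : C) : complex.Re (a + b) = complex.Re a + complex.Re b.
Proof. by case: a; case: b. Qed.

Lemma cImD (a b : C) : complex.Im (a + b) = complex.Im a + complex.Im b.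
Proof. by case: a; case: b. Qed.

Lemma is_derivCD h k t l m : is_derivC h t l -> is_derivC k t m ->
  is_derivC (fun s => h s + k s) t (l + m).
Proof.
move=> [h1 h2] [k1 k2]; split.
  rewrite cReD; have -> : (fun s => complex.Re (h s + k s)) =
    (fun s => complex.Re (h s)) + (fun s => complex.Re (k s)) by apply/funext => s; rewrite cReD.
  exact: is_deriveD.
rewrite cImD; have -> : (fun s => complex.Im (h s + k s)) =
  (fun s => complex.Im (h s)) + (fun s => complex.Im (k s)) by apply/funext => s; rewrite cImD.
exact: is_deriveD.
Qed.

Lemma is_derivCM h k t l m : is_derivC h t l -> is_derivC k t m ->
  is_derivC (fun s => h s * k s) t (l * k t + h t * m).
Proof.
move=> [h1 h2] [k1 k2]; split.
  have -> : (fun s => complex.Re (h s * k s)) =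
    (fun s => complex.Re (h s)) * (fun s => complex.Re (k s)) -
    (fun s => complex.Im (h s)) * (fun s => complex.Im (k s)).
    by apply/funext => s; rewrite cReM.
  have e := is_deriveB (is_deriveM h1 k1) (is_deriveM h2 k2).
  apply: is_derive_eq e _.
  by rewrite cReD !cReM /GRing.scale /=; ring.
have -> : (fun s => complex.Im (h s * k s)) =
    (fun s => complex.Re (h s)) * (fun s => complex.Im (k s)) +
    (fun s => complex.Im (h s)) * (fun s => complex.Re (k s)).
  by apply/funext => s; rewrite cImM.
have e := is_deriveD (is_deriveM h1 k2) (is_deriveM h2 k1).
apply: is_derive_eq e _.
by rewrite cImD !cImM /GRing.scale /=; ring.
Qed.

Lemma is_derivCZ (a : C) h t l : is_derivC h t l -> is_derivC (fun s => a * h s) t (a * l).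
Proof.
move=> hl; have := is_derivCM (is_derivC_cst a t) hl; by rewrite mul0r add0r.
Qed.

Lemma is_derivC_sum (I : Type) (r : seq I) (h : I -> R -> C) t (l : I -> C) :
  (forall i, is_derivC (h i) t (l i)) ->
  is_derivC (fun s => \sum_(i <- r) h i s) t (\sum_(i <- r) l i).
Proof.
move=> hl; elim: r => [|i r IH].
  have -> : (fun s => \sum_(i <- [::]) h i s) = fun=> 0.
    by apply/funext => s; rewrite big_nil.
  by rewrite big_nil; exact: is_derivC_cst.
have -> : (fun s => \sum_(j <- i :: r) h j s) = fun s => h i s + \sum_(j <- r) h j s.
  by apply/funext => s; rewrite big_cons.
by rewrite big_cons; exact: is_derivCD.
Qed.

Lemma derivC0_cst h : (forall t, is_derivC h t 0) -> forall s t, h s = h t.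
Proof.
move=> h0 s t; have e1 := @is_derive_0_is_cst R _ s t (fun t => (h0 t).1).
have e2 := @is_derive_0_is_cst R _ s t (fun t => (h0 t).2).
by move: e1 e2; case: (h s) => a b; case: (h t) => c d /= -> ->.
Qed.

Lemma is_derive_shift (f : R -> R) t l :
  is_derive (0 : R) 1 (fun s => f (t + s)) l -> is_derive t 1 f l.
Proof.
move=> [d0 e0].
have E : (fun u : R => u^-1 *: (f (u *: 1 + t) - f t)) =
         (fun u : R => u^-1 *: ((fun s => f (t + s)) (u *: 1 + 0) - (fun s => f (t + s)) 0)).
  by apply/funext => u; rewrite !addr0 [t + _]addrC.
by split; rewrite /derivable /derive E.
Qed.

Lemma is_derivC_shift h t l : is_derivC (fun s => h (t + s)) 0 l -> is_derivC h t l.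
Proof. by move=> [h1 h2]; split; exact: is_derive_shift. Qed.

Lemma is_derive_quadratic (f : R -> R) l c :
  (forall s, `|s| <= 1 -> `|f s - f 0 - s * l| <= c * s ^+ 2) ->
  is_derive (0 : R) 1 f l.
Proof.
move=> hf; have cv : (fun h : R => h^-1 *: (f (h *: 1 + 0) - f 0)) @ 0^' --> l.
  apply/cvgrPdist_le => e e0; near=> h.
  have h0 : h != 0 by near: h; exact: nbhs_dnbhs_neq.
  rewrite addr0 /GRing.scale /= mulr1.
  have h1 : `|h| <= 1 by near: h; apply: dnbhs0_le.
  have hc : `|h| <= e / (`|c| + 1).
    by near: h; apply: dnbhs0_le; rewrite divr_gt0 // ltr_wpDl.
  have -> : l - h^-1 * (f h - f 0) = - (h^-1 * (f h - f 0 - h * l)).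
    by rewrite [in RHS]mulrBr mulKf // opprB.
  rewrite normrN normrM normfV ler_pdivrMl ?normr_gt0 //.
  apply: le_trans (hf h h1) _.
  rewrite -[h ^+ 2]ger0_norm ?sqr_ge0 // normrX expr2 mulrA mulrC ler_wpM2l //.
  apply: (@le_trans _ _ ((`|c| + 1) * `|h|)).
    by rewrite ler_wpM2r // (le_trans (ler_norm c)) // lerDl.
  by rewrite mulrC -ler_pdivlMr // ltr_wpDl.
by split; [apply/cvg_ex; exists l | exact: cvg_lim cv].
Unshelve. all: by end_near. Qed.

End ComplexCurves.

Section SmoothOnGroup.
Variables (R : realType) (n : nat) (GG : alg_group n).
Local Notation C := R[i].
Local Notation M := 'M[R]_n.
Local Notation G := (points GG R).
Local Notation g := (gC R GG).
Implicit Types (f k : G -> C).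

Lemma is_derive_expm (x X y : M) i j :
  is_derive (0 : R) 1 (fun t => (x *m expm (t *: X) *m y) i j) ((x *m X *m y) i j).
Proof.
apply: (@is_derive_quadratic R _ _ (mxn x * (n%:R * expR (mxn X)) * mxn y)) => s s1.
have -> : (x *m expm (s *: X) *m y) i j - (x *m expm (0 *: X) *m y) i j -
    s * (x *m X *m y) i j = (x *m (expm (s *: X) - psum (s *: X) 2) *m y) i j.
  rewrite psum2 scale0r expm0 mulmxBr mulmxBl mulmxDr mulmxDl -scalemxAr -scalemxAl.
  by rewrite opprD addrA !mxE.
apply: le_trans (mxn_entry _ _ _) _; apply: le_trans (mxnM _ _) _.
rewrite -[s ^+ 2]ger0_norm ?sqr_ge0 // normrX mulrAC ler_wpM2r ?mxn_ge0 //.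
apply: le_trans (mxnM _ _) _; rewrite -mulrA ler_wpM2l ?mxn_ge0 //.
exact: expm_taylor.
Qed.

Lemma derivable_expm (x X : M) : derivable (fun t : R => x *m expm (t *: X)) 0 1.
Proof.
apply/derivable_mxP => i j; have [h _] := is_derive_expm x X 1%:M i j.
by move: h; under eq_fun do rewrite mulmx1.
Qed.

Lemma near_curve (x : G) (X : M) (U : set M) : X \in lie GG R -> open U -> U (val x) ->
  \forall t \near (0 : R), U (val (x * exp_pt (t *: X))%g).
Proof.
move=> hX oU Ux.
have c : {for (0 : R), continuous (fun t : R => val x *m expm (t *: X))}.
  by apply/differentiable_continuous/derivable1_diffP; exact: derivable_expm.
have : \forall t \near (0 : R), U (val x *m expm (t *: X)).
  apply: c; rewrite scale0r expm0 mulmx1; exact: open_nbhs_nbhs.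
apply: filterS => t; rewrite val_ptM val_exp_pt // memvZ //.
Qed.

Lemma derivable_curve (x : G) (X : M) (F : M -> R) : differentiable F (val x) ->
  derivable (fun t : R => F (val x *m expm (t *: X))) 0 1.
Proof.
move=> dF; apply/derivable1_diffP.
apply: (@differentiable_comp _ _ _ _ (fun t : R => val x *m expm (t *: X)) F).
  by apply/derivable1_diffP; exact: derivable_expm.
by rewrite scale0r expm0 mulmx1.
Qed.

Lemma extends_derivable (h : G -> R) (x : G) (X : M) : X \in lie GG R ->
  locally_extends (@smooth_on R n) setT h ->
  derivable (fun t : R => h (x * exp_pt (t *: X))%g) 0 1.
Proof.
move=> hX hh; have [U [F [oU Ux sF hF]]] := hh x I.
have dF : differentiable F (val x) by exact: smooth_differentiable sF Ux.
have E : \forall t \near (0 : R),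
    F (val x *m expm (t *: X)) = h (x * exp_pt (t *: X))%g.
  apply: filterS (near_curve hX oU Ux) => t Ut; rewrite hF //.
  by rewrite val_ptM val_exp_pt // memvZ.
by case: (near_eq_is_derive E (derivableP (@derivable_curve x X F dF))).
Qed.

Lemma smooth_is_derivC f (x : G) (X : M) : X \in lie GG R -> smooth f ->
  is_derivC (fun t => f (x * exp_pt (t *: X))%g) 0 (rderivR X f x).
Proof.
move=> hX [h1 h2]; rewrite /rderivR /Defs.derivC !derive1E.
split.
  exact: derivableP (@extends_derivable (fun y => complex.Re (f y)) x X hX h1).
exact: derivableP (@extends_derivable (fun y => complex.Im (f y)) x X hX h2).
Qed.

Lemma extends_lin (a b : R) (h k : G -> R) :
  locally_extends (@smooth_on R n) setT h -> locally_extends (@smooth_on R n) setT k ->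
  locally_extends (@smooth_on R n) setT (fun x => a * h x + b * k x).
Proof.
move=> hh hk x _; have [U [F [oU Ux sF hF]]] := hh x I.
have [V [E [oV Vx sE hE]]] := hk x I.
exists (U `&` V), (fun y => a * F y + b * E y); split=> //; first exact: openI.
  apply: smooth_lin; first exact: openI.
    exact: smooth_restrict (@subIsetl _ _ _) sF.
  exact: smooth_restrict (@subIsetr _ _ _) sE.
by move=> y _ [Uy Vy]; rewrite hF // hE.
Qed.

Lemma extends_mul (h k : G -> R) :
  locally_extends (@smooth_on R n) setT h -> locally_extends (@smooth_on R n) setT k ->
  locally_extends (@smooth_on R n) setT (fun x => h x * k x).
Proof.
move=> hh hk x _; have [U [F [oU Ux sF hF]]] := hh x I.
have [V [E [oV Vx sE hE]]] := hk x I.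
exists (U `&` V), (fun y => F y * E y); split=> //; first exact: openI.
  apply: smooth_mul; first exact: openI.
    exact: smooth_restrict (@subIsetl _ _ _) sF.
  exact: smooth_restrict (@subIsetr _ _ _) sE.
by move=> y _ [Uy Vy]; rewrite hF // hE.
Qed.

Lemma extends_ext (h k : G -> R) : (forall x, h x = k x) ->
  locally_extends (@smooth_on R n) setT h -> locally_extends (@smooth_on R n) setT k.
Proof. by move=> /funext ->. Qed.

Lemma smoothM f k : smooth f -> smooth k -> smooth (fun x => f x * k x).
Proof.
move=> [f1 f2] [k1 k2]; split.
  apply: extends_ext (extends_lin 1 (-1) (extends_mul f1 k1) (extends_mul f2 k2)) => x.
  by rewrite cReM mul1r mulN1r.
apply: extends_ext (extends_lin 1 1 (extends_mul f1 k2) (extends_mul f2 k1)) => x.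
by rewrite cImM !mul1r.
Qed.

Lemma smooth_cstC (c : C) : smooth (fun _ : G => c).
Proof.
have h (r : R) : locally_extends (@smooth_on R n) setT (fun _ : G => r).
  move=> x _; exists setT, (fun=> r); split=> //; first exact: openT.
  exact: smooth_cst.
by split; exact: h.
Qed.

Lemma smoothD f k : smooth f -> smooth k -> smooth (f + k).
Proof.
move=> [f1 f2] [k1 k2]; split.
  by apply: extends_ext (extends_lin 1 1 f1 k1) => x; rewrite !mul1r cReD.
by apply: extends_ext (extends_lin 1 1 f2 k2) => x; rewrite !mul1r cImD.
Qed.

Lemma smoothZ a f : smooth f -> smooth (a *: f).
Proof. by move=> hf; exact: (smoothM (smooth_cstC a) hf). Qed.

Lemma smooth0 : smooth (0 : G -> C).
Proof. exact: (smooth_cstC 0). Qed.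

(** Smoothness ensures that the difference quotients converge; otherwise the derivative is a default
    value and linearity can fail. *)
Lemma rderivR_lin (X : M) a f k : X \in lie GG R -> smooth f -> smooth k ->
  rderivR X (a *: f + k) = a *: rderivR X f + rderivR X k.
Proof.
move=> hX sf sk; apply/funext => x; apply: derivC_val.
apply: is_derivCD; last exact: smooth_is_derivC.
by apply: is_derivCZ; exact: smooth_is_derivC.
Qed.

Lemma rderivRM (X : M) f k : X \in lie GG R -> smooth f -> smooth k ->
  rderivR X (fun x => f x * k x) = fun x => rderivR X f x * k x + f x * rderivR X k x.
Proof.
move=> hX sf sk; apply/funext => x; apply: derivC_val.
have := is_derivCM (smooth_is_derivC x hX sf) (smooth_is_derivC x hX sk).
by rewrite scale0r exp_pt0 mulg1.
Qed.

(** The coefficients of the differential at 1 are values of rational polynomials at a rational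
    matrix, hence real. *)
Lemma diff_at1_Re P (X : 'M[C]_n) :
  complex.Re (diff_at1 P X) = diff_at1 P (map_mx (@complex.Re R) X) /\
  complex.Im (diff_at1 P X) = diff_at1 P (map_mx (@complex.Im R) X).
Proof.
have e (Q : mpoly (n * n) rat) : poly_at ratr Q (1%:M : 'M[C]_n) =
    (poly_at ratr Q (1%:M : M))%:C%C.
  rewrite -[RHS]/(real_complex R _) (@poly_at_rmorph n R C ratr) map_mx1.
  by congr (poly_at _ Q _); apply/funext => q /=; rewrite fmorph_rat.
have ReS (I : Type) (r : seq I) (F : I -> C) :
    complex.Re (\sum_(i <- r) F i) = \sum_(i <- r) complex.Re (F i).
  by elim/big_rec2: _ => // i x y _ <-; rewrite cReD.
have ImS (I : Type) (r : seq I) (F : I -> C) :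
    complex.Im (\sum_(i <- r) F i) = \sum_(i <- r) complex.Im (F i).
  by elim/big_rec2: _ => // i x y _ <-; rewrite cImD.
rewrite /diff_at1 ReS ImS; split; apply: eq_bigr => k _; rewrite e.
  by rewrite cReM /= mul0r subr0 -map_mxvec mxE.
by rewrite cImM /= mul0r addr0 -map_mxvec mxE.
Qed.

Lemma lie_ReIm (X : 'M[C]_n) : X \in lie GG C ->
  map_mx (@complex.Re R) X \in lie GG R /\ map_mx (@complex.Im R) X \in lie GG R.
Proof.
move=> /lieP hX; split; apply/lieP => P PS; have [e1 e2] := diff_at1_Re P X.
  by rewrite -e1 hX.
by rewrite -e2 hX.
Qed.

Lemma rderiv_lin (X : g) a f k : smooth f -> smooth k ->
  rderiv X (a *: f + k) = a *: rderiv X f + rderiv X k.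
Proof.
move=> sf sk; have [h1 h2] := lie_ReIm (subvsP X).
rewrite /rderiv !rderivR_lin // !scalerDr addrACA.
by congr (_ + _ + (_ + _)); rewrite !scalerA mulrC.
Qed.

Lemma rderivM (X : g) f k : smooth f -> smooth k ->
  rderiv X (fun x => f x * k x) = fun x => rderiv X f x * k x + f x * rderiv X k x.
Proof.
move=> sf sk; have [h1 h2] := lie_ReIm (subvsP X).
apply/funext => x.
have /(congr1 (@^~ x)) /= e1 := rderivRM h1 sf sk.
have /(congr1 (@^~ x)) /= e2 := rderivRM h2 sf sk.
transitivity (rderivR (map_mx (@complex.Re R) (vsval X)) (fun x => f x * k x) x +
  Complex 0 1 * rderivR (map_mx (@complex.Im R) (vsval X)) (fun x => f x * k x) x) => //.
rewrite e1 e2 mulrDr addrACA [RHS]addrC addrC; congr (_ + _).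
  by rewrite /rderiv !fctE mulrDr; congr (_ + _); rewrite mulrCA.
by rewrite /rderiv !fctE mulrDl; congr (_ + _); rewrite mulrA.
Qed.

End SmoothOnGroup.

(** * The center of the enveloping algebra *)

Section EnvelopingAction.
Variables (R : realType) (n : nat) (GG : alg_group n).
Local Notation C := R[i].
Local Notation g := (gC R GG).
Local Notation U := (free_env R GG).
Variables (V : lmodType C) (act : g -> {linear V -> V}).
Local Notation "u ⋅ v" := (env_act (fun X => act X) u v) (at level 35).
Local Notation word m v := (foldr (fun X => act X) v (monalg.fmonom_val m)).

Lemma env_actEw (u : U) v d :
  (monalg.msupp u `<=` d)%fset ->
  u ⋅ v = \sum_(m <- d) monalg.mcoeff m u *: word m v.
Proof.
move=> le; rewrite /env_act (big_fset_incl _ le) //= => k _ kx.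
by rewrite monalg.mcoeff_outdom // scale0r.
Qed.

Lemma env_actD (u u' : U) v : (u + u') ⋅ v = u ⋅ v + u' ⋅ v.
Proof.
pose d := (monalg.msupp u `|` monalg.msupp u')%fset.
rewrite (@env_actEw _ v d) ?monalg.msuppD_le //.
rewrite (@env_actEw u v d) ?fsubsetUl // (@env_actEw u' v d) ?fsubsetUr //.
by rewrite -big_split; apply: eq_bigr => m _ /=; rewrite monalg.mcoeffD scalerDl.
Qed.

Lemma env_act0 v : (0 : U) ⋅ v = 0.
Proof. by rewrite /env_act monalg.msupp0 big_seq_fset0. Qed.

Lemma env_actN (u : U) v : (- u) ⋅ v = - (u ⋅ v).
Proof. by apply/eqP; rewrite -addr_eq0 -env_actD addNr env_act0. Qed.

Lemma env_actB (u u' : U) v : (u - u') ⋅ v = u ⋅ v - u' ⋅ v.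
Proof. by rewrite (env_actD u (- u')) (env_actN u'). Qed.

Lemma env_actU (a : C) m v : (monalg.mkmalgU m a : U) ⋅ v = a *: word m v.
Proof.
rewrite (@env_actEw _ v [fset m]%fset) ?monalg.msuppU_le //.
by rewrite big_seq_fset1 monalg.mcoeffUU.
Qed.

Lemma env_act_linear (u : U) : linear (fun v => u ⋅ v).
Proof.
move=> a v w; rewrite /env_act scaler_sumr -big_split; apply: eq_bigr => m _ /=.
have -> : word m (a *: v + w) = a *: word m v + word m w.
  by elim: (monalg.fmonom_val m) => //= X s ->; rewrite linearP.
by rewrite scalerDr !scalerA mulrC.
Qed.

Lemma malg_ind (Q : U -> Prop) : Q 0 -> (forall u u', Q u -> Q u' -> Q (u + u')) ->
  (forall a m, Q (monalg.mkmalgU m a)) -> forall u, Q u.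
Proof.
move=> Q0 QD QU u; rewrite [u]monalg.monalgE.
by elim/big_ind: _ => // m _; exact: QU.
Qed.

Lemma env_act0r (u : U) : u ⋅ 0 = 0.
Proof.
rewrite /env_act big1 // => m _.
have -> : word m 0 = 0 by elim: (monalg.fmonom_val m) => //= X s ->; exact: linear0.
exact: scaler0.
Qed.

Lemma env_actDr (u : U) v w : u ⋅ (v + w) = u ⋅ v + u ⋅ w.
Proof. by have := env_act_linear u 1 v w; rewrite !scale1r. Qed.

(** By additivity in both arguments it is enough to treat two scaled words, whose product is their
    concatenation. *)
Lemma env_actM (u u' : U) v : (u * u') ⋅ v = u ⋅ (u' ⋅ v).
Proof.
move: u u'; apply: malg_ind => [u'|u1 u2 IH1 IH2 u'|a m].
- by rewrite (mul0r u') !env_act0.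
- have E : (u1 + u2) * u' = u1 * u' + u2 * u' :> U by exact: mulrDl.
  apply: etrans (congr1 (fun u => u ⋅ v) E) _.
  apply: etrans (env_actD (u1 * u') (u2 * u') v) _.
  exact: etrans (congr2 +%R (IH1 u') (IH2 u')) (esym (env_actD u1 u2 _)).
pose A : U := monalg.mkmalgU m a; rewrite -/A.
apply: malg_ind => [|u1 u2 IH1 IH2|b m'].
- have E : A * 0 = 0 :> U by exact: mulr0.
  apply: etrans (congr1 (fun u => u ⋅ v) E) _.
  by rewrite !env_act0 env_act0r.
- have E : A * (u1 + u2) = A * u1 + A * u2 :> U by exact: mulrDr.
  apply: etrans (congr1 (fun u => u ⋅ v) E) _.
  apply: etrans (env_actD (A * u1) (A * u2) v) _.
  apply: etrans (congr2 +%R IH1 IH2) _.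
  by rewrite (env_actD u1 u2) (env_actDr A).
have E := etrans (monalg.malgM_def A (monalg.mkmalgU m' b)) (monalg.fgmulUU a b m m').
apply: etrans (congr1 (fun u : U => u ⋅ v) E) _; rewrite /A !env_actU -scalerA.
have e : monalg.fmonom_val (monalg.mmul m m') = monalg.fmonom_val m ++ monalg.fmonom_val m'.
  by rewrite -[monalg.mmul m m']/(monalg.fmmul m m') monalg.fmmulE.
rewrite e foldr_cat; congr (_ *: _).
by elim: (monalg.fmonom_val m) => //= X s <-; rewrite linearZ.
Qed.

Hypothesis act_lin : forall (a : C) (X Y : g) v,
  act (a *: X + Y) v = a *: act X v + act Y v.
Hypothesis act_bracket : forall (X Y Z : g) v,
  vsval Z = bracket (vsval X) (vsval Y) ->
  act Z v = act X (act Y v) - act Y (act X v).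

Lemma env_act_gen X v : env_gen X ⋅ v = act X v.
Proof. by rewrite env_actU scale1r monalg.fmuE. Qed.

(** The elements acting by zero on all of V form a two-sided ideal, and it contains the defining
    relations because V is a representation of g. *)
Lemma env_ideal_act (u : U) v : env_ideal u -> u ⋅ v = 0.
Proof.
move=> /(_ [set u | forall v, u ⋅ v = 0]); apply=> {u v}.
- by move=> v; exact: env_act0.
- by move=> u u' h h' v; rewrite env_actD h h' addr0.
- move=> u u' h v; rewrite env_actM h.
  exact: env_act0r.
- by move=> u u' h v; rewrite env_actM h.
move=> u [[a [X [Y ->]]]|[X [Y [Z [e ->]]]]] v.
  apply: etrans (env_actB _ _ v) _; apply/eqP; rewrite subr_eq0; apply/eqP.
  apply: etrans (env_act_gen _ v) _; apply: esym; apply: etrans (env_actD _ _ v) _.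
  apply: etrans (congr2 +%R (env_actM _ _ v) (env_act_gen Y v)) _.
  apply: etrans (congr2 +%R (env_actU _ _ _) erefl) _.
  apply: etrans (congr2 +%R (congr2 *:%R erefl _) erefl) (esym (act_lin a X Y v)).
  by rewrite monalg.fmoneE; exact: env_act_gen.
apply: etrans (env_actB _ _ v) _; apply: etrans (congr2 +%R (env_actB _ _ v) erefl) _.
apply/eqP; rewrite subr_eq0; apply/eqP.
have e2 X' Y' : (env_gen X' * env_gen Y') ⋅ v = act X' (act Y' v).
  apply: etrans (env_actM _ _ v) _; apply: etrans (env_act_gen _ _) _.
  by congr (act _ _); exact: env_act_gen.
apply: etrans (congr2 +%R (e2 _ _) (congr1 -%R (e2 _ _))) _.
by apply: esym; apply: etrans (env_act_gen Z v) _; exact: act_bracket.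
Qed.

Lemma env_central_act (z : U) X v : env_central z -> z ⋅ (act X v) = act X (z ⋅ v).
Proof.
move=> hz; have h := env_ideal_act v (hz (env_gen X)).
have {}h := etrans (esym (env_actB (z * env_gen X) (env_gen X * z) v)) h.
have e1 : (z * env_gen X) ⋅ v = z ⋅ (act X v).
  by apply: etrans (env_actM _ _ v) _; congr (z ⋅ _); exact: env_act_gen.
have e2 : (env_gen X * z) ⋅ v = act X (z ⋅ v).
  by apply: etrans (env_actM _ _ v) _; exact: env_act_gen.
have {}h := etrans (esym (congr2 +%R e1 (congr1 -%R e2))) h.
by apply/eqP; rewrite -subr_eq0; apply/eqP.
Qed.

End EnvelopingAction.

Section MatrixCurves.
Variable R : realType.
Local Notation C := R[i].

Definition mx_derivC m n (A : R -> 'M[C]_(m, n)) t (A' : 'M[C]_(m, n)) : Prop :=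
  forall i j, is_derivC (fun s => A s i j) t (A' i j).

Lemma mx_derivC_cst m n (A : 'M[C]_(m, n)) t : mx_derivC (fun=> A) t 0.
Proof. by move=> i j; rewrite mxE; exact: is_derivC_cst. Qed.

Lemma mx_derivCM m n p (A : R -> 'M[C]_(m, n)) (B : R -> 'M[C]_(n, p)) t A' B' :
  mx_derivC A t A' -> mx_derivC B t B' ->
  mx_derivC (fun s => A s *m B s) t (A' *m B t + A t *m B').
Proof.
move=> hA hB i j; rewrite !mxE -big_split /=.
have -> : (fun s => (A s *m B s) i j) = (fun s => \sum_k A s i k * B s k j).
  by apply/funext => s; rewrite mxE.
by apply: is_derivC_sum => k; exact: is_derivCM.
Qed.

Lemma mx_derivC_toC n (x X y : 'M[R]_n) :
  mx_derivC (fun t => toC (x *m expm (t *: X) *m y)) 0 (toC (x *m X *m y)).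
Proof.
move=> i j; rewrite mxE; split => /=.
  have -> : (fun s => complex.Re (toC (x *m expm (s *: X) *m y) i j)) =
    (fun s => (x *m expm (s *: X) *m y) i j) by apply/funext => s; rewrite mxE.
  exact: is_derive_expm.
have -> : (fun s => complex.Im (toC (x *m expm (s *: X) *m y) i j)) = (fun=> 0).
  by apply/funext => s; rewrite mxE.
exact: is_derive_cst.
Qed.

End MatrixCurves.

(** * Continuity at 1 *)

Section ContinuityAtOne.
Variables (R : realType) (n : nat) (GG : alg_group n).
Local Notation C := R[i].
Local Notation G := (points GG R).
Local Notation normc := Normc.normc.

Lemma normc_real (a : R) : normc (a%:C)%C = `|a|.
Proof. by rewrite /Normc.normc /= expr0n addr0 sqrtr_sqr. Qed.

(** Continuity at 1 measured by [mxn], to match the accumulation hypothesis of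
    [topologically_perfect]. *)
Definition cont1 (f : G -> C) : Prop := forall e : R, 0 < e ->
  exists2 d : R, 0 < d & forall y, mxn (val y - 1%:M) <= d -> normc (f y - f 1%g) <= e.

Lemma cont1_cst c : cont1 (fun=> c).
Proof.
by move=> e e0; exists 1 => // y _; rewrite subrr Normc.normc0 ltW.
Qed.

Lemma cont1D f k : cont1 f -> cont1 k -> cont1 (fun y => f y + k y).
Proof.
move=> hf hk e e0; have e2 : 0 < e / 2 by rewrite divr_gt0.
have [d d0 h] := hf _ e2; have [d' d'0 h'] := hk _ e2.
exists (Num.min d d'); first by rewrite lt_min d0.
move=> y; rewrite le_min => /andP[yd yd']; rewrite opprD addrACA [e]splitr.
by apply: le_trans (normcD _ _) _; apply: lerD; [exact: h|exact: h'].
Qed.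

Lemma cont1M f k : cont1 f -> cont1 k -> cont1 (fun y => f y * k y).
Proof.
move=> hf hk e e0; set a := normc (f 1%g); set b := normc (k 1%g).
have a0 : 0 <= a by exact: normc_ge0.
have b0 : 0 <= b by exact: normc_ge0.
pose s := 1 + a + b.
have s0 : 0 < s by rewrite /s -addrA ltr_pwDl // addr_ge0.
pose u := Num.min 1 (e / s).
have u0 : 0 < u by rewrite lt_min ltr01 divr_gt0.
have [d d0 h] := hf _ u0; have [d' d'0 h'] := hk _ u0.
exists (Num.min d d'); first by rewrite lt_min d0.
move=> y; rewrite le_min => /andP[/h {}h /h' {}h'].
have -> : f y * k y - f 1%g * k 1%g = (f y - f 1%g) * (k y - k 1%g) +
    (f 1%g * (k y - k 1%g) + (f y - f 1%g) * k 1%g) by ring.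
apply: le_trans (normcD _ _) _; rewrite normcM.
apply: (@le_trans _ _ (u * 1 + (a * u + u * b))).
  apply: lerD.
    apply: ler_pM; rewrite ?normc_ge0 //; apply: le_trans h' _.
    by rewrite ge_min lexx.
  apply: le_trans (normcD _ _) _; rewrite !normcM -/a -/b.
  by apply: lerD; [rewrite ler_wpM2l|rewrite ler_wpM2r].
have -> : u * 1 + (a * u + u * b) = u * s by rewrite /s; ring.
by rewrite -ler_pdivlMr // ge_min lexx orbT.
Qed.

Lemma cont1_sum (I : Type) (r : seq I) (f : I -> G -> C) :
  (forall i, cont1 (f i)) -> cont1 (fun y => \sum_(i <- r) f i y).
Proof.
move=> hf; elim: r => [|i r IH].
  have -> : (fun y => \sum_(i <- [::]) f i y) = fun=> 0.
    by apply/funext => y; rewrite big_nil.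
  exact: cont1_cst.
have -> : (fun y => \sum_(j <- i :: r) f j y) = fun y => f i y + \sum_(j <- r) f j y.
  by apply/funext => y; rewrite big_cons.
exact: cont1D.
Qed.

Lemma cont1_eq f (c : C) : cont1 f ->
  (forall e : R, 0 < e -> exists2 q, f q = c & mxn (val q - 1%:M) <= e) -> f 1%g = c.
Proof.
move=> hf h; apply/eqP; rewrite -subr_eq0; apply/eqP; apply: Normc.eq0_normc.
apply/eqP; rewrite eq_le normc_ge0 andbT; apply/ler_addgt0Pl => e e0; rewrite addr0.
have [d d0 hd] := hf e e0; have [q fq hq] := h _ d0.
by have := hd _ hq; rewrite fq -normcN opprB.
Qed.

Lemma cont1_val i j : cont1 (fun y => toC (val y) i j).
Proof.
move=> e e0; exists e => // y hy.
have -> : toC (val y) i j - toC (val (1%g : G)) i j = ((val y - 1%:M) i j)%:C%C.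
  by rewrite val_pt1 !mxE rmorphB.
by rewrite normc_real; apply: le_trans (mxn_entry _ _ _) hy.
Qed.

(** From y^-1 - 1 = - y^-1 (y - 1), the norm c of the left side satisfies c <= (c + n) b with b = |y
    - 1|; for b <= 1/2 the term c b is absorbed. *)
Lemma mxn_ptV (y : G) : mxn (val y - 1%:M) <= 2^-1 ->
  mxn (val (y^-1)%g - 1%:M) <= 2 * n%:R * mxn (val y - 1%:M).
Proof.
set b := mxn (val y - 1%:M) => hb; set z := val (y^-1)%g.
have b0 : 0 <= b by exact: mxn_ge0.
have zy : z *m val y = 1%:M by rewrite /z -val_ptM mulVg.
have e : z - 1%:M = - (z *m (val y - 1%:M)) by rewrite mulmxBr zy mulmx1 opprB.
set c := mxn (z - 1%:M); have c0 : 0 <= c by exact: mxn_ge0.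
have h : c <= (c + n%:R) * b.
  rewrite /c {1}e mxnN; apply: le_trans (mxnM _ _) _; rewrite ler_wpM2r //.
  by rewrite -(@mxn1 R n) -{1}[z](subrK 1%:M); exact: mxnD.
have h' : c <= c * 2^-1 + n%:R * b.
  by apply: le_trans h _; rewrite mulrDl lerD2r ler_wpM2l.
have h2 : c <= 2 * (n%:R * b) by lra.
by rewrite -mulrA.
Qed.

Lemma cont1_inv i j : cont1 (fun y => toC (val (y^-1)%g) i j).
Proof.
move=> e e0; pose d := Num.min 2^-1 (e / (2 * n%:R + 1)).
have p0 : 0 < 2 * n%:R + 1 :> R by rewrite ltr_wpDl // mulr_ge0.
exists d; first by rewrite lt_min invr_gt0 ltr0n divr_gt0.
move=> y; rewrite le_min => /andP[/mxn_ptV h1 h2].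
have -> : toC (val (y^-1)%g) i j - toC (val ((1%g : G)^-1)%g) i j =
    ((val (y^-1)%g - 1%:M) i j)%:C%C.
  by rewrite invg1 val_pt1 !mxE rmorphB.
rewrite normc_real; apply: le_trans (mxn_entry _ _ _) _; apply: le_trans h1 _.
move: h2; rewrite ler_pdivlMr // => h2; apply: le_trans h2.
by rewrite mulrC ler_wpM2l ?mxn_ge0 // lerDl.
Qed.

Definition mx_cont1 m p (A : G -> 'M[C]_(m, p)) : Prop := forall i j, cont1 (fun y => A y i j).

Lemma mx_cont1_cst m p (A : 'M[C]_(m, p)) : mx_cont1 (fun=> A).
Proof. by move=> i j; exact: cont1_cst. Qed.

Lemma mx_cont1M m p q (A : G -> 'M[C]_(m, p)) (B : G -> 'M[C]_(p, q)) :
  mx_cont1 A -> mx_cont1 B -> mx_cont1 (fun y => A y *m B y).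
Proof.
move=> hA hB i j.
have -> : (fun y => (A y *m B y) i j) = (fun y => \sum_k A y i k * B y k j).
  by apply/funext => s; rewrite mxE.
by apply: cont1_sum => k; exact: cont1M.
Qed.

End ContinuityAtOne.

(** * The adjoint action on representations of g *)

Section Adjoint.
Variables (R : realType) (n : nat) (GG : alg_group n).
Local Notation C := R[i].
Local Notation G := (points GG R).
Local Notation g := (gC R GG).

Lemma toCM (A B : 'M[R]_n) : toC (A *m B) = toC A *m toC B.
Proof. exact: map_mxM. Qed.

Lemma toC1 : toC (1%:M : 'M[R]_n) = 1%:M.
Proof. exact: map_mx1. Qed.

Lemma toC_lie (X : 'M[R]_n) : X \in lie GG R -> toC X \in lie GG C.
Proof.
move=> /lieP h; apply/lieP => P PS; apply/eqP; rewrite eq_complex.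
have [-> ->] := diff_at1_Re P (toC X).
have -> : map_mx (@complex.Re R) (toC X) = X by apply/matrixP => i j; rewrite !mxE.
have -> : map_mx (@complex.Im R) (toC X) = 0 by apply/matrixP => i j; rewrite !mxE.
have -> : diff_at1 P (0 : 'M[R]_n) = 0 by exact: (linear0 (@diff_at1 n R P)).
by rewrite (h _ PS) /= eqxx.
Qed.

Lemma toC_point (x : G) : point_set GG C (toC (val x)).
Proof.
have := is_point_map (real_complex R) (pointP x).
apply: (@is_point_ext _ _ _ _ (ratr : {rmorphism rat -> C})) => q.
exact: fmorph_rat.
Qed.

Definition Ad_mx (x : G) (A : 'M[C]_n) : 'M[C]_n :=
  toC (val x) *m A *m toC (val (x^-1)%g).

Lemma Ad_mx_lie x A : A \in lie GG C -> Ad_mx x A \in lie GG C.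
Proof.
move=> hA; have := lie_Ad (mk_point (toC_point x)) hA.
by rewrite /Ad_mx /= -map_invmx.
Qed.

Definition Ad (x : G) (X : g) : g := vsproj (lie GG C) (Ad_mx x (vsval X)).

Lemma Ad_val x X : vsval (Ad x X) = Ad_mx x (vsval X).
Proof. by rewrite vsprojK //; apply: Ad_mx_lie; exact: subvsP. Qed.

Lemma toC_mulV (x : G) : toC (val (x^-1)%g) *m toC (val x) = 1%:M.
Proof. by rewrite -toCM -val_ptM mulVg val_pt1 toC1. Qed.

Lemma Ad_linear x : linear (Ad x).
Proof.
move=> a X Y; apply: val_inj.
have e : forall Z, val (Ad x Z) = Ad_mx x (vsval Z) by exact: Ad_val.
rewrite [LHS]e linearP [RHS]linearP /= !e /Ad_mx.
by rewrite mulmxDr mulmxDl -scalemxAr -scalemxAl.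
Qed.
HB.instance Definition _ x := GRing.isLinear.Build C g g *:%R (Ad x) (Ad_linear x).

Lemma Ad_mx_bracket x (A B : 'M[C]_n) :
  Ad_mx x (bracket A B) = bracket (Ad_mx x A) (Ad_mx x B).
Proof.
have e : forall A B : 'M[C]_n, Ad_mx x A *m Ad_mx x B = Ad_mx x (A *m B).
  move=> A' B'; rewrite /Ad_mx -!mulmxA; do 2!congr mulmx.
  by rewrite (mulmxA (toC _) (toC _)) toC_mulV mul1mx.
by rewrite /bracket !e /Ad_mx mulmxBr mulmxBl.
Qed.

Lemma Ad1 X : Ad 1%g X = X.
Proof.
apply: val_inj; apply: etrans (Ad_val _ _) _.
by rewrite /Ad_mx invg1 val_pt1 toC1 mul1mx mulmx1.
Qed.

Lemma mx_derivC_Ad (x : G) (X : 'M[R]_n) (A : 'M[C]_n) : X \in lie GG R ->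
  mx_derivC (fun t => Ad_mx (x * exp_pt (t *: X))%g A) 0 (Ad_mx x (bracket (toC X) A)).
Proof.
move=> hX; have hX' t : t *: X \in lie GG R by rewrite memvZ.
have -> : (fun t => Ad_mx (x * exp_pt (t *: X))%g A) = fun t =>
    toC (val x *m expm (t *: X) *m 1%:M) *m A *m
    toC (1%:M *m expm (t *: - X) *m val (x^-1)%g).
  apply/funext => t; have e1 := val_exp_pt (hX' t); have e2 := val_exp_pt (hX' (- t)).
  congr (toC _ *m A *m toC _).
    by rewrite mulmx1 -e1; exact: val_ptM.
  by rewrite invgM (exp_ptV t hX) mul1mx scalerN -scaleNr -e2; exact: val_ptM.
have := mx_derivCM (mx_derivCM (mx_derivC_toC (val x) X 1%:M) (mx_derivC_cst A 0))
  (mx_derivC_toC 1%:M (- X) (val (x^-1)%g)).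
congr (mx_derivC _ _ _).
rewrite !scale0r expm0 !mulmx1 !mul1mx mulmx0 addr0 !toCM /Ad_mx /bracket.
have -> : toC (- X) = - toC X by exact: map_mxN.
by rewrite mulmxBr mulmxBl mulNmx mulmxN !mulmxA.
Qed.

Lemma mx_cont1_Ad (x : G) (A : 'M[C]_n) : mx_cont1 (fun y => Ad_mx (x * y)%g A).
Proof.
have -> : (fun y => Ad_mx (x * y)%g A) = fun y => toC (val x) *m toC (val y) *m A *m
    (toC (val (y^-1)%g) *m toC (val (x^-1)%g)).
  by apply/funext => y; rewrite /Ad_mx invgM !val_ptM !toCM.
have h1 : mx_cont1 (fun y : G => toC (val y)) by move=> i j; exact: cont1_val.
have h2 : mx_cont1 (fun y : G => toC (val (y^-1)%g)) by move=> i j; exact: cont1_inv.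
have h3 (B : 'M[C]_n) : mx_cont1 (fun _ : G => B) by exact: mx_cont1_cst.
exact: (mx_cont1M (mx_cont1M (mx_cont1M (h3 _) h1) (h3 _)) (mx_cont1M h2 (h3 _))).
Qed.

Local Notation b := (vbasis {:g}).

(** The coordinate is extended to all matrices through a projection, so that it is a linear form in
    the entries and inherits derivatives and continuity from them. *)
Definition Ad_coord (j : 'I_(\dim {:g})) (A : 'M[C]_n) : C :=
  coord b j (vsproj (lie GG C) A).

Lemma Ad_coordE j (A : 'M[C]_n) :
  Ad_coord j A = \sum_i \sum_k A i k * Ad_coord j (delta_mx i k).
Proof.
rewrite {1}/Ad_coord {1}[A]matrix_sum_delta !linear_sum; apply: eq_bigr => i _.
by rewrite !linear_sum; apply: eq_bigr => k _; rewrite !linearZ.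
Qed.

Lemma is_derivC_Ad_coord j (A : R -> 'M[C]_n) A' t : mx_derivC A t A' ->
  is_derivC (fun s => Ad_coord j (A s)) t (Ad_coord j A').
Proof.
move=> h; rewrite Ad_coordE.
have -> : (fun s => Ad_coord j (A s)) =
    fun s => \sum_i \sum_k Ad_coord j (delta_mx i k) * A s i k.
  apply/funext => s; rewrite Ad_coordE; apply: eq_bigr => i _.
  by apply: eq_bigr => k _; rewrite mulrC.
apply: is_derivC_sum => i; apply: is_derivC_sum => k.
by rewrite mulrC; exact: is_derivCZ.
Qed.

Lemma cont1_Ad_coord j (A : G -> 'M[C]_n) : mx_cont1 A ->
  cont1 (fun y => Ad_coord j (A y)).
Proof.
move=> h.
have -> : (fun s => Ad_coord j (A s)) =
    fun s => \sum_i \sum_k A s i k * Ad_coord j (delta_mx i k).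
  by apply/funext => s; rewrite Ad_coordE.
apply: cont1_sum => i; apply: cont1_sum => k.
by apply: cont1M; [exact: h|exact: cont1_cst].
Qed.

Section AdjointAction.
Variables (V : lmodType C) (act : g -> {linear V -> V}).
Hypothesis act_lin : forall (a : C) (X Y : g) v,
  act (a *: X + Y) v = a *: act X v + act Y v.
Hypothesis act_bracket : forall (X Y Z : g) v,
  vsval Z = bracket (vsval X) (vsval Y) -> act Z v = act X (act Y v) - act Y (act X v).

(** The twisted action is again a representation of g, so central elements commute with it. Acting
    through it by u amounts to acting by Ad(x) u. *)
Definition Ad_act (x : G) (X : g) : {linear V -> V} := act (Ad x X).
Local Notation word x m v := (foldr (fun X => Ad_act x X) v m).

Lemma act_sum m (c : 'I_m -> C) (X : 'I_m -> g) v :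
  act (\sum_i c i *: X i) v = \sum_i c i *: act (X i) v.
Proof.
have a0 : act 0 v = 0.
  by have := act_lin (-1) 0 0 v; rewrite scaler0 add0r scaleN1r addNr.
apply: (big_ind2 (fun Y y => act Y v = y)) => [//|X1 v1 X2 v2 <- <-|i _].
  by rewrite -[X1]scale1r act_lin !scale1r.
by rewrite -[_ *: X i]addr0 act_lin a0 addr0.
Qed.

Lemma act_coord (X : g) v : act X v = \sum_j coord b j X *: act b`_j v.
Proof. by rewrite -act_sum -(coord_vbasis (memvf X)). Qed.

Lemma Ad_act_coord x X v :
  Ad_act x X v = \sum_j Ad_coord j (Ad_mx x (vsval X)) *: act b`_j v.
Proof. exact: act_coord. Qed.

Lemma Ad_act_lin x (a : C) (X Y : g) v :
  Ad_act x (a *: X + Y) v = a *: Ad_act x X v + Ad_act x Y v.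
Proof. by rewrite /Ad_act linearP act_lin. Qed.

Lemma Ad_act_bracket x (X Y Z : g) v : vsval Z = bracket (vsval X) (vsval Y) ->
  Ad_act x Z v = Ad_act x X (Ad_act x Y v) - Ad_act x Y (Ad_act x X v).
Proof.
move=> h; apply: act_bracket.
apply: etrans (Ad_val _ _) _; rewrite h Ad_mx_bracket.
by congr bracket; exact: esym (Ad_val _ _).
Qed.

(** Differentiating the letters one by one gives, by the Leibniz rule, the commutator of X' with the
    word. In the induction the outermost letter is expanded in a basis: its coordinates are scalar
    functions of t, and the basis elements are moved into the functional. *)
Lemma is_derivC_word (p : R -> G) (X' : g) w (m : seq g) (ell : {linear V -> C^o}) :
  (forall A, mx_derivC (fun t => Ad_mx (p t) A) 0 (Ad_mx (p 0) (bracket (vsval X') A))) ->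
  is_derivC (fun t => ell (word (p t) m w)) 0
    (ell (Ad_act (p 0) X' (word (p 0) m w) - word (p 0) m (Ad_act (p 0) X' w))).
Proof.
move=> hp; elim: m ell => [|Y m IH] ell /=.
  by rewrite subrr linear0; exact: is_derivC_cst.
have hZ : bracket (vsval X') (vsval Y) \in lie GG C.
  by apply: lie_bracket; exact: subvsP.
pose Z : g := vsproj (lie GG C) (bracket (vsval X') (vsval Y)).
have hZ' : vsval Z = bracket (vsval X') (vsval Y) by rewrite vsprojK.
have -> : (fun t => ell (Ad_act (p t) Y (word (p t) m w))) =
    fun t => \sum_j Ad_coord j (Ad_mx (p t) (vsval Y)) * (ell \o act b`_j) (word (p t) m w).
  by apply/funext => t; rewrite Ad_act_coord linear_sum; apply: eq_bigr => j _; rewrite linearZ.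
set u := word (p 0) m w in IH *; set u' := word (p 0) m _ in IH *.
suff -> : ell (Ad_act (p 0) X' (Ad_act (p 0) Y u) - Ad_act (p 0) Y u') =
    \sum_j (Ad_coord j (Ad_mx (p 0) (bracket (vsval X') (vsval Y))) * (ell \o act b`_j) u +
      Ad_coord j (Ad_mx (p 0) (vsval Y)) * (ell \o act b`_j) (Ad_act (p 0) X' u - u')).
  apply: is_derivC_sum => j.
  exact: is_derivCM (is_derivC_Ad_coord j (hp (vsval Y)))
    (IH (ell \o act b`_j : {linear V -> C^o})).
rewrite big_split /=.
have eS : forall (A : g) v, \sum_j Ad_coord j (Ad_mx (p 0) (vsval A)) * ell (act b`_j v) =
    ell (Ad_act (p 0) A v).
  by move=> A v; rewrite Ad_act_coord linear_sum; apply: eq_bigr => j _; rewrite linearZ.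
rewrite -hZ' !eS -linearD (Ad_act_bracket (p 0) u hZ').
by congr (ell _); rewrite [X in _ = _ + X]linearB addrA subrK.
Qed.

Lemma cont1_word (x : G) w (m : seq g) (ell : {linear V -> C^o}) :
  cont1 (fun y => ell (word (x * y)%g m w)).
Proof.
elim: m ell => [|Y m IH] ell /=; first exact: cont1_cst.
have -> : (fun y => ell (Ad_act (x * y)%g Y (word (x * y)%g m w))) =
    fun y => \sum_j Ad_coord j (Ad_mx (x * y)%g (vsval Y)) *
      (ell \o act b`_j) (word (x * y)%g m w).
  by apply/funext => t; rewrite Ad_act_coord linear_sum; apply: eq_bigr => j _; rewrite linearZ.
apply: cont1_sum => j; apply: cont1M; last exact: (IH (ell \o act b`_j : {linear V -> C^o})).
by apply: cont1_Ad_coord; exact: mx_cont1_Ad.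
Qed.

End AdjointAction.
End Adjoint.

(** * Invariance of the center under Ad(G) *)

Section CentralInvariance.
Variables (R : realType) (n : nat) (GG : alg_group n).
Local Notation C := R[i].
Local Notation G := (points GG R).
Local Notation g := (gC R GG).
Variables (V : lmodType C) (act : g -> {linear V -> V}).
Hypothesis act_lin : forall (a : C) (X Y : g) v,
  act (a *: X + Y) v = a *: act X v + act Y v.
Hypothesis act_bracket : forall (X Y Z : g) v,
  vsval Z = bracket (vsval X) (vsval Y) -> act Z v = act X (act Y v) - act Y (act X v).
Local Notation env x := (env_act (fun X => Ad_act act x X)).

Lemma is_derivC_env (p : R -> G) (X : g) (u : free_env R GG) w (ell : {linear V -> C^o}) :
  (forall A, mx_derivC (fun t => Ad_mx (p t) A) 0 (Ad_mx (p 0) (bracket (vsval X) A))) ->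
  is_derivC (fun t => ell (env (p t) u w)) 0
    (ell (Ad_act act (p 0) X (env (p 0) u w) - env (p 0) u (Ad_act act (p 0) X w))).
Proof.
move=> hp; elim/malg_ind: u => [|u u' IH IH'|a m].
- have -> : (fun t => ell (env (p t) 0 w)) = fun=> 0.
    by apply/funext => t; rewrite env_act0 linear0.
  by rewrite !env_act0 linear0 subr0 linear0; exact: is_derivC_cst.
- have -> : (fun t => ell (env (p t) (u + u') w)) =
      fun t => ell (env (p t) u w) + ell (env (p t) u' w).
    by apply/funext => t; rewrite env_actD linearD.
  rewrite !env_actD [X in ell (X - _)]linearD opprD addrACA linearD.
  exact: is_derivCD.
have -> : (fun t => ell (env (p t) (monalg.mkmalgU m a) w)) =
    fun t => a * ell (foldr (fun X => Ad_act act (p t) X) w (monalg.fmonom_val m)).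
  by apply/funext => t; rewrite env_actU linearZ.
rewrite !env_actU [X in ell (X - _)]linearZ -scalerBr linearZ; apply: is_derivCZ.
exact: is_derivC_word.
Qed.

Lemma cont1_env x (u : free_env R GG) w (ell : {linear V -> C^o}) :
  cont1 (fun y => ell (env (x * y)%g u w)).
Proof.
elim/malg_ind: u => [|u u' IH IH'|a m].
- have -> : (fun y => ell (env (x * y)%g 0 w)) = fun=> 0.
    by apply/funext => t; rewrite env_act0 linear0.
  exact: cont1_cst.
- have -> : (fun y => ell (env (x * y)%g (u + u') w)) =
      fun y => ell (env (x * y)%g u w) + ell (env (x * y)%g u' w).
    by apply/funext => t; rewrite env_actD linearD.
  exact: cont1D.
have -> : (fun y => ell (env (x * y)%g (monalg.mkmalgU m a) w)) =
    fun y => a * ell (foldr (fun X => Ad_act act (x * y)%g X) w (monalg.fmonom_val m)).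
  by apply/funext => t; rewrite env_actU linearZ.
by apply: cont1M; [exact: cont1_cst|exact: cont1_word].
Qed.

Hypothesis G_ss : connected_semisimple_real GG R.
Variables (z : free_env R GG) (z_central : env_central z).

(** Along t |-> x exp(tX) the derivative is the commutator of z with an element of g in the twisted
    action, so it vanishes, and the values at t = 0 and t = 1 agree. *)
Lemma env_central_exp x (X : 'M[R]_n) w (ell : {linear V -> C^o}) : X \in lie GG R ->
  ell (env (x * exp_pt X)%g z w) = ell (env x z w).
Proof.
move=> hX; pose p (t : R) := (x * exp_pt (t *: X))%g.
pose X' : g := vsproj (lie GG C) (toC X).
have hX' : vsval X' = toC X by rewrite vsprojK //; exact: toC_lie.
have hp t A : mx_derivC (fun s => Ad_mx (p (t + s)) A) 0
    (Ad_mx (p (t + 0)) (bracket (vsval X') A)).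
  have ep s : p (t + s) = (p t * exp_pt (s *: X))%g.
    exact: etrans (congr1 (fun q => x * q)%g (exp_ptDZ t s hX)) (mulgA _ _ _).
  have e : (fun s => Ad_mx (p (t + s)) A) = fun s => Ad_mx (p t * exp_pt (s *: X))%g A.
    by apply/funext => s; exact: (congr1 (fun q => Ad_mx q A) (ep s)).
  by rewrite e addr0 hX'; exact: mx_derivC_Ad.
have hc y : ell (Ad_act act y X' (env y z w) - env y z (Ad_act act y X' w)) = 0.
  rewrite -[RHS](linear0 ell); congr (ell _); apply/eqP; rewrite subr_eq0; apply/eqP.
  exact: esym (env_central_act (Ad_act_lin act_lin y) (Ad_act_bracket act_bracket y)
    X' w z_central).
have h t : is_derivC (fun s => ell (env (p s) z w)) t 0.
  apply: is_derivC_shift; rewrite -(hc (p (t + 0))).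
  exact: (is_derivC_env z w ell (hp t)).
have := derivC0_cst h 1 0.
by rewrite /p scale1r scale0r exp_pt0 mulg1.
Qed.

Lemma env_central_Ad x y w (ell : {linear V -> C^o}) :
  ell (env (x * y)%g z w) = ell (env x z w).
Proof.
(* Quantifying over x makes S a subgroup: the factors of a product are removed one after the other,
   at different base points. *)
pose S : set G := [set y | forall x w (ell : {linear V -> C^o}),
  ell (env (x * y)%g z w) = ell (env x z w)].
case: (G_ss) => conn ss _; move: x w ell.
suff : S y by [].
have SM y1 y2 : S y1 -> S y2 -> S (y1 * y2)%g.
  move=> h1 h2 x w ell; apply: etrans (h1 x w ell); apply: etrans (h2 (x * y1)%g w ell).
  exact: (congr1 (fun q => ell (env q z w)) (mulgA x y1 y2)).
have SV y1 : S y1 -> S (y1^-1)%g.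
  move=> h x w ell; apply: etrans (esym (h _ w ell)) _.
  have e : (x * y1^-1 * y1)%g = x by rewrite -mulgA mulVg mulg1.
  exact: (congr1 (fun q => ell (env q z w)) e).
have Sexp X : X \in lie GG R -> S (exp_pt X).
  by move=> hX x w ell; exact: env_central_exp.
have S1 : S 1%g by move=> x w ell; exact: (congr1 (fun q => ell (env q z w)) (mulg1 x)).
have Scomm Y Z s : Y \in lie GG R -> Z \in lie GG R -> S (pt_comm GG Y Z s).
  move=> hY hZ; apply: (eq_ind_r S _ (pt_commE s hY hZ)).
  have sY : S (exp_pt (s *: Y)) by apply: Sexp; rewrite memvZ.
  have sZ : S (exp_pt (s *: Z)) by apply: Sexp; rewrite memvZ.
  exact: SM (SM _ _ sY sZ) (SM _ _ (SV _ sY) (SV _ sZ)).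
suff Sclosed x0 : (forall e : R, 0 < e ->
    exists2 q, S q & mxn (val (x0 * q)%g - 1%:M) <= e) -> S x0.
  exact: (@topologically_perfect R n GG S S1 SM SV Scomm Sclosed ss conn y).
(* For q in S, f(x0 q) = f(x0). Since x0 q can be taken arbitrarily close to 1 and f is continuous
   at 1, f(1) = f(x0). *)
move=> h x w ell; pose f y := ell (env (x * y)%g z w).
have f1 : f 1%g = f x0.
  apply: (cont1_eq (cont1_env x z w ell)) => e e0; have [q Sq hq] := h _ e0.
  exists (x0 * q)%g; last exact: hq.
  apply: etrans (Sq (x * x0)%g w ell).
  exact: (congr1 (fun q' => ell (env q' z w)) (mulgA x x0 q)).
apply: etrans (esym f1) _; exact: (congr1 (fun q => ell (env q z w)) (mulg1 x)).
Qed.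

End CentralInvariance.

(** * Finite-dimensional spans *)

Section FiniteSpan.
Variable F : fieldType.
Implicit Types V : lmodType F.

Lemma subspaceZ V (S : set V) a v : is_subspace S -> S v -> S (a *: v).
Proof. by case=> h0 hD Sv; rewrite -[_ *: v]addr0; exact: hD. Qed.

Lemma subspaceD V (S : set V) u v : is_subspace S -> S u -> S v -> S (u + v).
Proof. by case=> h0 hD Su Sv; rewrite -[u]scale1r; exact: hD. Qed.

Lemma subspace_sum V (S : set V) (I : Type) (r : seq I) (f : I -> V) :
  is_subspace S -> (forall i, S (f i)) -> S (\sum_(i <- r) f i).
Proof.
move=> hS hf; elim/big_ind: _ => [|u v|//]; first by case: hS.
exact: subspaceD.
Qed.

Definition seq_span V (s : seq V) : set V :=
  [set v | exists c : nat -> F, v = \sum_(i < size s) c i *: s`_i].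

Lemma seq_span_subspace V (s : seq V) : is_subspace (seq_span s).
Proof.
split; first by exists (fun=> 0); rewrite big1 // => i _; rewrite scale0r.
move=> a _ _ [c ->] [c' ->]; exists (fun i => a * c i + c' i).
rewrite scaler_sumr -big_split; apply: eq_bigr => i _.
by rewrite scalerDl scalerA.
Qed.

Lemma seq_span_cat V (s t : seq V) u v :
  seq_span s u -> seq_span t v -> seq_span (s ++ t) (u + v).
Proof.
move=> [c ->] [c' ->].
exists (fun i => if (i < size s)%N then c i else c' (i - size s)%N).
rewrite size_cat big_split_ord /=; congr (_ + _); apply: eq_bigr => i _.
  by rewrite ltn_ord nth_cat ltn_ord.
by rewrite nth_cat ltnNge leq_addr /= addKn.
Qed.

Lemma fin_dim_span_sub V (A B : set V) : A `<=` B -> fin_dim_span B -> fin_dim_span A.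
Proof. by move=> h [s hs]; exists s => v /h /hs. Qed.

Lemma fin_dim_span_sum V (T : Type) (P : set T) (I : Type) (r : seq I)
    (f : I -> T -> V) :
  (forall i, List.In i r -> fin_dim_span [set v | exists2 t, P t & v = f i t]) ->
  fin_dim_span [set v | exists2 t, P t & v = \sum_(i <- r) f i t].
Proof.
elim: r => [_|i r IH h].
  exists [::] => _ [t _ ->]; exists (fun=> 0).
  by rewrite big_nil big_ord0.
have [s hs] := IH (fun j hj => h j (or_intror hj)).
have [s' hs'] := h i (or_introl erefl).
exists (s' ++ s) => _ [t Pt ->]; rewrite big_cons.
by apply: seq_span_cat; [apply: hs'; exists t|apply: hs; exists t].
Qed.

Lemma fin_dim_span_linear V V' (f : V -> V') (A : set V) : linear f ->
  fin_dim_span A -> fin_dim_span [set v | exists2 u, A u & v = f u].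
Proof.
move=> lf [s hs]; exists (map f s) => _ [u /hs[c ->] ->]; exists c.
have f0 : f 0 = 0 by have := lf (-1) 0 0; rewrite scaler0 add0r scaleN1r addNr.
have fS (r : seq 'I_(size s)) : f (\sum_(i <- r) c i *: s`_i) = \sum_(i <- r) c i *: f s`_i.
  elim: r => [|i r IH]; first by rewrite !big_nil.
  by rewrite !big_cons lf IH.
rewrite size_map fS; apply: eq_bigr => i _.
by rewrite (nth_map 0).
Qed.

Lemma lin_indep_size V (s : seq V) m (e : 'I_m -> V) : lin_indep e ->
  (forall i, seq_span s (e i)) -> (m <= size s)%N.
Proof.
move=> he hs.
pose A : 'M[F]_(m, size s) := \matrix_(i, j) sval (cid (hs i)) j.
have eA i : e i = \sum_j A i j *: s`_j.
  rewrite {1}(svalP (cid (hs i))); apply: eq_bigr => j _.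
  by rewrite mxE.
have : row_free A.
  rewrite -kermx_eq0; apply/rowV0P => u /sub_kermxP uA; apply/rowP => i; rewrite mxE.
  apply: he; under eq_bigr do rewrite eA scaler_sumr; rewrite exchange_big big1 //= => j _.
  under eq_bigr do rewrite scalerA; rewrite -scaler_suml.
  have := congr1 (fun B : 'rV_(size s) => B 0 j) uA; rewrite !mxE => ->.
  by rewrite scale0r.
by move/eqP <-; exact: rank_leq_col.
Qed.

(** An independent family in S of maximal size spans S; the sizes are bounded by
    [lin_indep_size]. *)
Lemma subspace_basis V (S : set V) (s : seq V) : is_subspace S -> S `<=` seq_span s ->
  exists m (e : 'I_m -> V), [/\ lin_indep e, forall i, S (e i) &
    forall v, S v -> exists c : 'I_m -> F, v = \sum_i c i *: e i].
Proof.
move=> hS hs; pose P m := `[< exists2 e : 'I_m -> V, lin_indep e & forall i, S (e i) >].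
have P0 : exists m, P m.
  by exists 0; apply/asboolP; exists (fun=> 0); [move=> a _ []|case].
have Pmax m : P m -> (m <= size s)%N.
  by move=> /asboolP[e he Se]; apply: lin_indep_size he _ => i; exact: hs.
case: (ex_maxnP P0 Pmax) => m /asboolP[e he Se] hmax; exists m, e; split=> // v Sv.
apply: contrapT => nv.
suff : P m.+1 by move/hmax; rewrite ltnn.
apply/asboolP; exists (fun i => oapp e v (unlift ord0 i)); last first.
  by move=> i; case: (unlift _ _) => //= j; exact: Se.
move=> a; rewrite big_ord_recl unlift_none /=.
under eq_bigr do rewrite liftK /=.
move=> h; have a0 : a ord0 = 0.
  apply/eqP/negP => /negP na; apply: nv.
  exists (fun i => - (a ord0)^-1 * a (lift ord0 i)).
  under eq_bigr do rewrite -scalerA; rewrite -scaler_sumr scaleNr.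
  apply/eqP; rewrite -subr_eq0 opprK; apply/eqP.
  have e1 : v = (a ord0)^-1 *: (a ord0 *: v) by rewrite scalerA mulVf // scale1r.
  by rewrite {1}e1 -scalerDr h scaler0.
move: h; rewrite a0 scale0r add0r => /he h i.
by case: (unliftP ord0 i) => [j|] ->.
Qed.

End FiniteSpan.

Section ContinuousMatrix.
Variables (R : realType) (n : nat) (GG : alg_group n).
Local Notation C := R[i].
Local Notation G := (points GG R).

Lemma ltc_Re (e : C) : 0 < e -> 0 < complex.Re e /\ e = ((complex.Re e)%:C)%C.
Proof. by case: e => a b; rewrite ltcE /= => /andP[/eqP -> a0]. Qed.

Lemma extends_near (K : set G) (f : G -> R) x (e : R) :
  locally_extends (@differentiable_on R n) K f -> K x -> 0 < e ->
  \forall y \near within K (nbhs x), `|f x - f y| < e.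
Proof.
move=> hf Kx e0; have [U [F [oU Ux dF hF]]] := hf x Kx.
have cF : {for val x, continuous F} by apply: differentiable_continuous; exact: dF.
have cv : {for x, continuous (val : G -> 'M[R]_n)} by exact: initial_continuous.
have h1 : \forall y \near nbhs x, U (val y) := cv _ (open_nbhs_nbhs (conj oU Ux)).
have h2 : \forall y \near nbhs x, `|F (val x) - F (val y)| < e.
  by move/cvgrPdist_lt: cF => /(_ _ e0) h2; exact: (cv _ h2).
apply: filterS (filterI h1 h2) => y [Uy hy] Ky.
by rewrite !hF.
Qed.

Lemma normc_le_ReIm (z : C) : Normc.normc z <= `|complex.Re z| + `|complex.Im z|.
Proof.
have -> : z = (complex.Re z)%:C%C + Complex 0 1 * (complex.Im z)%:C%C.
  by case: z => a b; apply/eqP; rewrite eq_complex /=; apply/andP; split; apply/eqP => /=; ring.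
apply: le_trans (normcD _ _) _; rewrite normcM !normc_real.
have -> : Normc.normc (Complex 0 1 : C) = 1.
  by rewrite /Normc.normc /= expr0n expr1n add0r sqrtr1.
rewrite mul1r; case: z => a b /=.
by rewrite !mulr0 !mul0r !mul1r ?subr0 ?addr0 ?add0r.
Qed.

Lemma within_continuous_mx (K : set G) m (rho : G -> 'M[C]_m) :
  (forall i j, locally_extendsC (@differentiable_on R n) K (fun k => rho k i j)) ->
  {within K, continuous (rho : G -> 'M[C^o]_m)}.
Proof.
move=> h; apply/subspace_continuousP => x Kx.
apply/(@cvg_ballP C _ _ _ _ (rho : G -> 'M[C^o]_m)) => e e1; have [e0 ee] := ltc_Re e1.
have e2 : 0 < complex.Re e / 2 by rewrite divr_gt0.
have H : \forall y \near within K (nbhs x), forall ij : 'I_m * 'I_m,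
    `|rho x ij.1 ij.2 - rho y ij.1 ij.2| < e.
  apply: filter_forall => -[i j]; have [hR hI] := h i j.
  apply: filterS (filterI (extends_near hR Kx e2) (extends_near hI Kx e2)) => y [h1 h2] /=.
  rewrite ee ltcR; apply: le_lt_trans (normc_le_ReIm _) _.
  by rewrite !raddfB /= [complex.Re e]splitr; exact: ltrD.
apply: filterS H => k H; split=> // i j.
by have := H (i, j); rewrite -ball_normE.
Qed.

End ContinuousMatrix.

(** * Finiteness of the action of the center on a weight *)

Section CentralOnWeights.
Variables (R : realType) (n : nat) (GG : alg_group n).
Local Notation C := R[i].
Local Notation G := (points GG R).
Local Notation g := (gC R GG).
Hypothesis G_ss : connected_semisimple_real GG R.
Variables (K : set G) (W : gk_rep R GG).
Hypotheses (K_sub : is_subgroup K) (W_weight : weight K W).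
Local Notation "u ⋅ w" := (env_act (fun X => gk_lie W X) u w) (at level 35).

Lemma gk_lie_lin (a : C) (X Y : g) (w : W) :
  gk_lie W (a *: X + Y) w = a *: gk_lie W X w + gk_lie W Y w.
Proof. by case: W_weight => -[[[+ _] _ _ _ _] _ _] _ _; apply. Qed.

Lemma gk_lie_bracket (X Y Z : g) (w : W) : vsval Z = bracket (vsval X) (vsval Y) ->
  gk_lie W Z w = gk_lie W X (gk_lie W Y w) - gk_lie W Y (gk_lie W X w).
Proof. by case: W_weight => -[[[_ +] _ _ _ _] _ _] _ _; apply. Qed.

Lemma gk_grp_env k (u : free_env R GG) (w : W) : K k ->
  gk_grp W k (u ⋅ w) = env_act (fun X => Ad_act (@gk_lie _ _ _ W) k X) u (gk_grp W k w).
Proof.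
move=> Kk; rewrite /env_act linear_sum; apply: eq_bigr => m _; rewrite linearZ.
congr (_ *: _); elim: (monalg.fmonom_val m) => [//|X s IH] /=; rewrite -IH.
case: W_weight => -[[_ _ h _ _] _ _] _ _; apply: h => //; exact: Ad_val.
Qed.

(** The inner product against u - v is a linear functional that distinguishes u from v unless they
    are equal. *)
Lemma weight_separated (u v : W) :
  (forall ell : {linear W -> C^o}, ell u = ell v) -> u = v.
Proof.
case: W_weight => _ _ [h [hl _ hp _ _]] e; apply/eqP; rewrite -subr_eq0; apply/negP => /negP nz.
have hlin : linear (fun x => h x (u - v) : C^o) by move=> a x y; exact: hl.
pose ell : {linear W -> C^o} := HB.pack (fun x => h x (u - v) : C^o)
  (GRing.isLinear.Build C W C^o *:%R _ hlin).
have := hp _ nz; have := linearB ell u v; rewrite (e ell) subrr /= => ->.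
by rewrite ltxx.
Qed.

(** In general k (z w) = (Ad(k) z)(k w), and here Ad(k) z acts as z. *)
Lemma env_central_grp (z : free_env R GG) k (w : W) : env_central z -> K k ->
  gk_grp W k (z ⋅ w) = z ⋅ gk_grp W k w.
Proof.
move=> hz Kk; rewrite gk_grp_env //; apply: weight_separated => ell.
have := env_central_Ad gk_lie_lin gk_lie_bracket G_ss hz 1%g k (gk_grp W k w) ell.
rewrite mul1g => ->.
suff -> : (fun X => Ad_act (@gk_lie _ _ _ W) 1%g X : W -> W) = fun X => gk_lie W X by [].
by apply/funext => X; rewrite /Ad_act Ad1.
Qed.

(** The span of the K-orbit of one nonzero vector is K-stable, hence all of S by simplicity, and it
    is finite-dimensional by local finiteness. *)
Lemma simple_finite (S : set W) : simple_sub (grp_acts K W) S ->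
  exists s : seq W, S `<=` seq_span s.
Proof.
case=> [hS sS [v0 Sv0 nz] min].
have [[_ [g1 gM] _ [locfin _] _] _ _] : harish_chandra K W by case: W_weight.
have [s hs] := locfin v0; exists s.
pose T : set W := [set v | forall S' : set W, is_subspace S' ->
  (forall k, K k -> S' (gk_grp W k v0)) -> S' v].
have K1 : K 1%g by case: K_sub.
have KM k k' : K k -> K k' -> K (k * k')%g.
  case: K_sub => _ h Kk Kk'; have := h _ _ Kk (h _ _ K1 Kk').
  by rewrite mul1g invgK.
have hT : is_subspace T.
  split; first by move=> S' [].
  by move=> a u v Tu Tv S' hS' h; case: (hS') => _; apply; [exact: Tu|exact: Tv].
have Tv0 : T v0 by move=> S' _ /(_ _ K1); rewrite g1.
have sT : stable (grp_acts K W) T.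
  move=> _ v [k Kk ->] Tv S' hS' h.
  apply: (Tv [set u | S' (gk_grp W k u)]) => [|k' Kk'] /=.
    case: hS' => h0 hD; split; first by rewrite /= linear0.
    by move=> a x y /= hx hy; rewrite linearP; exact: hD.
  by rewrite -gM //; apply: h; exact: KM.
have TS : T `<=` S.
  move=> v /(_ S hS); apply => k Kk; apply: sS Sv0; by exists k.
case: (min T hT sT TS) => [/(_ _ Tv0) /= v00|ST].
  by rewrite v00 eqxx in nz.
apply: subset_trans ST _ => v /(_ _ (seq_span_subspace s)); apply => k Kk.
by apply: hs; exists k.
Qed.

(** A basis of S turns it into a matrix representation [rho] of K, irreducible because S is simple
    and continuous because the action is differentiable. For central z the map v |-> z (Phi v)
    intertwines [rho] with W, so it lies in a finite-dimensional space by admissibility; it is then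
    evaluated at the coordinates of x. *)
Lemma central_simple_finite (S : set W) (x : W) : simple_sub (grp_acts K W) S -> S x ->
  fin_dim_span [set v | exists2 z, env_central z & v = z ⋅ x].
Proof.
move=> simS Sx; have [s hs] := simple_finite simS.
case: (simS) => [hS sS [v0 Sv0 nz] min].
have [[_ [g1 gM] _ _ dif] _ adm] : harish_chandra K W by case: W_weight.
have [m [e [he Se span]]] := subspace_basis hS hs.
have K1 : K 1%g by case: K_sub.
have KM k k' : K k -> K k' -> K (k * k')%g.
  case: K_sub => _ h Kk Kk'; have := h _ _ Kk (h _ _ K1 Kk').
  by rewrite mul1g invgK.
(* Off K any matrix will do; this makes [rho] a function on the whole group. *)
have ex k : exists A : 'M[C]_m, K k -> forall j, gk_grp W k (e j) = \sum_i A i j *: e i.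
  have [Kk|] := pselect (K k); last by exists 0.
  have h j : exists c : 'I_m -> C, gk_grp W k (e j) = \sum_i c i *: e i.
    by apply: span; apply: sS (Se j); exists k.
  exists (\matrix_(i, j) sval (cid (h j)) i) => _ j.
  rewrite {1}(svalP (cid (h j))); apply: eq_bigr => i _; by rewrite mxE.
pose rho k := sval (cid (ex k)).
have rhoE k : K k -> forall j, gk_grp W k (e j) = \sum_i rho k i j *: e i.
  exact: svalP (cid (ex k)).
pose Phi (v : 'cV[C]_m) : W := \sum_i v i 0 *: e i.
have lPhi : linear Phi.
  move=> a u v; rewrite /Phi scaler_sumr -big_split; apply: eq_bigr => i _ /=.
  by rewrite !mxE scalerDl scalerA.
have Phi_inj u v : Phi u = Phi v -> u = v.
  move=> h; apply/colP => i; apply/eqP; rewrite -subr_eq0; apply/eqP.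
  apply: (he (fun i => u i 0 - v i 0)); under eq_bigr do rewrite scalerBl.
  by rewrite sumrB; apply/eqP; rewrite subr_eq0; apply/eqP.
have PhiK k v : K k -> Phi (rho k *m v) = gk_grp W k (Phi v).
  move=> Kk; rewrite /Phi linear_sum.
  under [RHS]eq_bigr do rewrite linearZZ rhoE // scaler_sumr.
  rewrite exchange_big; apply: eq_bigr => i _ /=.
  rewrite mxE scaler_suml; apply: eq_bigr => j _.
  by rewrite scalerA mulrC.
have PhiS v : S (Phi v).
  by apply: subspace_sum => // i; exact: subspaceZ.
have Phi_surj w : S w -> exists v, w = Phi v.
  move=> /span[c ->]; exists (\col_i c i); apply: eq_bigr => i _; by rewrite mxE.
have mx_ext (A B : 'M[C]_m) : (forall v : 'cV_m, A *m v = B *m v) -> A = B.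
  move=> h; apply/matrixP => i j.
  by have := congr1 (fun u : 'cV_m => u i 0) (h (delta_mx j 0)); rewrite -!colE !mxE.
have irr : irreducible_K_rep K rho.
  split.
  - apply: mx_ext => v; apply: Phi_inj.
    by rewrite mul1mx PhiK // g1.
  - move=> k k' Kk Kk'; apply: mx_ext => v; apply: Phi_inj.
    by rewrite (PhiK _ _ (KM _ _ Kk Kk')) gM // -mulmxA !PhiK.
  - by apply: within_continuous_mx; case: (dif m e rho he rhoE).
  split=> //.
    have [v hv] := Phi_surj _ Sv0; exists v => //; apply: contra nz => /eqP v0E.
    by rewrite hv v0E /Phi big1 // => i _; rewrite mxE scale0r.
  move=> T hT sT _; pose T' := [set Phi v | v in T].
  have hT' : is_subspace T'.
    case: hT => T0 TD; split.
      by exists 0 => //; rewrite /Phi big1 // => i _; rewrite mxE scale0r.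
    move=> a _ _ [u Tu <-] [v Tv <-]; exists (a *: u + v); [exact: TD|exact: lPhi].
  have sT' : stable (grp_acts K W) T'.
    move=> _ _ [k Kk ->] [v Tv <-]; exists (rho k *m v); last exact: PhiK.
    by apply: (sT (mulmx (rho k)) v) => //; exists k.
  have TS : T' `<=` S by move=> _ [v _ <-].
  case: (min T' hT' sT' TS) => h; [left=> v Tv|right=> v _].
    apply: Phi_inj; rewrite (h (Phi v)) /=; last by exists v.
    by rewrite /Phi big1 // => i _; rewrite mxE scale0r.
  by have [u Tu /Phi_inj <-] := h _ (PhiS v).
have [t ht] := adm m rho irr.
have [a ->] := Phi_surj _ Sx.
exists [seq T a | T <- t] => _ [z hz ->].
pose T v := z ⋅ Phi v.
have KT : K_hom K rho W T.
  split=> [c u v|k Kk v]; first by rewrite /T lPhi env_act_linear.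
  by rewrite /T PhiK // env_central_grp.
have [c hc] := ht T KT; exists c.
rewrite size_map -[LHS]/(T a) hc fct_sumE; apply: eq_bigr => i _.
by rewrite (nth_map 0).
Qed.

(** By semisimplicity w is a finite sum of vectors lying in simple K-submodules. *)
Lemma central_finite (w : W) :
  fin_dim_span [set v | exists2 z, env_central z & v = z ⋅ w].
Proof.
have [[_ _ _ [_ ss] _] _ _] : harish_chandra K W by case: W_weight.
have [s -> hs] := ss w.
have -> : [set v | exists2 z, env_central z & v = z ⋅ \sum_(x <- s) x] =
    [set v | exists2 z, env_central z & v = \sum_(x <- s) z ⋅ x].
  suff e z : z ⋅ \sum_(x <- s) x = \sum_(x <- s) z ⋅ x.
    by apply/seteqP; split=> v /= [z hz ->]; exists z => //; rewrite e.
  elim: {hs} s => [|x s IH]; first by rewrite !big_nil env_act0r.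
  by rewrite !big_cons env_actDr IH.
apply: (@fin_dim_span_sum C W _ (fun z => env_central z) _ s (fun x z => z ⋅ x)) => x xs.
have [|S simS Sx] := hs x; last exact: central_simple_finite simS Sx.
by elim: s xs {hs} => [//|y s IH] /= [->|/IH h]; rewrite inE ?eqxx // h orbT.
Qed.

Lemma intertwines_env (V : lmodType C) (lieV : g -> V -> V) grpV (F : W -> V) u w :
  intertwines K (fun X => gk_lie W X) (fun k => gk_grp W k) lieV grpV F ->
  F (u ⋅ w) = env_act lieV u (F w).
Proof.
case=> lF gF _.
have F0 : F 0 = 0 by have := lF (-1) 0 0; rewrite scaler0 add0r scaleN1r addNr.
have FS (r : seq (monalg.fmonom g)) (c : _ -> C) f :
    F (\sum_(i <- r) c i *: f i) = \sum_(i <- r) c i *: F (f i).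
  elim: r => [|i r IH]; first by rewrite !big_nil.
  by rewrite !big_cons lF IH.
rewrite /env_act FS; apply: eq_bigr => m _; congr (_ *: _).
by elim: (monalg.fmonom_val m) => [//|X s IH] /=; rewrite gF IH.
Qed.

Lemma intertwines_Z_finite (F : W -> (G -> C)) w :
  intertwines K (fun X => gk_lie W X) (fun k => gk_grp W k) rderiv rtrans F ->
  Z_finite (F w).
Proof.
move=> hF; case: (hF) => lF _ _.
apply: fin_dim_span_sub (fin_dim_span_linear lF (central_finite w)) => _ [z hz ->].
exists (z ⋅ w); first by exists z.
by rewrite (intertwines_env z w hF).
Qed.

End CentralOnWeights.

Import -(notations) monalg.

(** * Products of modular forms *)

Section TensorInduction.
Variables (F : fieldType).
Implicit Types V W U : lmodType F.

Lemma linear_fun0 V U (f : V -> U) : linear f -> f 0 = 0.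
Proof. by move=> lf; have := lf (-1) 0 0; rewrite scaler0 add0r scaleN1r addNr. Qed.

Lemma linear_funD V U (f : V -> U) : linear f -> {morph f : x y / x + y}.
Proof. by move=> lf x y; have := lf 1 x y; rewrite !scale1r. Qed.

Lemma linear_funZ V U (f : V -> U) a x : linear f -> f (a *: x) = a *: f x.
Proof. by move=> lf; have := lf a x 0; rewrite (linear_fun0 lf) !addr0. Qed.

(** No case for scalars is required: a scalar is absorbed into the first factor of a pure tensor. *)
Lemma tens_ind V W (Q : tens V W -> Prop) : Q 0 -> (forall t u, Q t -> Q u -> Q (t + u)) ->
  (forall v w, Q (tprod v w)) -> forall t, Q t.
Proof.
move=> Q0 QD QU t; rewrite -[t]repr_tensK [repr_tens t]monalg.monalgE.
have pi0 : pi_tens (0 : free_tens V W) = 0 :> tens V W.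
  apply: (addrI (pi_tens (0 : free_tens V W))).
  by rewrite [RHS]addr0 -pi_tensD addr0.
elim/big_ind: _ => [|u u' hu hu'|]; first by rewrite pi0.
  by rewrite pi_tensD; exact: QD.
move=> [v w] _; move: (monalg.mcoeff _ _) => a.
have -> : monalg.mkmalgU (v, w) a = a *: monalg.mkmalgU (v, w) 1 :> free_tens V W.
  by apply: (monalg.malgP _ _).1 => k; rewrite monalg.mcoeffZ !monalg.mcoeffU mulrnAr mulr1.
rewrite pi_tensZ -[tens_scale _ _]/(a *: tprod v w).
case: (tprod_bilin V W) => hl _.
by rewrite -(linear_funZ a v (hl w)); exact: QU.
Qed.

Lemma tens_ext V W U (f h : tens V W -> U) : linear f -> linear h ->
  (forall v w, f (tprod v w) = h (tprod v w)) -> f = h.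
Proof.
move=> lf lh e; apply/funext => t; elim/tens_ind: t => [|t u ht hu|//].
  by rewrite (linear_fun0 lf) (linear_fun0 lh).
by rewrite (linear_funD lf) (linear_funD lh) ht hu.
Qed.

End TensorInduction.

Section Products.
Variables (R : realType) (n : nat) (GG : alg_group n).
Local Notation C := R[i].
Local Notation G := (points GG R).
Local Notation g := (gC R GG).
Implicit Types f h : G -> C.

Lemma K_finite_lin (K : set G) (a : C) f h :
  K_finite K f -> K_finite K h -> K_finite K (a *: f + h).
Proof.
move=> [s hs] [t ht]; exists (s ++ t) => _ [k Kk ->].
have -> : rtrans k (a *: f + h) = a *: rtrans k f + rtrans k h by [].
apply: seq_span_cat; last by apply: ht; exists k.
by apply: subspaceZ; [exact: seq_span_subspace|apply: hs; exists k].
Qed.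

Lemma K_finite0 (K : set G) : K_finite K (0 : G -> C).
Proof.
by exists [::] => _ [k _ ->]; exists (fun=> 0); rewrite big_ord0; apply/funext.
Qed.

Lemma K_finiteM (K : set G) f h :
  K_finite K f -> K_finite K h -> K_finite K (fun x => f x * h x).
Proof.
move=> [s hs] [t ht].
(* Translates of the product are parametrised by the coefficients of the translates of f and h; each
   product of two spanning functions then contributes a span of dimension at most one. *)
pose T : Type := (nat -> C) * (nat -> C).
pose b (ij : 'I_(size s) * 'I_(size t)) (c : T) : G -> C :=
  (c.1 ij.1 * c.2 ij.2) *: (fun x => s`_ij.1 x * t`_ij.2 x : C).
apply: (@fin_dim_span_sub _ _ _
    [set v | exists2 c : T, setT c & v = \sum_(ij <- index_enum _) b ij c]).
  move=> _ [k Kk ->].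
  have [c hc] := hs _ (ex_intro2 _ _ k Kk erefl).
  have [c' hc'] := ht _ (ex_intro2 _ _ k Kk erefl).
  exists (c, c') => //; apply/funext => x.
  rewrite fct_sumE.
  have ef : rtrans k f x = \sum_(i < size s) (c i *: s`_i) x by rewrite hc fct_sumE.
  have eh : rtrans k h x = \sum_(i < size t) (c' i *: t`_i) x by rewrite hc' fct_sumE.
  transitivity ((\sum_(i < size s) (c i *: s`_i) x) * (\sum_(i < size t) (c' i *: t`_i) x)).
    by rewrite -ef -eh.
  rewrite mulr_suml; under eq_bigr do rewrite mulr_sumr.
  rewrite pair_bigA; apply: eq_bigr => ij _.
  by rewrite /b !fctE mulrACA.
apply: fin_dim_span_sum => ij _; exists [:: (fun x => s`_ij.1 x * t`_ij.2 x : C)] => _ [c _ ->].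
by exists (fun=> c.1 ij.1 * c.2 ij.2); rewrite big_ord1.
Qed.

Variables (Gamma : set G).

Lemma smooth_quotient_lin (a : C) f h : smooth_quotient Gamma f ->
  smooth_quotient Gamma h -> smooth_quotient Gamma (a *: f + h).
Proof.
move=> [sf hf] [sh hh]; split; first by apply: smoothD => //; exact: smoothZ.
by move=> c x Gc; rewrite !fctE hf // hh.
Qed.

Lemma smooth_quotientM f h : smooth_quotient Gamma f ->
  smooth_quotient Gamma h -> smooth_quotient Gamma (fun x => f x * h x).
Proof.
move=> [sf hf] [sh hh]; split; first exact: smoothM.
by move=> c x Gc; rewrite hf // hh.
Qed.

Lemma smooth_quotient0 : smooth_quotient Gamma (0 : G -> C).
Proof. by split=> //; exact: smooth0. Qed.

Lemma rderiv0 (X : g) : rderiv X (0 : G -> C) = 0.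
Proof.
have := @rderiv_lin R n GG X (-1) 0 0 (@smooth0 R n GG) (@smooth0 R n GG).
by rewrite scaler0 add0r scaleN1r addNr.
Qed.

Let mulr_linl (a b c d : C) : (a * b + c) * d = a * (b * d) + c * d.
Proof. by rewrite mulrDl mulrA. Qed.

Let mulr_linr (a b c d : C) : d * (a * b + c) = a * (d * b) + d * c.
Proof. by rewrite mulrDr mulrCA. Qed.

Lemma mul_bilin : bilin (fun f h : G -> C => (fun x => f x * h x) : G -> C).
Proof.
split=> h a f f'; apply/funext => x.
  exact: mulr_linl.
exact: mulr_linr.
Qed.

Section Pairing.
Variables (W1 W2 : gk_rep R GG).
Local Notation fun1 := (W1 -> (G -> C)).
Local Notation fun2 := (W2 -> (G -> C)).

Definition tens_prod (F1 : fun1) (F2 : fun2) (t : tens W1 W2) : G -> C :=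
  mult_tens (tens_map F1 F2 t).

Lemma tens_prod_linear (F1 : fun1) (F2 : fun2) : linear F1 -> linear F2 -> linear (tens_prod F1 F2).
Proof.
move=> l1 l2 a t u; rewrite /tens_prod (tens_map_linear l1 l2).
exact: (tens_lift_linear mul_bilin).
Qed.

Lemma tens_prodE (F1 : fun1) (F2 : fun2) v w : linear F1 -> linear F2 ->
  tens_prod F1 F2 (tprod v w) = (fun x => F1 v x * F2 w x).
Proof.
move=> l1 l2; rewrite /tens_prod /tens_map (tens_liftE (tens_map_bilin l1 l2)).
exact: (tens_liftE mul_bilin).
Qed.

Lemma tens_prod_linl (a : C) (F1 F1' : fun1) (F2 : fun2) t : linear F1 -> linear F1' -> linear F2 ->
  tens_prod (a *: F1 + F1') F2 t = a *: tens_prod F1 F2 t + tens_prod F1' F2 t.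
Proof.
move=> l1 l1' l2; have l : linear (a *: F1 + F1').
  by case: (@linear_subspace _ W1 (G -> C)) => _; apply.
have h := tens_prod_linear l l2; have h1 := tens_prod_linear l1 l2.
have h2 := tens_prod_linear l1' l2.
elim/tens_ind: t => [|t u IHt IHu|v w].
- by rewrite (linear_fun0 h) (linear_fun0 h1) (linear_fun0 h2) scaler0 addr0.
- by rewrite (linear_funD h) (linear_funD h1) (linear_funD h2) IHt IHu scalerDr addrACA.
rewrite !tens_prodE //; by apply/funext => x; exact: mulr_linl.
Qed.

Lemma tens_prod_linr (a : C) (F1 : fun1) (F2 F2' : fun2) t : linear F1 -> linear F2 -> linear F2' ->
  tens_prod F1 (a *: F2 + F2') t = a *: tens_prod F1 F2 t + tens_prod F1 F2' t.
Proof.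
move=> l1 l2 l2'; have l : linear (a *: F2 + F2').
  by case: (@linear_subspace _ W2 (G -> C)) => _; apply.
have h := tens_prod_linear l1 l; have h1 := tens_prod_linear l1 l2.
have h2 := tens_prod_linear l1 l2'.
elim/tens_ind: t => [|t u IHt IHu|v w].
- by rewrite (linear_fun0 h) (linear_fun0 h1) (linear_fun0 h2) scaler0 addr0.
- by rewrite (linear_funD h) (linear_funD h1) (linear_funD h2) IHt IHu scalerDr addrACA.
rewrite !tens_prodE //; by apply/funext => x; exact: mulr_linr.
Qed.

Lemma gk_tensor_lieE (X : g) (v : W1) (w : W2) :
  gk_lie (gk_tensor W1 W2) X (tprod v w) =
  tprod (gk_lie W1 X v) w + tprod v (gk_lie W2 X w).
Proof.
rewrite /=; congr (_ + _); rewrite /tens_map tens_liftE //; apply: tens_map_bilin => //;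
  exact: linearP.
Qed.

Lemma gk_tensor_grpE k (v : W1) (w : W2) :
  gk_grp (gk_tensor W1 W2) k (tprod v w) = tprod (gk_grp W1 k v) (gk_grp W2 k w).
Proof.
by rewrite /= /tens_map tens_liftE //; apply: tens_map_bilin => //; exact: linearP.
Qed.

End Pairing.
End Products.

Section ModularForms.
Variables (R : realType) (n : nat) (GG : alg_group n).
Local Notation C := R[i].
Local Notation G := (points GG R).
Local Notation g := (gC R GG).
Hypothesis G_ss : connected_semisimple_real GG R.
Variables (K Gamma : set G) (d : nat) (sigma : G -> 'M[C]_d) (H : 'M[C]_d).
Hypotheses (K_sub : is_subgroup K) (sigmaP : norm_data K sigma H).

(* The conditions on automorphic forms other than Z-finiteness; unlike the latter they
   are inherited by products. *)
Definition pre_automorphic (f : G -> C) : Prop :=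
  [/\ smooth_quotient Gamma f, moderate_growth sigma H f & K_finite K f].

Lemma pre_automorphic_lin (a : C) f h : pre_automorphic f -> pre_automorphic h ->
  pre_automorphic (a *: f + h).
Proof.
move=> [f1 f2 f3] [h1 h2 h3]; split; first exact: smooth_quotient_lin.
  exact: (moderate_growth_lin G_ss sigmaP).
exact: K_finite_lin.
Qed.

Lemma pre_automorphicM f h : pre_automorphic f -> pre_automorphic h ->
  pre_automorphic (fun x => f x * h x).
Proof.
move=> [f1 f2 f3] [h1 h2 h3]; split; first exact: smooth_quotientM.
  exact: moderate_growthM.
exact: K_finiteM.
Qed.

Lemma pre_automorphic0 : pre_automorphic 0.
Proof.
split; first exact: smooth_quotient0; last exact: K_finite0.
exact: moderate_growth0.
Qed.

Local Notation forms W := (modular_forms K Gamma sigma H W).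
Local Notation intertw W := (intertwines K (fun X => gk_lie W X) (fun k => gk_grp W k)
  rderiv rtrans).

(** Z-finiteness of the values is automatic for an intertwining map defined on a weight, so only the
    conditions stable under sums and products have to be checked. *)
Lemma modular_formsP (W : gk_rep R GG) (F : W -> (G -> C)) : weight K W ->
  intertw W F -> (forall w, pre_automorphic (F w)) -> forms W F.
Proof.
move=> hW iF aF; split=> // w; have [h1 h2 h3] := aF w; split=> //.
exact: intertwines_Z_finite iF.
Qed.

Lemma modular_forms_pre (W : gk_rep R GG) (F : W -> (G -> C)) w :
  forms W F -> pre_automorphic (F w).
Proof. by case=> _ /(_ w)[]. Qed.

Lemma modular_forms_linear (W : gk_rep R GG) (F : W -> (G -> C)) :
  forms W F -> linear F.
Proof. by case=> -[]. Qed.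

Lemma modular_forms_subspace (W : gk_rep R GG) : weight K W -> is_subspace (forms W).
Proof.
move=> hW; case: (@linear_subspace _ W (G -> C)) => l0 lD.
split.
  apply: (modular_formsP hW) => [|w]; last exact: pre_automorphic0.
  by split=> // X v; rewrite rderiv0.
move=> a p q hp hq; case: (hp) (hq) => -[lp gp kp] _ [[lq gq kq] _].
apply: (modular_formsP hW) => [|w]; last first.
  by apply: pre_automorphic_lin; exact: modular_forms_pre.
split; first exact: lD.
  move=> X v; rewrite [LHS]/(a *: p _ + q _) gp gq.
  have [[sp _] _ _] := modular_forms_pre v hp.
  have [[sq _] _ _] := modular_forms_pre v hq.
  exact: esym (rderiv_lin X a sp sq).
move=> k Kk v; rewrite [LHS]/(a *: p _ + q _) (kp k Kk) (kq k Kk); exact: erefl.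
Qed.

Section Pairing.
Variables (W1 W2 : gk_rep R GG) (F1 : W1 -> (G -> C)) (F2 : W2 -> (G -> C)).
Hypotheses (hF1 : forms W1 F1) (hF2 : forms W2 F2).
Let l1 := modular_forms_linear hF1.
Let l2 := modular_forms_linear hF2.
Let lV := tens_prod_linear l1 l2.

Lemma tens_prod_pre t : pre_automorphic (tens_prod F1 F2 t).
Proof.
elim/tens_ind: t => [|t u ht hu|v w].
- by rewrite (linear_fun0 lV); exact: pre_automorphic0.
- rewrite (linear_funD lV) -[tens_prod F1 F2 t]scale1r; exact: pre_automorphic_lin.
rewrite (tens_prodE _ _ l1 l2).
by apply: pre_automorphicM; exact: modular_forms_pre.
Qed.

Lemma tens_prod_lie (X : g) t :
  tens_prod F1 F2 (gk_lie (gk_tensor W1 W2) X t) = rderiv X (tens_prod F1 F2 t).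
Proof.
elim/tens_ind: t => [|t u ht hu|v w].
- by rewrite linear0 (linear_fun0 lV) rderiv0.
- have [[st _] _ _] := tens_prod_pre t; have [[su _] _ _] := tens_prod_pre u.
  apply: etrans (congr1 _ (linearD (gk_lie (gk_tensor W1 W2) X) t u)) _.
  apply: etrans (linear_funD lV _ _) _; apply: etrans (congr2 _ ht hu) _.
  apply: etrans (esym (congr1 (rderiv X) (linear_funD lV t u))).
  by have := rderiv_lin X 1 st su; rewrite !scale1r => ->.
rewrite gk_tensor_lieE (linear_funD lV) !(tens_prodE _ _ l1 l2).
have [[sv _] _ _] := modular_forms_pre v hF1.
have [[sw _] _ _] := modular_forms_pre w hF2.
rewrite (rderivM X sv sw); case: (hF1) (hF2) => -[_ g1 _] _ [[_ g2 _] _].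
by rewrite g1 g2.
Qed.

Lemma tens_prod_grp k t : K k ->
  tens_prod F1 F2 (gk_grp (gk_tensor W1 W2) k t) = rtrans k (tens_prod F1 F2 t).
Proof.
move=> Kk; elim/tens_ind: t => [|t u ht hu|v w].
- by rewrite linear0 (linear_fun0 lV).
- apply: etrans (congr1 _ (linearD (gk_grp (gk_tensor W1 W2) k) t u)) _.
  apply: etrans (linear_funD lV _ _) _; apply: etrans (congr2 _ ht hu) _.
  exact: esym (congr1 (rtrans k) (linear_funD lV t u)).
rewrite gk_tensor_grpE !(tens_prodE _ _ l1 l2).
case: (hF1) (hF2) => -[_ _ k1] _ [[_ _ k2] _].
by rewrite (k1 k Kk) (k2 k Kk).
Qed.

Lemma m12_modular_form (W : gk_rep R GG) (mu : gk_hom K W (gk_tensor W1 W2)) :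
  weight K W -> forms W (m12 (val mu) F1 F2).
Proof.
move=> hW; have [lmu gmu kmu] : gk_homs K W (gk_tensor W1 W2) (val mu).
  exact/asboolP/(valP mu).
apply: (modular_formsP hW) => [|w]; last exact: (tens_prod_pre (val mu w)).
split.
- move=> a u v; exact: etrans (congr1 (tens_prod F1 F2) (lmu a u v)) (lV _ _ _).
- move=> X v; exact: etrans (congr1 (tens_prod F1 F2) (gmu X v)) (tens_prod_lie _ _).
move=> k Kk v; exact: etrans (congr1 (tens_prod F1 F2) (kmu k Kk v)) (tens_prod_grp _ Kk).
Qed.

End Pairing.

Section Correspondence.
Variables (W W1 W2 : gk_rep R GG) (W_weight : weight K W).
Variables (M : is_subspace (forms W)) (M1 : is_subspace (forms W1))
  (M2 : is_subspace (forms W2)).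
Local Notation homs := (gk_hom K W (gk_tensor W1 W2)).

Lemma submP (V : lmodType C) (S : set V) (hS : is_subspace S) (x : subm hS) : S (val x).
Proof. exact/asboolP/(valP x). Qed.

Lemma subm_val_lin (V : lmodType C) (S : set V) (hS : is_subspace S) a (x y : subm hS) :
  val (a *: x + y) = a *: val x + val y.
Proof. by []. Qed.

Lemma m12E (mu : W -> gk_tensor W1 W2) (F1 : W1 -> (G -> C)) (F2 : W2 -> (G -> C)) :
  m12 mu F1 F2 = tens_prod F1 F2 \o mu.
Proof. by []. Qed.

Definition co_form (mu : homs) (F1 : subm M1) (F2 : subm M2) : subm M :=
  Subm (introT (subspace_predP M _) (m12_modular_form (submP F1) (submP F2) mu W_weight)).

Lemma co_form_bilin mu : bilin (co_form mu).
Proof.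
have mE F1 F2 : val (co_form mu F1 F2) = tens_prod (val F1) (val F2) \o val mu by [].
have l1 (F : subm M1) := modular_forms_linear (submP (F : subm M1)).
have l2 (F : subm M2) := modular_forms_linear (submP (F : subm M2)).
split=> [F2|F1] a F F'; apply: val_inj.
  apply: etrans (esym (subm_val_lin a _ _)); rewrite !mE.
  apply/funext => w.
  have eF : val (a *: F + F') = a *: val F + val F' := subm_val_lin _ _ _.
  apply: etrans (congr1 (fun f => tens_prod f (val F2) (val mu w)) eF) _.
  exact: (tens_prod_linl a (val mu w) (l1 F) (l1 F') (l2 F2)).
apply: etrans (esym (subm_val_lin a _ _)); rewrite !mE.
apply/funext => w.
have eF : val (a *: F + F') = a *: val F + val F' := subm_val_lin _ _ _.
apply: etrans (congr1 (fun f => tens_prod (val F1) f (val mu w)) eF) _.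
exact: (tens_prod_linr a (val mu w) (l1 F1) (l2 F) (l2 F')).
Qed.

Definition co_map (mu : homs) : linhom (tens (subm M1) (subm M2)) (subm M) :=
  Subm (introT (subspace_predP (linear_subspace _ _) _)
    (tens_lift_linear (co_form_bilin mu))).

Lemma co_mapE mu F1 F2 : val (val (co_map mu) (tprod F1 F2)) = m12 (val mu) (val F1) (val F2).
Proof. by rewrite [val (co_map mu)]/= (tens_liftE (co_form_bilin mu)). Qed.

(** Linear maps on a tensor product are compared on pure tensors, where linearity in [mu] reduces to
    the linearity of [tens_prod F1 F2]. *)
Lemma co_map_linear : linear co_map.
Proof.
move=> a mu mu'; apply: val_inj.
have lT (nu : homs) : linear (val (co_map nu)) by exact: submP (co_map nu).
pose L := linear_subspace (tens (subm M1) (subm M2)) (subm M).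
apply: etrans (esym (@subm_val_lin _ _ L a (co_map mu) (co_map mu'))).
apply: tens_ext => [||F1 F2]; first exact: lT.
  by case: (@linear_subspace _ (tens (subm M1) (subm M2)) (subm M)) => _; apply; exact: lT.
apply: val_inj; apply: etrans (co_mapE _ _ _) _.
apply: etrans (esym (@subm_val_lin _ _ M a (val (co_map mu) (tprod F1 F2))
  (val (co_map mu') (tprod F1 F2)))).
apply: etrans (esym (congr2 (fun p q => a *: p + q) (co_mapE mu F1 F2) (co_mapE mu' F1 F2))).
rewrite !m12E; apply/funext => w.
apply: etrans (congr1 (fun f => tens_prod (val F1) (val F2) (f w)) (subm_val_lin a mu mu')) _.
exact: (tens_prod_linear (modular_forms_linear (submP F1)) (modular_forms_linear (submP F2))
  a (val mu w) (val mu' w)).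
Qed.

End Correspondence.
End ModularForms.

Theorem proposition2p2 (R : realType) (n : nat) (GG : alg_group n)
    (GG_ss : connected_semisimple_alg GG R[i])
    (G_ss : connected_semisimple_real GG R)
    (K : set (points GG R)) (K_max : maximal_compact K)
    (Gamma : set (points GG R)) (Gamma_arith : arithmetic_subgroup Gamma)
    (d : nat) (sigma : points GG R -> 'M[R[i]]_d) (H : 'M[R[i]]_d)
    (sigmaP : norm_data K sigma H)
    (W W1 W2 : gk_rep R GG)
    (W_weight : weight K W) (W1_weight : weight K W1) (W2_weight : weight K W2) :
  (forall (mu : gk_hom K W (gk_tensor W1 W2))
      (F1 : W1 -> (points GG R -> R[i])) (F2 : W2 -> (points GG R -> R[i])),
    modular_forms K Gamma sigma H W1 F1 ->
    modular_forms K Gamma sigma H W2 F2 ->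
    modular_forms K Gamma sigma H W (m12 (val mu) F1 F2))
  /\
  (exists (M : is_subspace (modular_forms K Gamma sigma H W))
          (M1 : is_subspace (modular_forms K Gamma sigma H W1))
          (M2 : is_subspace (modular_forms K Gamma sigma H W2))
          (Co : {linear gk_hom K W (gk_tensor W1 W2) ->
                        linhom (tens (subm M1) (subm M2)) (subm M)}),
    forall (mu : gk_hom K W (gk_tensor W1 W2)) (F1 : subm M1) (F2 : subm M2),
      val (val (Co mu) (tprod F1 F2)) = m12 (val mu) (val F1) (val F2)).
Proof.
have K_sub : is_subgroup K by case: K_max.
split; first by move=> mu F1 F2 h1 h2; exact: (m12_modular_form G_ss K_sub sigmaP).
pose M := modular_forms_subspace G_ss Gamma K_sub sigmaP W_weight.
pose M1 := modular_forms_subspace G_ss Gamma K_sub sigmaP W1_weight.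
pose M2 := modular_forms_subspace G_ss Gamma K_sub sigmaP W2_weight.
pose co := co_map G_ss K_sub sigmaP W_weight M M1 M2.
have co_lin : linear co by exact: co_map_linear.
pose Co : {linear gk_hom K W (gk_tensor W1 W2) ->
    linhom (tens (subm M1) (subm M2)) (subm M)} :=
  HB.pack co (GRing.isLinear.Build R[i] _ _ *:%R co co_lin).
by exists M, M1, M2, Co => mu F1 F2; exact: co_mapE.
Qed.
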